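(* Consider the two-community graph $\mathcal{K}_{2N}(w_1,w_2)$ with $w_1=1$, $w_2=N^{-\beta}$, and let $q=N^\alpha$, for some fixed $\alpha\in\mathbb{R}$ and $\beta>0$. Let $U^{(N)}_q(in)$ and $U^{(N)}_q(out)$ be the values of the pairwise LEP-interaction potential for two distinct vertices in the same community and for two vertices in different communities, respectively. Then: (a) if $1-\beta<\alpha=\frac12$, then $\lim_{N\to\infty}U^{(N)}_q(out)=1$ and $\lim_{N\to\infty}U^{(N)}_q(in)=\varepsilon_0(\beta)$ for some $\varepsilon_0(\beta)\in(0,1)$. (b) if $1-\beta<\alpha<\frac12$, then $\lim_{N\to\infty}U^{(N)}_q(out)=1$ and $\lim_{N\to\infty}U^{(N)}_q(in)=0$. (c) if $\alpha=1-\beta<\frac12$, then $\lim_{N\to\infty}U^{(N)}_q(out)=\varepsilon_2(\alpha,\beta)$ for some $\varepsilon_2(\alpha,\beta)\in(0,1)$ and $\lim_{N\to\infty}U^{(N)}_q(in)=0$. (d) if $\alpha<\min\{\frac12,1-\beta\}$, then $\lim_{N\to\infty}U^{(N)}_q(\star)=0$ for $\star\in\{in,out\}$. (e) if $\alpha=\frac12<1-\beta$, then $\lim_{N\to\infty}U^{(N)}_q(\star)=\varepsilon_1(\alpha,\beta)$ for $\star\in\{in,out\}$, for some $\varepsilon_1(\alpha,\beta)\in(0,1)$ (the same for $in$ and $out$). (f) if $\alpha>\frac12$, then $\lim_{N\to\infty}U^{(N)}_q(\star)=1$ for $\star\in\{in,out\}$.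
   Context: For a positive integer $M$, $[M]=\{1,\dots,M\}$. For $w_1,w_2>0$, $\mathcal{K}_{2N}(w_1,w_2)$ is the complete graph on $V=[2N]$ in which an edge $\{x,y\}$ has weight $w_1$ if $x,y\in[N]$ or $x,y\in[2N]\setminus[N]$ (same community), and weight $w_2$ otherwise (different communities). Let $G=(V,E,w)$ be a finite simple undirected connected weighted graph with edge weights $w:E\to[0,\infty)$. A spanning rooted forest $F$ of $G$ is a collection of vertex-disjoint rooted trees in $G$ whose vertex sets cover $V$; $|F|$ is its number of trees, $w(F)=\prod_{e\in F}w(e)$ is its weight (empty product equal to $1$), and $\Pi(F)$ is the partition of $V$ whose blocks are the vertex sets of the trees of $F$. For $q>0$, the loop-erased partition $\Pi_q$ is the random partition of $V$ with law $$\mathbb{P}(\Pi_q=\Pi)=\frac{1}{Z(q)}\sum_{F:\,\Pi(F)=\Pi}q^{|F|}w(F),\qquad Z(q)=\sum_{F}q^{|F|}w(F),$$ where sums are over spanning rooted forests of $G$ (the same tree with two different choices of root counts as two different rooted trees). For $x\in V$, $B_q(x)$ denotes the block of $\Pi_q$ containing $x$. The pairwise LEP-interaction potential is $U_q(x,y):=\mathbb{P}(B_q(x)\neq B_q(y))$ for distinct $x,y\in V$. On $\mathcal{K}_{2N}(w_1,w_2)$, by symmetry, $U_q(x,y)$ takes a common value $U^{(N)}_q(in)$ for all distinct $x,y$ in the same community and a common value $U^{(N)}_q(out)$ for all $x,y$ in different communities. *)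

(* Defs.v *)
From mathcomp Require Import all_boot all_order all_fingroup all_algebra.
From mathcomp Require Import all_classical all_reals all_analysis.
From mathcomp Require Import zify.

Set Implicit Arguments.
Unset Strict Implicit.
Unset Printing Implicit Defensive.

Import Order.TTheory GRing.Theory Num.Theory.
Import numFieldNormedType.Exports.

Local Open Scope ring_scope.

(* Edges are unordered pairs, i.e. two-element sets of vertices.  A finite
   weighted graph is given by its edge set [E : {set {set V}}] and a weight
   function [w : {set V} -> R], of which only the values on [E] matter. *)

Definition adj (V : finType) (D : {set {set V}}) : rel V :=
  fun x y => [set x; y] \in D.

Definition connected_graph (V : finType) (S : {set V}) (D : {set {set V}}) :
    bool :=
  [forall x in S, forall y in S, connect (adj D) x y].

Definition acyclic_graph (V : finType) (D : {set {set V}}) : bool :=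
  `[< forall c : seq V, (2 < size c)%N -> ~~ ucycleb (adj D) c >].

(* A candidate rooted tree is a triple (vertex set, edge set, root). *)
Notation rtree V := ({set V} * {set {set V}} * V)%type.

Definition rtree_verts (V : finType) (t : rtree V) : {set V} := t.1.1.
Definition rtree_edges (V : finType) (t : rtree V) : {set {set V}} := t.1.2.
Definition rtree_root (V : finType) (t : rtree V) : V := t.2.

Definition rooted_tree (V : finType) (E : {set {set V}}) (t : rtree V) : bool :=
  [&& rtree_root t \in rtree_verts t,
      rtree_edges t \subset E,
      [forall e in rtree_edges t, e \subset rtree_verts t],
      connected_graph (rtree_verts t) (rtree_edges t)
    & acyclic_graph (rtree_edges t)].

Definition spanning_rooted_forest (V : finType) (E : {set {set V}})
    (F : {set rtree V}) : bool :=
  [&& [forall t in F, rooted_tree E t],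
      [forall t in F, forall u in F,
         (t != u) ==> [disjoint rtree_verts t & rtree_verts u]]
    & \bigcup_(t in F) rtree_verts t == [set: V]].

Definition forest_weight (R : realType) (V : finType) (w : {set V} -> R)
    (F : {set rtree V}) : R :=
  \prod_(t in F) \prod_(e in rtree_edges t) w e.

Definition forest_partition (V : finType) (F : {set rtree V}) :
    {set {set V}} :=
  [set rtree_verts t | t in F].

Definition LEP_Z (R : realType) (V : finType) (E : {set {set V}})
    (w : {set V} -> R) (q : R) : R :=
  \sum_(F : {set rtree V} | spanning_rooted_forest E F)
     q ^+ #|F| * forest_weight w F.

Definition LEP_law (R : realType) (V : finType) (E : {set {set V}})
    (w : {set V} -> R) (q : R) (P : {set {set V}}) : R :=
  (LEP_Z E w q)^-1 *
  \sum_(F : {set rtree V} |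
          spanning_rooted_forest E F && (forest_partition F == P))
     q ^+ #|F| * forest_weight w F.

Definition LEP_prob (R : realType) (V : finType) (E : {set {set V}})
    (w : {set V} -> R) (q : R) (A : pred {set {set V}}) : R :=
  \sum_(P : {set {set V}} | finset.partition P [set: V] && A P) LEP_law E w q P.

Definition LEP_potential (R : realType) (V : finType) (E : {set {set V}})
    (w : {set V} -> R) (q : R) (x y : V) : R :=
  LEP_prob E w q (fun P => finset.pblock P x != finset.pblock P y).

(* The vertex set [2N] is 'I_(2 * N), numbered from 0. *)

Definition complete_edges (V : finType) : {set {set V}} :=
  [set e : {set V} | #|e| == 2%N].

Definition community1 (N : nat) : {set 'I_(2 * N)} :=
  [set x : 'I_(2 * N) | (x < N)%N].

Definition two_community_weight (R : realType) (N : nat) (w1 w2 : R)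
    (e : {set 'I_(2 * N)}) : R :=
  if (e \subset community1 N) || (e \subset ~: community1 N) then w1 else w2.

Definition same_community (N : nat) (x y : 'I_(2 * N)) : bool :=
  (x \in community1 N) == (y \in community1 N).

Definition two_community_potential (R : realType) (N : nat) (w1 w2 q : R)
    (x y : 'I_(2 * N)) : R :=
  LEP_potential (complete_edges _) (@two_community_weight R N w1 w2) q x y.

(* The common values of the potential.  [get] picks an element of a set; the
   sets below are inhabited by symmetry, see [U_inE] and [U_outE].  They are
   singletons unless N < 2 (for [U_in]) or N = 0 (for [U_out]), when there is no
   pair of vertices of the required kind and the value is arbitrary. *)

Definition U_in (R : realType) (N : nat) (w1 w2 q : R) : R :=
  get (fun u : R => forall x y : 'I_(2 * N), x != y -> same_community x y ->
                    two_community_potential w1 w2 q x y = u).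

Definition U_out (R : realType) (N : nat) (w1 w2 q : R) : R :=
  get (fun u : R => forall x y : 'I_(2 * N), ~~ same_community x y ->
                    two_community_potential w1 w2 q x y = u).

Section Symmetry.

Local Notation img s := (fun A : {set _} => [set s x | x in A]).

Lemma perm_imset_bij (T : finType) (s : T -> T) :
  injective s -> bijective (img s : {set T} -> {set T}).
Proof.
by move=> si; apply: injF_bij; apply: imset_inj.
Qed.

Definition rtree_map (V : finType) (s : V -> V) (t : rtree V) : rtree V :=
  (img s (rtree_verts t), img (img s) (rtree_edges t), s (rtree_root t)).

Section Fix.
Context (R : realType) (V : finType) (E : {set {set V}}) (w : {set V} -> R).
Context (q : R) (s : V -> V) (s_inj : injective s).
Context (sE : forall e : {set V}, ([set s x | x in e] \in E) = (e \in E)).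
Context (sw : forall e : {set V}, w [set s x | x in e] = w e).

Let s1 : {set V} -> {set V} := img s.
Let s1_inj : injective s1. Proof. exact: imset_inj. Qed.
Let s2 : {set {set V}} -> {set {set V}} := img s1.
Let s2_inj : injective s2. Proof. exact: imset_inj. Qed.

Lemma rtree_map_inj : injective (rtree_map s).
Proof.
move=> [[S D] r] [[S' D'] r'] [hS hD /s_inj ->].
by congr (_, _, _); [apply: s1_inj | apply: s2_inj].
Qed.

Let s3 : {set rtree V} -> {set rtree V} := img (rtree_map s).
Let s3_inj : injective s3.
Proof. exact/imset_inj/rtree_map_inj. Qed.

Lemma adj_map D x y : adj (s2 D) (s x) (s y) = adj D x y.
Proof.
by rewrite /adj -[RHS](mem_imset _ _ s1_inj) /s1 imsetU !imset_set1.
Qed.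

Lemma forall_bij (T : finType) (f : T -> T) (A : pred T) : injective f ->
  [forall x, A x] = [forall x, A (f x)].
Proof.
move=> fi; have [g _ gK] := injF_bij fi.
by apply/forallP/forallP => h x; [exact: h | rewrite -(gK x); exact: h].
Qed.

Lemma connect_map D x y :
  connect (adj (s2 D)) (s x) (s y) = connect (adj D) x y.
Proof.
have [g sK gK] := injF_bij s_inj.
apply/connectP/connectP => -[p hp hy].
  exists (map g p).
    have : path (adj (s2 D)) (s x) (map s (map g p)).
      by rewrite -map_comp (eq_map gK) map_id.
    by rewrite path_map; apply: sub_path => a b /=; rewrite adj_map.
  by apply: s_inj; rewrite hy -(last_map s) -map_comp (eq_map gK) map_id.
exists (map s p); last by rewrite last_map hy.
by rewrite path_map; apply: sub_path hp => a b /=; rewrite adj_map.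
Qed.

Lemma connected_map S D :
  connected_graph (s1 S) (s2 D) = connected_graph S D.
Proof.
rewrite /connected_graph (forall_bij _ s_inj); apply: eq_forallb => x.
rewrite (mem_imset _ _ s_inj) (forall_bij _ s_inj); congr (_ ==> _).
apply: eq_forallb => y.
by rewrite (mem_imset _ _ s_inj) connect_map.
Qed.

Lemma acyclic_map D : acyclic_graph (s2 D) = acyclic_graph D.
Proof.
have [g sK gK] := injF_bij s_inj.
have cm c : ucycleb (adj (s2 D)) (map s c) = ucycleb (adj D) c.
  rewrite /ucycleb map_inj_uniq //; congr (_ && _).
  by rewrite cycle_map; apply: eq_cycle => a b /=; rewrite adj_map.
apply: asbool_equiv_eq; split => h c hc.
  by rewrite -cm; apply: h; rewrite size_map.
have -> : c = map s (map g c) by rewrite -map_comp (eq_map gK) map_id.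
by rewrite cm; apply: h; rewrite size_map.
Qed.

Lemma imset_sub (A B : {set V}) : (s1 A \subset s1 B) = (A \subset B).
Proof.
apply/idP/idP => [/fintype.subsetP h|]; last exact: imsetS.
by apply/fintype.subsetP => x xA; rewrite -(mem_imset _ _ s_inj) h ?(mem_imset _ _ s_inj).
Qed.

Lemma rooted_tree_map t : rooted_tree E (rtree_map s t) = rooted_tree E t.
Proof.
rewrite /rooted_tree /= connected_map acyclic_map (mem_imset _ _ s_inj).
congr [&& _, _, _ & _].
  apply/fintype.subsetP/fintype.subsetP => h e.
    by move=> he; rewrite -sE; apply: h; rewrite (mem_imset _ _ s1_inj).
  by case/imsetP => f hf ->; rewrite sE h.
rewrite (forall_bij _ s1_inj); apply: eq_forallb => e.
by rewrite (mem_imset _ _ s1_inj) imset_sub.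
Qed.

Lemma imset_full : s1 [set: V] = [set: V].
Proof. by apply/eqP; rewrite eqEcard finset.subsetT /= card_imset. Qed.

Lemma forest_map F : spanning_rooted_forest E (s3 F) = spanning_rooted_forest E F.
Proof.
have ti := rtree_map_inj.
rewrite /spanning_rooted_forest; congr [&& _, _ & _].
- rewrite (forall_bij _ ti); apply: eq_forallb => t.
  by rewrite (mem_imset _ _ ti) rooted_tree_map.
- rewrite (forall_bij _ ti); apply: eq_forallb => t.
  rewrite (mem_imset _ _ ti); congr (_ ==> _).
  rewrite (forall_bij _ ti); apply: eq_forallb => u.
  rewrite (mem_imset _ _ ti) (inj_eq ti); congr (_ ==> (_ ==> _)).
  by rewrite imset_disjoint //; exact: in2W.
have h : \bigcup_(t in s3 F) rtree_verts t = s1 (\bigcup_(t in F) rtree_verts t).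
  rewrite big_imset /=; last exact: in2W.
  by rewrite -[RHS]/(imset _ _); elim/big_rec2: _ => [|t A B _ ->];
    rewrite ?imset0 ?imsetU.
by rewrite h -[RHS](inj_eq s1_inj) imset_full.
Qed.

Lemma forest_weight_map F : forest_weight w (s3 F) = forest_weight w F.
Proof.
rewrite /forest_weight big_imset /=; last by move=> ? ? _ _; apply: rtree_map_inj.
apply: eq_bigr => t _; rewrite big_imset /=; last by move=> ? ? _ _; apply: s1_inj.
by apply: eq_bigr => e _; rewrite sw.
Qed.

Lemma forest_partition_map F : forest_partition (s3 F) = s2 (forest_partition F).
Proof. by rewrite /forest_partition /s3 /s2 -!imset_comp. Qed.

Lemma LEP_law_map P : LEP_law E w q (s2 P) = LEP_law E w q P.
Proof.
rewrite /LEP_law; congr (_ * _).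
rewrite (reindex s3) /=; last exact/onW_bij/injF_bij.
apply: eq_big => F.
  by rewrite forest_map forest_partition_map (inj_eq s2_inj).
by rewrite forest_weight_map card_imset //; exact: rtree_map_inj.
Qed.

Lemma pblock_map P x : finset.partition P [set: V] ->
  finset.pblock (s2 P) (s x) = s1 (finset.pblock P x).
Proof.
move=> hP; have hP2 : finset.partition (s2 P) [set: V].
  by rewrite -imset_full imset_partition.
apply: def_pblock; first by case/and3P: hP2.
  rewrite (mem_imset _ _ s1_inj) pblock_mem //.
  by rewrite (cover_partition hP).
by rewrite (mem_imset _ _ s_inj) mem_pblock (cover_partition hP).
Qed.

Lemma LEP_potential_map x y :
  LEP_potential E w q (s x) (s y) = LEP_potential E w q x y.
Proof.
rewrite /LEP_potential /LEP_prob (reindex s2) /=; last exact/onW_bij/injF_bij.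
apply: eq_big => [P|P _]; last exact: LEP_law_map.
rewrite -{1}imset_full imset_partition //; apply: andb_id2l => hP.
by rewrite !pblock_map // (inj_eq s1_inj).
Qed.

End Fix.

Lemma potential_perm (R : realType) (N : nat) (w1 w2 q : R)
    (s : 'I_(2 * N) -> 'I_(2 * N)) : injective s ->
  (forall x y, same_community (s x) (s y) = same_community x y) ->
  forall x y, two_community_potential w1 w2 q (s x) (s y) =
              two_community_potential w1 w2 q x y.
Proof.
move=> si hs x y; apply: LEP_potential_map => // e.
  by rewrite !inE card_imset.
have weightE (f : {set 'I_(2 * N)}) : two_community_weight w1 w2 f =
    if [forall x in f, forall y in f, same_community x y] then w1 else w2.
  rewrite /two_community_weight; congr (if _ then _ else _).
  apply/orP/forall_inP => [[/fintype.subsetP h|/fintype.subsetP h] a af|h].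
  - by apply/forall_inP => b bf; rewrite /same_community !h.
  - apply/forall_inP => b bf.
    by have := h _ af; have := h _ bf; rewrite /same_community !inE => /negPf-> /negPf->.
  - have [/exists_inP[a af ac]|] := boolP [exists a in f, a \in community1 N].
      left; apply/fintype.subsetP => b bf.
      by have /forall_inP/(_ _ bf)/eqP <- := h _ af.
    rewrite negb_exists_in => /forall_inP nf; right; apply/fintype.subsetP => b bf.
    by rewrite inE nf.
rewrite !weightE; congr (if _ then _ else _).
rewrite (forall_bij _ si); apply: eq_forallb => a.
rewrite (mem_imset _ _ si) (forall_bij _ si); congr (_ ==> _).
by apply: eq_forallb => b; rewrite (mem_imset _ _ si) hs.
Qed.

Lemma same_tperm (N : nat) (a b : 'I_(2 * N)) : same_community a b ->
  forall x y, same_community (tperm a b x) (tperm a b y) = same_community x y.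
Proof.
move=> ab x y; have h z : (tperm a b z \in community1 N) = (z \in community1 N).
  by case: tpermP => // ->; rewrite (eqP ab).
by rewrite /same_community !h.
Qed.

Lemma mem_rev (N : nat) (x : 'I_(2 * N)) :
  (rev_ord x \in community1 N) = (x \notin community1 N).
Proof.
have := ltn_ord x; rewrite !inE /= => hx; rewrite -leqNgt; apply/idP/idP; lia.
Qed.

Lemma same_rev (N : nat) (x y : 'I_(2 * N)) :
  same_community (rev_ord x) (rev_ord y) = same_community x y.
Proof.
rewrite /same_community !mem_rev.
by case: (x \in _); case: (y \in _).
Qed.

Lemma same_trans (N : nat) : left_transitive (@same_community N).
Proof. by move=> x y /eqP xy z; rewrite /same_community xy. Qed.

Lemma potential_sym (R : realType) (N : nat) (w1 w2 q : R) (x y : 'I_(2 * N)) :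
  two_community_potential w1 w2 q x y =
  two_community_potential w1 w2 q y x :> R.
Proof. by apply: eq_bigl => P; rewrite (eq_sym (finset.pblock P x)). Qed.

Lemma potential_same (R : realType) (N : nat) (w1 w2 q : R)
    (x y x' y' : 'I_(2 * N)) :
  x != y -> x' != y' -> same_community x x' -> same_community y y' ->
  two_community_potential w1 w2 q x y =
  two_community_potential w1 w2 q x' y'.
Proof.
move=> xy xy' sx sy.
rewrite -(@potential_perm R N w1 w2 q (tperm x x') perm_inj (same_tperm sx)).
rewrite tpermL; set z := tperm x x' y.
have zx : x' != z by rewrite -(tpermL x x') (inj_eq perm_inj).
have sz : same_community z y'.
  move: sx sy; rewrite /z /same_community.
  by case: tpermP => [->|->|_ _ _ //] /eqP->.
rewrite -(@potential_perm R N w1 w2 q (tperm z y') perm_inj (same_tperm sz)).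
by rewrite tpermL tpermD // eq_sym.
Qed.

End Symmetry.

Lemma U_inE (R : realType) (N : nat) (w1 w2 q : R) (x y : 'I_(2 * N)) :
  x != y -> same_community x y ->
  two_community_potential w1 w2 q x y = U_in N w1 w2 q.
Proof.
move=> xy sxy; rewrite /U_in; set P := (X in get X).
suff : P (get P) by apply.
apply: (@getPex _ P); exists (two_community_potential w1 w2 q x y).
move=> x' y' xy' sxy'.
have [sx|nx] := boolP (same_community x' x).
  apply: potential_same => //; move: sx sxy sxy'; rewrite /same_community.
  by move=> /eqP-> /eqP<- /eqP<-.
rewrite -(@potential_perm R N w1 w2 q _ rev_ord_inj (@same_rev N)).
apply: potential_same => //; first by rewrite (inj_eq rev_ord_inj).
  by move: nx; rewrite /same_community mem_rev; case: (x' \in _); case: (x \in _).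
move: nx sxy sxy'; rewrite /same_community mem_rev => + /eqP<- /eqP<-.
by case: (x' \in _); case: (x \in _).
Qed.

Lemma U_outE (R : realType) (N : nat) (w1 w2 q : R) (x y : 'I_(2 * N)) :
  ~~ same_community x y ->
  two_community_potential w1 w2 q x y = U_out N w1 w2 q.
Proof.
move=> sxy; rewrite /U_out; set P := (X in get X).
suff : P (get P) by apply.
apply: (@getPex _ P); exists (two_community_potential w1 w2 q x y).
move=> x' y' sxy'.
have neq (a b : 'I_(2 * N)) : ~~ same_community a b -> a != b.
  by apply: contraNneq => ->; rewrite /same_community.
have [sx|nx] := boolP (same_community x' x).
  apply: potential_same; rewrite ?neq //.
  move: sx sxy sxy'; rewrite /same_community.
  by case: (x \in _); case: (y \in _); case: (x' \in _); case: (y' \in _).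
rewrite potential_sym; apply: potential_same; rewrite ?neq //.
- by move: sxy'; rewrite /same_community eq_sym.
- move: nx sxy sxy'; rewrite /same_community.
  by case: (x \in _); case: (y \in _); case: (x' \in _); case: (y' \in _).
- move: nx sxy sxy'; rewrite /same_community.
  by case: (x \in _); case: (y \in _); case: (x' \in _); case: (y' \in _).
Qed.

(* Main.v *)
Require Import Defs.
From mathcomp Require Import all_boot all_order all_fingroup all_algebra.
From mathcomp Require Import all_classical all_reals all_analysis.
From mathcomp Require Import zify ring lra.

Set Implicit Arguments.
Unset Strict Implicit.
Unset Printing Implicit Defensive.

Import Order.TTheory GRing.Theory Num.Theory.
Import numFieldNormedType.Exports.

Local Open Scope ring_scope.

(** Spanning rooted forests are acyclic parent functions, so the matrix-tree
    theorem turns their weighted counts into determinants.  Expanding the number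
    of vertices of a community in the tree of [x] along the path from [x] to its
    root gives a sum over self-avoiding paths; the term of a path is the
    determinant of a rank-three update of a triangular matrix and depends only on
    the numbers [a], [b] of vertices of the path in each community.  The potential
    is thereby a Green function of a killed walk with state (current community,
    [a], [b]).  Dynkin's formula applied to test functions of low degree expresses
    [U_in] and [U_out] exactly through the first moments of this walk, and further
    test functions bound the moments.  When [alpha = 1/2] the total mass of the
    walk is of order [sqrt N]: its limit is read off the test function
    [g (k / sqrt N)], [k = a + b], where [- g' + (1 + c s) g = 1], with [c = 1] if
    the walk stays in its community and [c = 1/2] if it equidistributes; then
    [eps0] and [eps1] are the values [g 0], while [eps2 = 1/3]. *)

(** In units of [1 / M], a step of the walk dies with rate [q + own + w * other]: the root weight
    plus the weight towards vertices already visited, [own] of them in the current community and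
    [other] in the opposite one. When [M] is of order [N], this self-avoidance alone stops a path
    after about [sqrt N] steps, and [alpha = 1/2] is where [q] competes with it. Crossings have rate
    about [N w]; the ratio [q / T], with [T = q + 2 N w], compares death with crossing, hence the
    threshold [alpha = 1 - beta], where [T = 3 q] and [1/3] arises. The obstacle is that the tree
    counts contain mixed second moments [a b]. They enter only through one sum, which two balance
    equations express by first moments; what is left involves [mass1], [mass2], [a_sum2] and
    [b_sum1], and crude bounds suffice unless [q * mass / N] stays of order one. In that case
    [q = sqrt N], and the rate [q + c k] at [k = s sqrt N] is [sqrt N (1 + c s)], which gives the
    differential equation; [c] is the fraction of visited vertices lying in the current
    community. *)

Section ParentFunctions.
Context (V : finType).
Implicit Types (f : {ffun V -> option V}) (v u r : V).

Definition parent f v := odflt v (f v).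

Definition rooted_fun f : bool :=
  `[< forall v, exists k, f (iter k (parent f) v) = None >].

Definition leads_to f v r : Prop :=
  exists k, iter k (parent f) v = r /\ f r = None.

Definition tree_root f v : V := odflt v [pick r | `[< leads_to f v r >]].

(** The rank is the number of steps to the root. Acyclicity is used and established through ranks: a
    modified parent function only needs a modified rank. *)
Lemma rooted_fun_rank f : rooted_fun f ->
  exists rk : V -> nat, forall v u, f v = Some u -> (rk u < rk v)%N.
Proof.
move=> /asboolP hf.
have hf' v : exists k, f (iter k (parent f) v) == None.
  by have [k hk] := hf v; exists k; apply/eqP.
exists (fun v => ex_minn (hf' v)) => v u fv.
case: (ex_minnP (hf' v)) => -[|k] /eqP hk _; first by rewrite /= fv in hk.
case: (ex_minnP (hf' u)) => l _ /(_ k); rewrite ltnS; apply.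
by move: hk; rewrite iterSr /parent fv => ->.
Qed.

Lemma rank_rooted_fun f (rk : V -> nat) :
  (forall v u, f v = Some u -> (rk u < rk v)%N) -> rooted_fun f.
Proof.
move=> hrk; apply/asboolP => v; have [m] := ubnP (rk v).
elim: m v => // m IH v; rewrite ltnS => hv.
case fv : (f v) => [u|]; last by exists 0%N.
have [|k hk] := IH u; first exact: leq_trans (hrk _ _ fv) hv.
by exists k.+1; rewrite iterSr {2}/parent fv.
Qed.

Lemma rooted_fun_ind f (P : V -> Prop) : rooted_fun f ->
  (forall v, f v = None -> P v) ->
  (forall v u, f v = Some u -> P u -> P v) -> forall v, P v.
Proof.
move=> /rooted_fun_rank[rk hrk] h0 hS v; have [m] := ubnP (rk v).
elim: m v => // m IH v; rewrite ltnS => hv.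
case fv : (f v) => [u|]; last exact: h0.
by apply: (hS _ _ fv); apply: IH; exact: leq_trans (hrk _ _ fv) hv.
Qed.

Lemma leads_to_uniq f v r r' : leads_to f v r -> leads_to f v r' -> r = r'.
Proof.
move=> [k [hk hr]] [l [hl hr']].
have fixr s m : f s = None -> iter m (parent f) s = s.
  by move=> fs; elim: m => //= m ->; rewrite /parent fs.
wlog kl : k l r r' hk hr hl hr' / (k <= l)%N.
  by move=> h; case/orP: (leq_total k l) => ?; [|symmetry]; apply: h; eassumption.
by rewrite -hl -(subnK kl) iterD hk fixr.
Qed.

Lemma tree_rootP f v r : leads_to f v r -> tree_root f v = r.
Proof.
move=> h; rewrite /tree_root; case: pickP => [s /asboolP hs|/(_ r)/asboolPn//].
exact: leads_to_uniq hs h.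
Qed.

Lemma tree_root_id f r : f r = None -> tree_root f r = r.
Proof. by move=> fr; apply: tree_rootP; exists 0%N. Qed.

Lemma leads_to_step f v u r :
  f v = Some u -> leads_to f u r -> leads_to f v r.
Proof. by move=> fv [k [hk fr]]; exists k.+1; rewrite iterSr {2}/parent fv. Qed.

Lemma leads_to_root f v : rooted_fun f -> leads_to f v (tree_root f v).
Proof.
move=> hf; move: v; apply: (rooted_fun_ind hf) => [v fv|v u fv hu].
  by rewrite tree_root_id //; exists 0%N.
by have h := leads_to_step fv hu; rewrite (tree_rootP h).
Qed.

Lemma tree_root_step f v u : rooted_fun f ->
  f v = Some u -> tree_root f v = tree_root f u.
Proof.
by move=> hf fv; apply/tree_rootP/(leads_to_step fv)/leads_to_root.
Qed.

Lemma root_of_tree_root f v : rooted_fun f -> f (tree_root f v) = None.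
Proof. by move=> hf; have [k []] := leads_to_root v hf. Qed.

Definition redirect f t (o : option V) : {ffun V -> option V} :=
  [ffun v => if v == t then o else f v].

Lemma redirect_root_rooted f t : rooted_fun f -> rooted_fun (redirect f t None).
Proof.
move=> /rooted_fun_rank[rk hrk]; apply: (@rank_rooted_fun _ rk) => v u.
by rewrite ffunE; case: eqP => // _; exact: hrk.
Qed.

(** If [z] lies in the tree of [t], the new edge closes a cycle through [t]; otherwise it grafts the
    tree of [t] onto that of [z]. *)
Lemma redirect_rooted f t z : f t = None -> rooted_fun f ->
  rooted_fun (redirect f t (Some z)) = (tree_root f z != t).
Proof.
move=> ft hf; have [rk hrk] := rooted_fun_rank hf.
apply/idP/idP => [hg|/eqP zt]; first apply/eqP => zt.
  have : forall v, tree_root f v != t.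
    apply: (rooted_fun_ind hg) => v => [|u];
      rewrite ffunE; case: (eqVneq v t) => [->|vt] //.
    - by move=> fv; rewrite tree_root_id.
    - by move=> [<-]; rewrite zt eqxx.
    - by move=> fv; rewrite (tree_root_step hf fv).
  by move=> /(_ t); rewrite tree_root_id // eqxx.
(* Lifting the whole tree of [t] by [K] puts it above every other rank, so the edge from [t] to [z]
   descends too. *)
pose K := (\max_v rk v).+1.
have rkK v : (rk v < K)%N by rewrite ltnS; apply: leq_bigmax.
apply: (@rank_rooted_fun _ (fun v => if tree_root f v == t then K + rk v else rk v)%N) => v u.
rewrite ffunE; case: (eqVneq v t) => [->|vt].
  move=> [<-]; rewrite (tree_root_id ft) eqxx.
  by case: eqP => // _; apply: leq_trans (rkK _) (leq_addr _ _).
move=> fv; rewrite (tree_root_step hf fv); have := hrk _ _ fv.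
by case: ifP => // _; rewrite ltn_add2l.
Qed.

End ParentFunctions.

(** * The weighted matrix-tree theorem for parent functions *)

Section MatrixTree.
Context (R : fieldType) (n : nat).
Implicit Types (f : {ffun 'I_n -> option 'I_n}) (W : 'I_n -> option 'I_n -> R).

Definition forest_fun_weight W f : R := \prod_v W v (f v).

Definition laplacian W : 'M[R]_n :=
  \matrix_(i, j) ((\sum_o W i o) * (i == j)%:R - W i (Some j)).

(** If some vertices never reach a root, their indicator is a kernel vector. Otherwise a permutation
    with a nonzero term sends each vertex to itself or to its parent, so it increases no rank; as it
    preserves the total rank, it is the identity. *)
Lemma det_parent_matrix f :
  \det (\matrix_(i, j) ((i == j)%:R - (f i == Some j)%:R) : 'M[R]_n) =
  (rooted_fun f)%:R.
Proof.
case: (boolP (rooted_fun f)) => hf; last first.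
  apply/eqP; rewrite -det_tr; apply/det0P.
  move/asboolPn/existsNP: hf => [v0 /forallNP hv0].
  pose D v := `[< forall k, f (iter k (parent f) v) <> None >].
  exists (\row_j (D j)%:R).
    apply/eqP => /rowP/(_ v0)/eqP; rewrite !mxE.
    have -> : D v0 by apply/asboolP.
    by rewrite oner_eq0.
  apply/rowP => i; rewrite !mxE.
  under eq_bigr do rewrite !mxE mulrBr.
  rewrite big_split /= sumrN (bigD1 i) //= eqxx mulr1 big1 ?addr0; last first.
    by move=> j /negPf ji; rewrite eq_sym ji mulr0.
  case fi : (f i) => [u|]; last first.
    rewrite big1 ?subr0; last by move=> j _; rewrite mulr0.
    by have -> : D i = false by apply/asboolPn => /(_ 0%N).
  rewrite (bigD1 u) //= eqxx mulr1 big1 ?addr0; last first.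
    by move=> j /negPf ju; rewrite (inj_eq (@Some_inj _)) eq_sym ju mulr0.
  suff -> : D i = D u by rewrite subrr.
  apply: asbool_equiv_eq; split => h k.
    by have := h k.+1; rewrite iterSr {2}/parent fi.
  by case: k => [|k]; rewrite ?fi // iterSr {2}/parent fi.
have [rk hrk] := rooted_fun_rank hf.
rewrite /determinant (bigD1 1%g) //= [X in _ + X]big1 ?addr0.
  rewrite odd_perm1 expr0 mul1r big1 // => i _; rewrite mxE perm1 eqxx.
  case: eqP => [/hrk|]; rewrite ?ltnn // => _; by rewrite subr0.
move=> s s1; apply/eqP; rewrite mulf_eq0; apply/orP; right; apply/prodf_eq0.
have [i hi] : exists i, ~~ ((s i == i) || (f i == Some (s i))).
  apply/existsP; rewrite -negb_forall; apply: contra s1 => /forallP h.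
  have le i : (rk (s i) <= rk i)%N.
    by case/orP: (h i) => /eqP; [move-> | move/hrk/ltnW].
  have eqs : (\sum_i rk (s i) = \sum_i rk i)%N.
    by rewrite [RHS](reindex_inj (@perm_inj _ s)).
  have /forallP eqi : [forall i, rk (s i) == rk i].
    have := leqif_sum (fun i (_ : true) => leqif_eq (le i)).
    by move=> [_]; rewrite eqs eqxx => /esym/forallP hh; apply/forallP => i; exact: hh.
  apply/eqP/permP => i; rewrite perm1.
  case/orP: (h i) => /eqP // /hrk; by rewrite (eqP (eqi i)) ltnn.
exists i => //; rewrite mxE; move: hi; rewrite negb_or => /andP[/negPf h1 /negPf h2].
by rewrite (eq_sym i) h1 h2 subr0.
Qed.

(** Row [i] of the Laplacian is the combination, with weights [W i o], of the possible rows [i] of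
    parent matrices. Multilinearity expands the determinant over all parent functions, and
    [det_parent_matrix] discards the cyclic ones. *)
Theorem matrix_tree W :
  \det (laplacian W) = \sum_(f | rooted_fun f) forest_fun_weight W f.
Proof.
transitivity (\sum_f forest_fun_weight W f *
   \det (\matrix_(i, j) ((i == j)%:R - (f i == Some j)%:R) : 'M[R]_n)); last first.
  rewrite [RHS]big_mkcond /=; apply: eq_bigr => f _.
  by rewrite det_parent_matrix; case: ifP; rewrite ?mulr1 ?mulr0.
under eq_bigr do rewrite /determinant mulr_sumr.
rewrite exchange_big /=; apply: eq_bigr => s _.
under [RHS]eq_bigr do rewrite mulrCA.
rewrite -mulr_sumr; congr (_ * _).
pose F i o := W i o * ((i == s i)%:R - (o == Some (s i))%:R).
transitivity (\sum_(f : {ffun 'I_n -> option 'I_n}) \prod_i F i (f i)); last first.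
  apply: eq_bigr => f _; rewrite /forest_fun_weight -big_split /=.
  by apply: eq_bigr => i _; rewrite mxE.
rewrite -(bigA_distr_bigA F); apply: eq_bigr => i _; rewrite mxE.
under [RHS]eq_bigr do rewrite /F mulrBr.
rewrite big_split /= sumrN -mulr_suml; congr (_ - _).
rewrite (bigD1 (Some (s i))) //= eqxx mulr1 big1 ?addr0 //.
by move=> o /negPf->; rewrite mulr0.
Qed.

(** Forests are grouped by what remains after cutting [t] from its parent; [t] may be reattached to
    [z] exactly when [z] is outside the tree of [t]. The weights at [t] enter linearly and may be
    signed. *)
Lemma forest_sum_row W t : 
  \sum_(f | rooted_fun f) forest_fun_weight W f =
  \sum_(f | rooted_fun f && (f t == None)) (\prod_(v | v != t) W v (f v)) *
     (W t None + \sum_z W t (Some z) * (tree_root f z != t)%:R).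
Proof.
under [RHS]eq_bigr do rewrite mulrDr mulr_sumr.
rewrite big_split /= [in RHS]exchange_big /=.
rewrite (partition_big (fun f : {ffun _} => f t) xpredT) //=.
rewrite (bigD1 None) //=; congr (_ + _).
  by apply: eq_bigr => f /andP[_ /eqP ft]; rewrite /forest_fun_weight (bigD1 t) //= ft mulrC.
rewrite [LHS](reindex_omap (Some : 'I_n -> _) id) /=; last by case.
apply: eq_big => z; first by rewrite eqxx.
move=> _; rewrite (reindex_onto (fun f => redirect f t (Some z))
  (fun f => redirect f t None)) /=; last first.
  by move=> f /andP[_ /eqP ft]; apply/ffunP => v; rewrite !ffunE; case: eqP => // ->.
have redirectK f : (redirect (redirect f t (Some z)) t None == f) = (f t == None).
  apply/eqP/eqP => [<-|ft]; first by rewrite ffunE eqxx.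
  by apply/ffunP => v; rewrite !ffunE; case: eqP => // ->.
under eq_bigl do rewrite redirectK ffunE !eqxx andbT.
rewrite (eq_bigl (fun f => (rooted_fun f && (f t == None)) && (tree_root f z != t))); last first.
  move=> f; case: (eqVneq (f t) None) => ft; last by rewrite !andbF.
  rewrite !andbT; case: (boolP (rooted_fun f)) => hf /=; first exact: redirect_rooted.
  apply: contraNF hf => /(redirect_root_rooted t).
  by have /eqP-> : redirect (redirect f t (Some z)) t None == f by rewrite redirectK ft.
rewrite big_mkcondr /=; apply: eq_bigr => f /andP[_ ft].
case: ifP => _; rewrite ?mulr0 // mulr1 /forest_fun_weight (bigD1 t) //= ffunE eqxx.
rewrite mulrC; congr (_ * _); apply: eq_bigr => v /negPf vt.
by rewrite ffunE vt.
Qed.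

End MatrixTree.

(** * Forests as acyclic parent functions *)

Section ForestsOfFunctions.
Context (V : finType).
Implicit Types (f g : {ffun V -> option V}) (v u r x y : V) (D : {set {set V}}).

Lemma set2_eq x y v u :
  [set x; y] = [set v; u] -> (x = v /\ y = u) \/ (x = u /\ y = v).
Proof.
move=> e.
have : x \in [set v; u] by rewrite -e set21.
have : y \in [set v; u] by rewrite -e set22.
have : v \in [set x; y] by rewrite e set21.
have : u \in [set x; y] by rewrite e set22.
rewrite !in_set2 => /orP[]/eqP h1 /orP[]/eqP h2 /orP[]/eqP h3 /orP[]/eqP h4;
  subst; by [left | right].
Qed.

Lemma adj_sym D : symmetric (adj D).
Proof. by move=> x y; rewrite /adj finset.setUC. Qed.

Lemma rooted_fun_neq f v u : rooted_fun f -> f v = Some u -> v != u.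
Proof.
move=> /rooted_fun_rank[rk hrk] /hrk; by apply: contraTneq => ->; rewrite ltnn.
Qed.

(** On a cycle, a vertex of maximal rank has both neighbours as its parent, so they coincide, which
    a cycle of length at least three excludes. *)
Lemma acyclic_parent_edges f D : rooted_fun f ->
  (forall x y, adj D x y -> f x = Some y \/ f y = Some x) -> acyclic_graph D.
Proof.
move=> /rooted_fun_rank[rk hrk] hD; apply/asboolP => c hc; apply/negP.
case: c hc => // z0 c0; set c := z0 :: c0 => hc.
have z0c : z0 \in c by rewrite mem_head.
case: (arg_maxnP (fun z => rk z) z0c) => z zc zmax.
have nbr y : y \in c -> adj D z y -> f z = Some y.
  by move=> yc /hD[//|/hrk]; have := zmax _ yc; rewrite /= ltnNge => ->.
have [i s hs] := rot_to zc.
have memc y : (y \in z :: s) = (y \in c) by rewrite -hs mem_rot.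
rewrite /ucycleb -(rot_cycle i) -(rot_uniq i) hs.
have : size (z :: s) = size c by rewrite -hs size_rot.
case: s memc {hs} => [|y s] memc; first by move=> e; rewrite -e in hc.
case/lastP: s memc => [|s y'] memc; first by move=> e; rewrite -e in hc.
move=> _ /=; rewrite rcons_path /= last_rcons => /andP[/andP[zy /andP[_ y'z]]].
rewrite adj_sym in y'z.
have fy : f z = Some y by apply: nbr => //; rewrite -memc !inE eqxx orbT.
have : f z = Some y' by apply: nbr => //; rewrite -memc !inE mem_rcons mem_head !orbT.
by rewrite fy => -[->]; rewrite mem_rcons mem_head /= andbF.
Qed.

Definition tree_of f r : rtree V :=
  ([set v | tree_root f v == r],
   [set [set v; parent f v] | v in [set v | (tree_root f v == r) && (f v != None)]],
   r).

Definition forest_of f : {set rtree V} :=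
  [set tree_of f r | r in [set r | f r == None]].

Lemma adj_tree_of f r x y : adj (rtree_edges (tree_of f r)) x y ->
  f x = Some y \/ f y = Some x.
Proof.
case/imsetP => v; rewrite inE => /andP[_]; rewrite /parent.
by case fv : (f v) => [u|] // _ /set2_eq[[-> ->]|[-> ->]]; [left | right].
Qed.

Lemma tree_of_connected f r : rooted_fun f ->
  connected_graph (rtree_verts (tree_of f r)) (rtree_edges (tree_of f r)).
Proof.
move=> hf.
have csym : connect_sym (adj (rtree_edges (tree_of f r))).
  exact/sym_connect_sym/adj_sym.
have toroot v : tree_root f v = r -> connect (adj (rtree_edges (tree_of f r))) v r.
  move: v; apply: (rooted_fun_ind hf) => [v fv|v u fv IH].
    by rewrite tree_root_id // => ->.
  move=> vr; have ur := vr; rewrite (tree_root_step hf fv) in ur.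
  apply: connect_trans (IH ur); apply: connect1; apply/imsetP; exists v.
    by rewrite inE vr eqxx fv.
  by rewrite /parent fv.
apply/forall_inP => x; rewrite inE => /eqP xr; apply/forall_inP => y; rewrite inE => /eqP yr.
by apply: connect_trans (toroot _ xr) _; rewrite csym toroot.
Qed.

Lemma forest_of_valid f : rooted_fun f ->
  spanning_rooted_forest (complete_edges V) (forest_of f).
Proof.
move=> hf; apply/and3P; split.
- apply/forall_inP => t /imsetP[r]; rewrite inE => /eqP fr ->.
  apply/and5P; split.
  + by rewrite inE tree_root_id.
  + apply/fintype.subsetP => e /imsetP[v]; rewrite inE => /andP[_ fv] ->.
    rewrite inE cards2 /parent; case fu : (f v) fv => [u|] // _.
    by rewrite (rooted_fun_neq hf fu).
  + apply/forall_inP => e /imsetP[v]; rewrite inE => /andP[/eqP vr fv] ->.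
    apply/fintype.subsetP => x; rewrite in_set2 /parent inE.
    case fu : (f v) fv => [u|] // _ /orP[/eqP->|/eqP->]; first by rewrite vr.
    by rewrite -(tree_root_step hf fu) vr.
  + exact: tree_of_connected.
  + by apply: (acyclic_parent_edges hf) => x y; exact: adj_tree_of.
- apply/forall_inP => _ /imsetP[r _ ->]; apply/forall_inP => _ /imsetP[s _ ->].
  apply/implyP => rs; apply/pred0P => v /=; rewrite !inE.
  by apply: contraNF rs => /andP[/eqP-> /eqP->].
- apply/eqP/setP => v; rewrite inE; apply/bigcupP; exists (tree_of f (tree_root f v)).
    by apply: imset_f; rewrite inE root_of_tree_root.
  by rewrite inE.
Qed.

(** Trees carry their roots, and orientations are recovered by moving away from the root: if the
    edge at [v] pointed the other way in [g], the induction hypothesis at [u] would make [u] and [v]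
    parents of each other in [f]. *)
Lemma forest_of_inj f g : rooted_fun f -> rooted_fun g ->
  forest_of f = forest_of g -> f = g.
Proof.
move=> hf hg e.
have tree_eq r : f r = None -> g r = None /\ tree_of f r = tree_of g r.
  move=> fr; have : tree_of f r \in forest_of g.
    by rewrite -e; apply: imset_f; rewrite inE fr.
  by case/imsetP => r'; rewrite inE => /eqP gr' eT; have [_ _ er] := eT; rewrite {1}er eT er.
apply/ffunP; apply: (rooted_fun_ind hf) => [v fv|v u fv IH].
  by have [->] := tree_eq _ fv.
have [_] := tree_eq _ (root_of_tree_root v hf).
move=> /(congr1 (@rtree_edges V))/setP/(_ [set v; u]).
rewrite (_ : _ \in rtree_edges (tree_of f _)); last first.
  by apply/imsetP; exists v; rewrite ?inE ?eqxx ?fv // /parent fv.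
move=> /esym/imsetP[v']; rewrite inE => /andP[_]; rewrite /parent.
case gv' : (g v') => [u'|] // _ /set2_eq[[ev eu]|[ev eu]]; first by rewrite fv ev gv' eu.
have [rk hrk] := rooted_fun_rank hf.
have := hrk _ _ fv; suff /hrk : f u = Some v by move=> h1 h2; have := ltn_trans h1 h2; rewrite ltnn.
by rewrite IH eu gv' ev.
Qed.

(** An edge of [D] missing from [D'] would close a path of [D'] into a cycle of [D]. This shows that
    the chosen parent edges exhaust a given tree. *)
Lemma acyclic_connected_eq (S : {set V}) D D' :
  D \subset complete_edges V -> [forall e in D, e \subset S] ->
  D' \subset D -> connected_graph S D' -> acyclic_graph D -> D' = D.
Proof.
move=> /fintype.subsetP DE /forall_inP DS D'D cD' /asboolP aD.
apply/eqP; rewrite finset.eqEsubset D'D /=; apply/fintype.subsetP => e eD.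
have := DE _ eD; rewrite inE => /cards2P[x [y [xy exy]]].
have /fintype.subsetP eS := DS _ eD.
have xS : x \in S by apply: eS; rewrite exy set21.
have yS : y \in S by apply: eS; rewrite exy set22.
have /connectP[p0 hp0 ly0] : connect (adj D') x y.
  by move/forall_inP: cD' => /(_ _ xS)/forall_inP/(_ _ yS).
case/shortenP: hp0 ly0 => p hp up _ ly.
apply/negPn/negP => eD'.
have sp : (2 < size (x :: p))%N.
  case: p hp ly {up} => [_ /= e0|u [|u' p] //=]; first by rewrite e0 eqxx in xy.
  by rewrite andbT => xu e0; rewrite /adj -e0 -exy (negPf eD') in xu.
apply/negP: (aD _ sp); rewrite negbK /ucycleb up andbT /= rcons_path -ly.
rewrite adj_sym /adj -exy eD andbT; apply: sub_path hp => a b.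
exact: (fintype.subsetP D'D).
Qed.

(** The parent of a vertex is its successor on a shortest path to the root inside its tree; the
    distance [d] to the root serves as rank. *)
Lemma forest_of_surj (F : {set rtree V}) :
  spanning_rooted_forest (complete_edges V) F ->
  exists2 f, rooted_fun f & forest_of f = F.
Proof.
move=> /and3P[/forall_inP hT /forall_inP hdis /eqP hcov].
have uniq_tree t t' v : t \in F -> t' \in F -> v \in rtree_verts t ->
    v \in rtree_verts t' -> t = t'.
  move=> tF t'F vt vt'; apply/eqP; apply: contraTT vt' => ne.
  have /forall_inP/(_ _ t'F)/implyP/(_ ne) := hdis _ tF.
  by move/disjointFr=> /(_ _ vt) ->.
have [tree htree] : {tree : V -> rtree V & forall v, tree v \in F /\ v \in rtree_verts (tree v)}.
  apply: (@boolp.choice _ _ (fun v t => t \in F /\ v \in rtree_verts t)) => v.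
  have : v \in \bigcup_(t in F) rtree_verts t by rewrite hcov inE.
  by case/bigcupP => t tF vt; exists t.
have treeP t v : t \in F -> v \in rtree_verts t -> tree v = t.
  by move=> tF vt; have [h1 h2] := htree v; apply: uniq_tree vt.
pose good v n := `[< exists p, [/\ path (adj (rtree_edges (tree v))) v p,
  last v p = rtree_root (tree v) & size p = n] >].
have ex_good v : exists n, good v n.
  have [tF vt] := htree v; have /and5P[rt _ _ /forall_inP/(_ _ vt)/forall_inP/(_ _ rt) + _] := hT _ tF.
  by case/connectP => p hp lp; exists (size p); apply/asboolP; exists p.
pose d v := ex_minn (ex_good v).
have edge_tree v u : adj (rtree_edges (tree v)) v u -> tree u = tree v.
  have [tF vt] := htree v; have /and5P[_ _ /forall_inP hS _ _] := hT _ tF.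
  by move=> /hS/fintype.subsetP/(_ u); rewrite set22 => /(_ isT); exact: treeP.
have step v : exists o, match o with
    | None => v = rtree_root (tree v)
    | Some u => adj (rtree_edges (tree v)) v u /\ (d u < d v)%N end.
  rewrite {2}/d; case: ex_minnP => n /asboolP[[|u p] [/= hp lp <-]] _; first by exists None.
  move: hp => /andP[vu hp]; exists (Some u); split => //.
  rewrite /d; case: ex_minnP => m _; apply; apply/asboolP; exists p.
  by rewrite (edge_tree _ _ vu).
have [f0 hf0] := boolp.choice step.
pose f : {ffun V -> option V} := [ffun v => f0 v].
have fN v : f v = None -> v = rtree_root (tree v).
  by rewrite ffunE => e; have := hf0 v; rewrite e.
have fS v u : f v = Some u -> adj (rtree_edges (tree v)) v u /\ (d u < d v)%N.
  by rewrite ffunE => e; have := hf0 v; rewrite e.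
have hf : rooted_fun f by apply: (@rank_rooted_fun _ _ d) => v u /fS[].
have fr t : t \in F -> f (rtree_root t) = None.
  move=> tF; have /and5P[rt _ _ _ _] := hT _ tF; have et := treeP _ _ tF rt.
  case e : (f _) => [u|] //; have [_] := fS _ _ e.
  rewrite {2}/d; case: ex_minnP => m _ /(_ 0%N); rewrite leqn0 => hm.
  have /eqP -> // : m == 0%N.
  by apply: hm; apply/asboolP; exists [::]; split; rewrite //= et.
have rootE : forall v, tree_root f v = rtree_root (tree v).
  apply: (rooted_fun_ind hf) => [v fv|v u fv IH]; first by rewrite tree_root_id // -fN.
  by have [vu _] := fS _ _ fv; rewrite (tree_root_step hf fv) IH (edge_tree _ _ vu).
have treeE t : t \in F -> tree_of f (rtree_root t) = t.
  move=> tF; have /and5P[rt DE hS hc ha] := hT _ tF.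
  have vE : rtree_verts (tree_of f (rtree_root t)) = rtree_verts t.
    apply/setP => v; rewrite inE rootE; apply/eqP/idP => [e|vt]; last by rewrite (treeP t).
    have [tF' vt'] := htree v; have /and5P[rt' _ _ _ _] := hT _ tF'.
    by rewrite e in rt'; rewrite -(uniq_tree _ _ _ tF' tF rt' rt).
  have eE : rtree_edges (tree_of f (rtree_root t)) = rtree_edges t.
    apply: (acyclic_connected_eq DE hS) => //; last by rewrite -vE; exact: tree_of_connected.
    apply/fintype.subsetP => e /imsetP[v]; rewrite inE => /andP[vr] + ->.
    rewrite /parent; case fv : (f v) => [u|] // _; have [+ _] := fS _ _ fv.
    by rewrite (treeP t) // -vE inE.
  case: t {tF rt DE hS hc ha} vE eE => [[S D] r] /= vE eE.
  by rewrite /tree_of; congr (_, _, _).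
exists f => //; apply/setP => t; apply/imsetP/idP => [[r]|tF]; last first.
  by exists (rtree_root t); rewrite ?inE ?fr // treeE.
rewrite inE => /eqP /fN -> ->; rewrite treeE; by have [] := htree r.
Qed.

End ForestsOfFunctions.

(** * The potential as a ratio of sums over parent functions *)

Section PotentialOfFunctions.
Context (R : realType) (V : finType) (w : {set V} -> R) (q : R).
Implicit Types (f : {ffun V -> option V}).

Definition edge_weight (v : V) (o : option V) : R :=
  if o is Some u then w [set v; u] else q.

(** Every vertex that is not a root accounts for one edge, the one to its parent, and every root for
    a factor [q]. Two vertices cannot give the same edge, since each would be the parent of the
    other. *)
Lemma forest_of_weight f : rooted_fun f ->
  q ^+ #|forest_of f| * forest_weight w (forest_of f) = \prod_v edge_weight v (f v).
Proof.
move=> hf; have tinj : injective (tree_of f) by move=> r r' [].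
rewrite /forest_weight /forest_of card_imset // big_imset /=; last exact: in2W.
rewrite [RHS](bigID (fun v => f v == None)) /=; congr (_ * _).
  rewrite (eq_bigr (fun=> q)); last by move=> v /eqP ->.
  by rewrite prodr_const; congr (_ ^+ _); apply: eq_card => v; rewrite !inE.
rewrite [RHS](partition_big (tree_root f) (mem [set r | f r == None])) /=; last first.
  by move=> v _; rewrite inE root_of_tree_root.
apply: eq_bigr => r _; rewrite big_imset /=.
  apply: eq_big => v; first by rewrite inE andbC.
  by rewrite inE /parent; case: (f v) => // /andP[].
move=> v v'; rewrite !inE /parent; case fv : (f v) => [u|]; last by rewrite andbF.
case fv' : (f v') => [u'|]; last by rewrite andbF.
move=> _ _ /set2_eq[[]//|[ev eu]]; have [rk hrk] := rooted_fun_rank hf.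
have := hrk _ _ fv; have := hrk _ _ fv'; move: ev eu => /= -> -> h1 h2.
by have := ltn_trans h1 h2; rewrite ltnn.
Qed.

Lemma forest_of_partition f : rooted_fun f ->
  forest_partition (forest_of f) = finset.preim_partition (tree_root f) [set: V].
Proof.
move=> hf; rewrite /forest_partition /forest_of -imset_comp.
rewrite /finset.preim_partition /finset.equivalence_partition.
apply/setP => S; apply/imsetP/imsetP => -[r].
  rewrite inE => /eqP fr ->; exists r; rewrite ?inE //.
  by apply/setP => v; rewrite !inE (tree_root_id fr) eq_sym.
move=> _ ->; exists (tree_root f r); first by rewrite inE root_of_tree_root.
by apply/setP => v; rewrite !inE eq_sym.
Qed.

Lemma pblock_forest_of f x y : rooted_fun f ->
  (finset.pblock (forest_partition (forest_of f)) x !=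
   finset.pblock (forest_partition (forest_of f)) y) = (tree_root f x != tree_root f y).
Proof.
move=> hf; rewrite forest_of_partition //; congr (~~ _).
have hP := preim_partitionP (tree_root f) [set: V].
rewrite eq_pblock ?(partition_trivIset hP) //; last by rewrite (cover_partition hP) inE.
rewrite pblock_equivalence_partition ?inE //.
by split=> // /eqP ->.
Qed.

Lemma sum_forest_of (P : pred {set rtree V}) :
  \sum_(F | spanning_rooted_forest (complete_edges V) F && P F)
     q ^+ #|F| * forest_weight w F =
  \sum_(f : {ffun V -> option V} | rooted_fun f && P (forest_of f))
     \prod_v edge_weight v (f v).
Proof.
pose h (F : {set rtree V}) : {ffun V -> option V} := odflt [ffun=> None] [pick f | rooted_fun f && (forest_of f == F)].
have hP F : spanning_rooted_forest (complete_edges V) F ->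
    rooted_fun (h F) /\ forest_of (h F) = F.
  rewrite /h; case: pickP => [f /andP[? /eqP ?] //|n] /forest_of_surj[f hf eF].
  by have := n f; rewrite hf eF eqxx.
rewrite (reindex_onto (fun f => forest_of f) h) /=; last by move=> F /andP[/hP[]].
apply: eq_big => [f|f /andP[/andP[/hP[hf _] _] /eqP ef]]; last first.
  by rewrite forest_of_weight // -ef.
apply/idP/idP => [/andP[/andP[/hP[hf _] ->] /eqP <-]|/andP[hf ->]]; first by rewrite hf.
have vf := forest_of_valid hf; have [h1 h2] := hP _ vf.
by rewrite vf /=; apply/eqP/forest_of_inj.
Qed.

Lemma LEP_Z_rooted_fun : LEP_Z (complete_edges V) w q =
  \sum_(f : {ffun V -> option V} | rooted_fun f) \prod_v edge_weight v (f v).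
Proof.
have := sum_forest_of xpredT; under [in LHS]eq_bigl do rewrite andbT.
by under [in RHS]eq_bigl do rewrite andbT.
Qed.

Lemma LEP_potential_rooted_fun x y :
  LEP_potential (complete_edges V) w q x y =
  (LEP_Z (complete_edges V) w q)^-1 *
  \sum_(f : {ffun V -> option V} | rooted_fun f && (tree_root f x != tree_root f y))
     \prod_v edge_weight v (f v).
Proof.
rewrite /LEP_potential /LEP_prob /LEP_law -mulr_sumr; congr (_ * _).
pose A (P : {set {set V}}) := finset.partition P [set: V] &&
  (finset.pblock P x != finset.pblock P y).
transitivity (\sum_(F | spanning_rooted_forest (complete_edges V) F && A (forest_partition F))
     q ^+ #|F| * forest_weight w F).
  rewrite [RHS](partition_big (@forest_partition V) A) /=; last by move=> F /andP[].
  apply: eq_bigr => P AP; apply: eq_bigl => F.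
  by case: eqP => [->|_]; rewrite ?andbF // -/(A P) (AP : A P = true) !andbT.
rewrite sum_forest_of; apply: eq_bigl => f; case hf : (rooted_fun f) => //=.
by rewrite /A pblock_forest_of // forest_of_partition // preim_partitionP.
Qed.

End PotentialOfFunctions.

(** * Forests following a given path *)

Section SmallDeterminants.
Context (R : comNzRingType).
Implicit Types (F : nat -> nat -> R).

Lemma det_mx2E F : \det (\matrix_(i < 2, j < 2) F i j) =
  F 0%N 0%N * F 1%N 1%N - F 0%N 1%N * F 1%N 0%N.
Proof.
rewrite (expand_det_row _ ord0) !big_ord_recl big_ord0 /cofactor !det_mx11 !mxE /=.
by rewrite /bump /= expr0 expr1; ring.
Qed.

Lemma det_mx3E F : \det (\matrix_(i < 3, j < 3) F i j) =
  F 0%N 0%N * (F 1%N 1%N * F 2%N 2%N - F 1%N 2%N * F 2%N 1%N)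
  - F 0%N 1%N * (F 1%N 0%N * F 2%N 2%N - F 1%N 2%N * F 2%N 0%N)
  + F 0%N 2%N * (F 1%N 0%N * F 2%N 1%N - F 1%N 1%N * F 2%N 0%N).
Proof.
have minor j : \det (row' ord0 (col' j (\matrix_(i < 3, j < 3) F i j))) =
    F 1%N (bump j 0) * F 2%N (bump j 1) - F 1%N (bump j 1) * F 2%N (bump j 0).
  rewrite -(det_mx2E (fun i k => F i.+1 (bump j k))); congr (\det _).
  by apply/matrixP => i k; rewrite !mxE.
rewrite (expand_det_row _ ord0) !big_ord_recl big_ord0 /cofactor !minor !mxE /=.
by rewrite /bump /= expr0 expr1 sqrrN expr1n; ring.
Qed.

(* The Weinstein-Aronszajn identity, with [X] standing for [V C^-1]. *)
Lemma det_low_rank_update n k (C : 'M[R]_n) (U : 'M[R]_(n, k)) (V X : 'M[R]_(k, n)) :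
  X *m C = V -> \det (C + U *m V) = \det C * \det (1%:M + X *m U).
Proof.
move=> XC.
transitivity (\det (block_mx C (- U) V 1%:M)).
  have -> : block_mx C (- U) V 1%:M =
      block_mx 1%:M (- U) 0 1%:M *m block_mx (C + U *m V) 0 V 1%:M.
    rewrite mulmx_block !mul1mx !mul0mx !mulmx1 ?mulmx0 !add0r mulNmx.
    by rewrite addrK.
  by rewrite det_mulmx det_ublock det_lblock !det1 !mulr1 !mul1r.
have -> : block_mx C (- U) V 1%:M =
    block_mx 1%:M 0 X 1%:M *m block_mx C (- U) 0 (1%:M + X *m U).
  rewrite mulmx_block !mul1mx !mul0mx ?mulmx0 !addr0 XC mulmxN.
  by rewrite addrCA [- _ + _]addrC subrr addr0.
by rewrite det_mulmx det_ublock det_lblock !det1 !mul1r.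
Qed.

End SmallDeterminants.

Lemma sum_option (R : nmodType) (T : finType) (F : option T -> R) :
  \sum_o F o = F None + \sum_x F (Some x).
Proof.
rewrite (bigD1 None) //=; congr (_ + _).
rewrite (reindex_omap (Some : T -> _) id) /=; last by case.
by apply: eq_bigl => x; rewrite eqxx.
Qed.

Section Pinned.
Context (R : fieldType) (n : nat).
Implicit Types (W : 'I_n -> option 'I_n -> R) (th : option 'I_n -> R).
Implicit Types (t v : 'I_n) (p : seq 'I_n) (C : pred 'I_n).

(* [t :: p] is a path listed from its tip [t] back to its starting point: the
   vertices of [p] point to their predecessor in the list. *)
Definition pinned t p th W v (o : option 'I_n) : R :=
  if v == t then th o
  else if v \in p then (o == Some (nth v (t :: p) (index v p)))%:R
  else W v o.

(* With this signed row of weights at the tip of the path, [forest_sum_row] counts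
   the vertices of [C] in the tree of the tip. *)
Definition count_row C (o : option 'I_n) : R :=
  if o is Some z then - (C z)%:R else #|C|%:R.

Lemma sum_pinned t p th W v : \sum_o pinned t p th W v o =
  if v == t then \sum_o th o else if v \in p then 1 else \sum_o W v o.
Proof.
rewrite /pinned; case: ifP => // _; case: ifP => // _.
rewrite (bigD1 (Some (nth v (t :: p) (index v p)))) //= eqxx big1 ?addr0 //.
by move=> o /negPf ->.
Qed.

Lemma sum_count_row C : \sum_o count_row C o = 0.
Proof.
rewrite sum_option /= sumrN; apply/eqP; rewrite subr_eq0 -sum1_card natr_sum big_mkcond /=.
apply/eqP; apply: eq_bigr => x _.
by rewrite unfold_in; case: (C x).
Qed.

Lemma laplacian_count_row t p C W i j :
  laplacian (pinned t p (count_row C) W) i j =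
  if i == t then (C j)%:R
  else if i \in p then (i == j)%:R - (nth i (t :: p) (index i p) == j)%:R
  else (\sum_o W i o) * (i == j)%:R - W i (Some j).
Proof.
rewrite mxE sum_pinned sum_count_row /pinned; case: ifP => _.
  by rewrite mul0r /= opprK add0r.
by case: ifP => _ //; rewrite mul1r (inj_eq (@Some_inj _)) (eq_sym j).
Qed.

(* The potential of [t :: p] solving the triangular system attached to the path:
   it jumps by one at each vertex of [C]. *)
Definition path_potential t p C (Minv : R) v : R :=
  if v \in t :: p then (count C (drop (index v (t :: p)) (t :: p)))%:R
  else (C v)%:R * Minv.

Lemma path_potential_tip t p C Minv :
  path_potential t p C Minv t = (count C (t :: p))%:R.
Proof. by rewrite /path_potential mem_head index_head drop0. Qed.

Definition pinned_base t p (M : R) : 'M[R]_n := \matrix_(i, j)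
  if i == t then (i == j)%:R
  else if i \in p then (i == j)%:R - (nth i (t :: p) (index i p) == j)%:R
  else M * (i == j)%:R.

(** For [j] on the path, column [j] says that the value at [j] is [C j] plus the value at the path
    vertex pointing to [j], which comes next in the list; hence the count of [C] from [j] back to
    the start. For [j] off the path the column contributes only [M] times the value at [j]. *)
Lemma path_potential_solves t p C M j : uniq (t :: p) -> M != 0 ->
  \sum_i path_potential t p C M^-1 i * pinned_base t p M i j = (C j)%:R.
Proof.
move=> utp M0; set y := path_potential _ _ _ _.
pose q := t :: p; have [tp up] := andP utp.
have -> : \sum_i y i * pinned_base t p M i j =
    y j * (if j \in q then 1 else M) -
    \sum_(i | i \in p) y i * (nth i q (index i p) == j)%:R.
  have -> : y j * (if j \in q then 1 else M) =
      \sum_i y i * ((if i \in q then 1 else M) * (i == j)%:R).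
    rewrite (bigD1 j) //= eqxx mulr1 big1 ?addr0 // => i /negPf ->.
    by rewrite !mulr0.
  rewrite [in X in _ - X]big_mkcond /= -sumrB; apply: eq_bigr => i _.
  rewrite mxE /q inE; case: (eqVneq i t) => [->|it] /=.
    by rewrite (negPf tp) subr0 mul1r.
  by case: ifP => _; rewrite ?subr0 ?mul1r ?mulrBr.
have sumE : \sum_(i | i \in p) y i * (nth i q (index i p) == j)%:R =
    \sum_(0 <= l < size p) (count C (drop l.+1 q))%:R * (nth t q l == j)%:R.
  rewrite -big_uniq //= (big_nth t); apply: eq_big_nat => l /andP[_ lp].
  have lt : (nth t p l == t) = false by apply: contraNF tp => /eqP <-; apply: mem_nth.
  rewrite /y /path_potential inE mem_nth ?orbT //= [t == _]eq_sym lt index_uniq //=.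
  by congr (_ * (_ == _)%:R); apply: set_nth_default => /=; rewrite ltnS ltnW.
rewrite {}sumE; have [jq|jq] := boolP (j \in q); last first.
  rewrite big_nat big1 ?subr0 => [|l /andP[_ lp]].
    by rewrite /y /path_potential -/q (negPf jq) mulrAC -mulrA divff // mulr1.
  case: eqP => [e|]; last by rewrite mulr0.
  by rewrite -e mem_nth //= ltnS ltnW in jq.
rewrite /y /path_potential -/q jq mulr1; set m := index j q.
have mq : (m < size q)%N by rewrite index_mem.
have -> : (drop m q) = j :: drop m.+1 q by rewrite (drop_nth t) // nth_index.
have -> : \sum_(0 <= l < size p) (count C (drop l.+1 q))%:R * (nth t q l == j)%:R =
    \sum_(0 <= l < size p) (l == m)%:R * (count C (drop m.+1 q))%:R :> R.
  apply: eq_big_nat => l /andP[_ lp]; case: (eqVneq l m) => [->|lm].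
    by rewrite nth_index // eqxx mulr1 mul1r.
  case: eqP => [e|_]; last by rewrite mulr0 mul0r.
  by move: lm; rewrite /m -e index_uniq ?eqxx //= ltnS ltnW.
(* No vertex points to the last entry of the list, the start of the path. *)
rewrite /= natrD -mulr_suml; have [mp|pm] := ltnP m (size p).
  rewrite (bigD1_seq m) ?iota_uniq ?mem_index_iota //= eqxx big1 ?addr0 ?mul1r ?addrK //.
  by move=> l /negPf ->.
rewrite (drop_oversize pm).
by rewrite /= mulr0 subr0 addr0.
Qed.

End Pinned.

Arguments count_row {R n} C o.

(** The matrix is the Laplacian of weights that force the path and make every other vertex a root of
    weight [M]; a single forest survives. *)
Lemma det_pinned_base (R : fieldType) (n : nat) (t : 'I_n) (p : seq 'I_n) (M : R) :
  uniq (t :: p) -> \det (pinned_base t p M) = M ^+ (n - size (t :: p)).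
Proof.
move=> utp; have [tp up] := andP utp.
pose W (_ : 'I_n) (o : option 'I_n) : R := if o is None then M else 0.
pose th (o : option 'I_n) : R := (o == None)%:R.
pose f0 : {ffun 'I_n -> option 'I_n} :=
  [ffun v => if v == t then None
             else if v \in p then Some (nth v (t :: p) (index v p)) else None].
have sum_th : \sum_o th o = 1.
  by rewrite sum_option /th /= big1 ?addr0.
have sum_W (v : 'I_n) : \sum_o W v o = M by rewrite sum_option /= big1 ?addr0.
have -> : pinned_base t p M = laplacian (pinned t p th W).
  apply/matrixP => i j; rewrite !mxE sum_pinned sum_th sum_W /pinned /th.
  case: ifP => _; first by rewrite mul1r subr0.
  case: ifP => _; last by rewrite subr0.
  by rewrite mul1r (inj_eq (@Some_inj _)) (eq_sym j).
have hf0 : rooted_fun f0.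
  apply: (@rank_rooted_fun _ _ (fun v => if v \in t :: p then index v (t :: p) else 0%N)).
  move=> v u; rewrite ffunE; case: (eqVneq v t) => // vt; case: ifP => // vp [<-].
  have lt : (index v p < size (t :: p))%N by rewrite /= ltnS ltnW // index_mem.
  rewrite mem_nth // index_uniq // inE vp orbT /= [t == v]eq_sym (negPf vt).
  exact: ltnSn.
rewrite matrix_tree (bigD1 f0) //= [X in _ + X]big1 ?addr0.
  rewrite /forest_fun_weight (bigID (fun v => v \in t :: p)) /= big1 ?mul1r => [|v].
    rewrite (eq_bigr (fun=> M)) => [|v].
      rewrite prodr_const; congr (_ ^+ _).
      have e := cardC (mem (t :: p)); rewrite card_ord (card_uniqP utp) in e.
      rewrite (@eq_card _ _ [predC mem (t :: p)]) => [|v]; last by rewrite !inE.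
      by rewrite -(addKn (size (t :: p)) #|_|) [(_ + _)%N]e.
    by rewrite inE negb_or /pinned ffunE => /andP[/negPf-> /negPf->].
  rewrite inE /pinned ffunE; case: eqP => //= _ ->; by rewrite eqxx.
move=> f /andP[_ ff0]; have [v fv] : exists v, f v != f0 v.
  apply/existsP; rewrite -negb_forall; apply: contra ff0 => /forallP h.
  by apply/eqP/ffunP => v; apply/eqP.
apply/eqP/prodf_eq0; exists v => //; rewrite /pinned; move: fv; rewrite ffunE.
case: ifP => _; first by rewrite /th => /negPf->.
by case: ifP => _; rewrite /W; [move=> /negPf-> | case: (f v)].
Qed.

(** * Determinants on the two-community graph *)

Section TwoCommunities.
Context (R : fieldType) (n N : nat) (c : pred 'I_n) (w q : R).
Hypothesis card_community : forall s, #|[pred v | c v == s]| = N.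
Implicit Types (t u v : 'I_n) (p : seq 'I_n) (s : bool).

Let M : R := q + N%:R * (1 + w).
Hypothesis M_neq0 : M != 0.

Definition community_weight v (o : option 'I_n) : R :=
  if o is Some u then (if c v == c u then 1 else w) else q.
Local Notation W := community_weight.

Definition nb s p : nat := count (fun v => c v == s) p.

Lemma card_unvisited s p : uniq p ->
  #|[pred v | (v \notin p) && (c v == s)]| = (N - nb s p)%N.
Proof.
move=> up; rewrite -(card_community s) -(cardID (mem p) [pred v | c v == s]).
have -> : #|[predI [pred v | c v == s] & mem p]| = nb s p.
  rewrite /nb -size_filter -(card_uniqP (filter_uniq _ up)).
  by apply: eq_card => v; rewrite !inE mem_filter.
by rewrite addKn; apply: eq_card => v; rewrite !inE.
Qed.

Lemma sum_community_weight v : \sum_o W v o = M.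
Proof.
rewrite sum_option /= (bigID (fun u => c u == c v)) /=.
rewrite (eq_bigr (fun=> 1)) => [|u /eqP->]; last by rewrite eqxx.
rewrite [X in _ + (_ + X)](eq_bigr (fun=> w)) => [|u]; last by rewrite eq_sym => /negPf->.
rewrite !sumr_const !card_community.
have -> : #|[pred u | c u != c v]| = N.
  rewrite -(card_community (~~ c v)); apply: eq_card => u; rewrite !inE.
  by case: (c u); case: (c v).
by rewrite /M mulrDr mulr1 mulr_natl.
Qed.

(* Weights, up to a factor depending on the length of the path only, of the
   forests in which [x] is joined to its root by a path with [a] and [b] vertices
   in the two communities, counted with the number of vertices of community [s]
   in the tree of [x]. *)
Definition tree_count s (a b : nat) : R :=
  if s then a%:R * (M - (N - b)%:R) + w * b%:R * (N - a)%:R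
  else b%:R * (M - (N - a)%:R) + w * a%:R * (N - b)%:R.

(** Off the path, the first two columns of [U] subtract the edge weights, which depend on
    communities only. At the tip, the third column removes the base row and the first two replace it
    by the indicator of community [s]. Path potentials invert the base, leaving a determinant of
    order three in [a] and [b]. *)
Lemma det_count_row s t p : uniq (t :: p) ->
  \det (laplacian (pinned t p (count_row (fun v => c v == s)) W)) =
  M ^+ (n - size (t :: p)) / M * tree_count s (nb true (t :: p)) (nb false (t :: p)).
Proof.
move=> utp; set a := nb true _; set b := nb false _.
pose y r v := path_potential t p (fun v => c v == r) M^-1 v.
pose U : 'M[R]_(n, 3) := \matrix_(v, k)
  (if v == t then [:: s%:R; (~~ s)%:R; -1] else if v \in p then [:: 0; 0; 0]
   else if c v then [:: -1; - w; 0] else [:: - w; -1; 0])`_k.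
pose Vm : 'M[R]_(3, n) := \matrix_(k, j)
  [:: (c j == true)%:R; (c j == false)%:R; (j == t)%:R]`_k.
pose X : 'M[R]_(3, n) := \matrix_(k, v) [:: y true v; y false v; (v == t)%:R]`_k.
have -> : laplacian (pinned t p (count_row (fun v => c v == s)) W) =
    pinned_base t p M + U *m Vm.
  apply/matrixP => i j; rewrite laplacian_count_row !mxE !big_ord_recl big_ord0 !mxE /=.
  rewrite sum_community_weight.
  case: (eqVneq i t) => [->|it].
    by rewrite [j == t]eq_sym; clear U; case: s; case: (c j) => /=; ring.
  case: ifP => _; first by rewrite !mul0r !addr0.
  by case: (c i); case: (c j) => /=; ring.
have XK : X *m pinned_base t p M = Vm.
  apply/matrixP => k j; rewrite !mxE.
  have hy r : \sum_v y r v * pinned_base t p M v j = (c j == r)%:R.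
    exact: path_potential_solves.
  case: k => [[|[|[|//]]]] hk /=.
  - by rewrite -hy; apply: eq_bigr => v _; rewrite mxE.
  - by rewrite -hy; apply: eq_bigr => v _; rewrite mxE.
  - rewrite (bigD1 t) //= !mxE eqxx mul1r big1 ?addr0 1?eq_sym //.
    by move=> v /negPf vt; rewrite mxE /= vt mul0r.
rewrite (det_low_rank_update U XK) det_pinned_base // -mulrA; congr (_ * _).
pose m r : R := (N - nb r (t :: p))%:R.
have yt1 : y true t = a%:R by rewrite /y path_potential_tip.
have yt2 : y false t = b%:R by rewrite /y path_potential_tip.
have sum_y r (h : 'I_n -> R) (e : R) : (forall v, c v = r -> h v = e) ->
    \sum_(v | v \notin t :: p) y r v * h v = m r / M * e.
  move=> he; rewrite (bigID (fun v => c v == r)) /= [X in _ + X]big1 ?addr0.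
    rewrite (eq_bigr (fun=> M^-1 * e)).
      rewrite sumr_const -[#|_|]/#|[pred v | (v \notin t :: p) && (c v == r)]|.
      by rewrite card_unvisited // -mulr_natl mulrA.
    move=> v /andP[vp /eqP cv]; rewrite /y /path_potential (negPf vp) cv eqxx mul1r.
    by rewrite he.
  move=> v /andP[vp /negPf cv]; by rewrite /y /path_potential (negPf vp) cv !mul0r.
have split_sum (F : 'I_n -> R) (k : 'I_3) : \sum_v F v * U v k =
    F t * U t k + \sum_(v | v \notin t :: p) F v * U v k.
  rewrite (bigD1 t) //=; congr (_ + _).
  rewrite (bigID (fun v => v \in p)) /= big1 ?add0r.
    by apply: eq_bigl => v; rewrite inE negb_or.
  move=> v /andP[/negPf vt vp]; rewrite mxE vt vp.
  by case: k => [[|[|[|//]]]] hk /=; rewrite mulr0.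
pose G (i k : nat) : R := nth 0 (nth [::]
  [:: [:: 1 - m true / M + a%:R * s%:R; - w * m true / M + a%:R * (~~ s)%:R; - a%:R];
      [:: - w * m false / M + b%:R * s%:R; 1 - m false / M + b%:R * (~~ s)%:R; - b%:R];
      [:: s%:R; (~~ s)%:R; 0]] i) k.
have -> : 1%:M + X *m U = \matrix_(i, k) G i k.
  apply/matrixP => i k; rewrite !mxE.
  under eq_bigr do rewrite mxE.
  rewrite split_sum mxE eqxx.
  have sE r e : (forall v, c v = r -> v \notin t :: p -> U v k = e) ->
     \sum_(v | v \notin t :: p) y r v * U v k = m r / M * e.
    move=> he; rewrite -(@sum_y r (fun v => if v \notin t :: p then U v k else e)).
      by apply: eq_bigr => v ->.
    by move=> v cv; case: ifP => // vp; exact: he.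
  have last_row : \sum_(v | v \notin t :: p) (v == t)%:R * U v k = 0.
    by rewrite big1 // => v; rewrite inE negb_or => /andP[/negPf-> _]; rewrite mul0r.
  have UE v : v \notin t :: p -> U v k = (if c v then [:: -1; - w; 0] else [:: - w; -1; 0])`_k.
    by rewrite inE negb_or mxE => /andP[/negPf-> /negPf->].
  case: i => [[|[|[|//]]]] hi /=; rewrite ?yt1 ?yt2 ?last_row ?eqxx.
  - rewrite (@sE true [:: -1; - w; 0]`_k) => [|v cv /UE]; last by rewrite cv.
    by case: k {sE last_row UE} => [[|[|[|//]]]] hk; rewrite /G /=; field.
  - rewrite (@sE false [:: - w; -1; 0]`_k) => [|v cv /UE]; last by rewrite cv.
    by case: k {sE last_row UE} => [[|[|[|//]]]] hk; rewrite /G /=; field.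
  - by case: k {sE last_row UE} => [[|[|[|//]]]] hk; rewrite /G /= ?addr0 ?mul1r ?add0r ?subrr.
rewrite det_mx3E /G /= /tree_count /m -/a -/b.
by clear U split_sum G; case: s => /=; field.
Qed.

(** The last factors are the eigenvalues [q] and [q + 2 N w] on vectors that are constant,
    respectively opposite, on the two communities; the other [n - 2] eigenvalues are [M]. *)
Lemma det_community_laplacian :
  \det (laplacian W) = M ^+ n / M ^+ 2 * (q * (q + 2 * N%:R * w)).
Proof.
pose y r v : R := (c v == r)%:R / M.
pose U : 'M[R]_(n, 2) := \matrix_(v, k) (if c v then [:: -1; - w] else [:: - w; -1])`_k.
pose Vm : 'M[R]_(2, n) := \matrix_(k, j) [:: (c j == true)%:R; (c j == false)%:R]`_k.
pose X : 'M[R]_(2, n) := M^-1 *: Vm.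
have -> : laplacian W = M%:M + U *m Vm.
  apply/matrixP => i j; rewrite !mxE !big_ord_recl big_ord0 !mxE /= sum_community_weight.
  by rewrite mulr_natr; case: (c i); case: (c j) => /=; ring.
have XK : X *m M%:M = Vm by rewrite mul_mx_scalar scalerA divff // scale1r.
rewrite (det_low_rank_update U XK) det_scalar -mulrA; congr (_ * _).
pose G (i k : nat) : R := nth 0 (nth [::]
  [:: [:: 1 - N%:R / M; - w * N%:R / M]; [:: - w * N%:R / M; 1 - N%:R / M]] i) k.
have -> : 1%:M + X *m U = \matrix_(i, k) G i k.
  apply/matrixP => i k; rewrite !mxE.
  have sE r (e : R) : (forall v, c v = r -> U v k = e) ->
     \sum_v ((c v == r)%:R * U v k) = N%:R * e.
    move=> he; rewrite (bigID (fun v => c v == r)) /= [X in _ + X]big1 ?addr0.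
      rewrite (eq_bigr (fun=> e)) ?sumr_const ?card_community ?mulr_natl //.
      by move=> v /eqP cv; rewrite cv eqxx mul1r he.
    by move=> v /negPf ->; rewrite mul0r.
  under eq_bigr do rewrite mxE -mulrA mxE.
  rewrite -mulr_sumr.
  case: i => [[|[|//]]] hi /=.
  - rewrite (sE true [:: -1; - w]`_k) => [|v cv]; last by rewrite mxE cv.
    by case: k {sE} => [[|[|//]]] hk; rewrite /G /=; field.
  - rewrite (sE false [:: - w; -1]`_k) => [|v cv]; last by rewrite mxE cv.
    by case: k {sE} => [[|[|//]]] hk; rewrite /G /=; field.
rewrite det_mx2E /G /=; have -> : q = M - N%:R * (1 + w) by rewrite /M; ring.
by field.
Qed.

End TwoCommunities.

(** * Expansion along the path to the root *)

Section PathRecursion.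
Context (R : fieldType) (n : nat) (W : 'I_n -> option 'I_n -> R) (C : pred 'I_n).
Implicit Types (t u v z : 'I_n) (p : seq 'I_n) (f : {ffun 'I_n -> option 'I_n}).

Definition tree_card f t : nat := #|[pred z | C z && (tree_root f z == tree_root f t)]|.

(** The vertices of [p] are forced while the tip keeps its own weights, so only forests containing
    the path contribute. *)
Definition path_sum t p : R :=
  \sum_(f | rooted_fun f)
     forest_fun_weight (pinned t p (W t) W) f * (tree_card f t)%:R.

Lemma pinned_tip t p th v o : v != t ->
  pinned t p th W v o = pinned t p (count_row C) W v o.
Proof. by rewrite /pinned => /negPf->. Qed.

(** When [t] is a root, the signed row turns the bracket of [forest_sum_row] into [#|C|] minus the
    number of vertices of [C] outside the tree of [t]. *)
Lemma path_sum_root t p :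
  \sum_(f | rooted_fun f && (f t == None))
     forest_fun_weight (pinned t p (W t) W) f * (tree_card f t)%:R =
  W t None * \det (laplacian (pinned t p (count_row C) W)).
Proof.
rewrite matrix_tree (forest_sum_row _ t) mulr_sumr; apply: eq_bigr => f /andP[hf /eqP ft].
rewrite /forest_fun_weight (bigD1 t) //= ft {1}/pinned eqxx -!mulrA; congr (_ * (_ * _)).
  by apply: eq_bigr => v vt; rewrite (pinned_tip _ _ _ vt).
rewrite /pinned eqxx /= /tree_card (tree_root_id ft).
rewrite -!sum1_card !natr_sum big_mkcond [X in _ = X + _]big_mkcond /= -big_split /=.
apply: eq_bigr => z _; rewrite !inE unfold_in.
by case: (C z); case: eqP => /= _; rewrite ?mulr0 ?mulr1 ?mulN1r ?oppr0 ?mul0r ?addr0 ?subrr.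
Qed.

(** A parent on the path closes a cycle, so no forest follows the path, and a forest that does not
    follow it has weight zero. *)
Lemma path_sum_back t p u : uniq (t :: p) -> u \in t :: p ->
  \sum_(f | rooted_fun f && (f t == Some u))
     forest_fun_weight (pinned t p (W t) W) f * (tree_card f t)%:R = 0.
Proof.
move=> /andP[tp up] utp; apply: big1 => f /andP[hf /eqP ft].
have [follows|] := boolP [forall v in p, f v == Some (nth v (t :: p) (index v p))].
  have notroot : forall v, v \notin t :: p.
    apply: (rooted_fun_ind hf) => [v fv|v u' fv hu'];
      apply/negP; rewrite inE => /orP[/eqP vt|vp].
    - by rewrite vt ft in fv.
    - by move/forall_inP/(_ _ vp): follows; rewrite fv.
    - by move: fv hu'; rewrite vt ft => -[<-]; rewrite utp.
    - move/forall_inP/(_ _ vp): follows; rewrite fv => /eqP[e].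
      by move: hu'; rewrite e mem_nth //= ltnS ltnW // index_mem.
  by have := notroot t; rewrite mem_head.
rewrite negb_forall_in => /exists_inP[v vp fv].
rewrite /forest_fun_weight (bigD1 v) //= {1}/pinned vp (negPf fv).
have /negPf-> : v != t by apply: contraNneq tp => <-.
by rewrite !mul0r.
Qed.

Lemma path_sum_step t p u : uniq (t :: p) -> u \notin t :: p ->
  \sum_(f | rooted_fun f && (f t == Some u))
     forest_fun_weight (pinned t p (W t) W) f * (tree_card f t)%:R =
  W t (Some u) * path_sum u (t :: p).
Proof.
move=> /andP[tp up] utp; have [/negPf ut uNp] : u != t /\ u \notin p.
  by apply/andP; rewrite -negb_or -in_cons.
have tu : (t == u) = false by rewrite eq_sym.
have tailE v o : v != t -> pinned u (t :: p) (W u) W v o = pinned t p (W t) W v o.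
  rewrite /pinned inE => /negPf vt; rewrite vt /=; case: (eqVneq v u) => [->|vu].
    by rewrite (negPf uNp).
  by rewrite [t == v]eq_sym vt.
have tipE o : pinned u (t :: p) (W u) W t o = (o == Some u)%:R.
  by rewrite /pinned tu mem_head /= eqxx.
rewrite /path_sum [in RHS](bigID (fun f : {ffun _} => f t == Some u)) /= [X in _ + X]big1 ?addr0; last first.
  move=> f /andP[_ ftu]; rewrite /forest_fun_weight (bigD1 t) //= tipE.
  by rewrite (negPf ftu) !mul0r.
rewrite mulr_sumr; apply: eq_bigr => f /andP[hf /eqP ft].
rewrite /tree_card (tree_root_step hf ft) mulrA; congr (_ * _).
rewrite /forest_fun_weight (bigD1 t) //= [in RHS](bigD1 t) //= tipE ft eqxx mul1r.
rewrite {1}/pinned eqxx; congr (_ * _).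
by apply: eq_bigr => v vt; rewrite tailE.
Qed.

Lemma path_sum_rec t p : uniq (t :: p) ->
  path_sum t p = W t None * \det (laplacian (pinned t p (count_row C) W)) +
    \sum_(u | u \notin t :: p) W t (Some u) * path_sum u (t :: p).
Proof.
move=> utp; rewrite {1}/path_sum (partition_big (fun f : {ffun _} => f t) xpredT) //=.
rewrite sum_option path_sum_root; congr (_ + _).
rewrite (bigID (fun u => u \in t :: p)) /= big1 ?add0r => [|u uin].
  by apply: eq_bigr => u uout; rewrite path_sum_step.
by rewrite path_sum_back.
Qed.

Lemma path_sum1 t :
  path_sum t [::] = \sum_(f | rooted_fun f) forest_fun_weight W f * (tree_card f t)%:R.
Proof.
apply: eq_bigr => f _; congr (_ * _); apply: eq_bigr => v _.
by rewrite /pinned; case: eqP => // ->.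
Qed.

End PathRecursion.

Section Green.
Context (R : fieldType) (N : nat) (w M : R).

(* [green m F s a b] is the sum of [F] over the walk that sits in community [s]
   after visiting [a] vertices of the first and [b] vertices of the second
   community, runs for at most [m] more steps, and moves at each step to a new
   vertex of its own community with weight [1 / M] and to a new vertex of the
   other one with weight [w / M]. *)
Fixpoint green (m : nat) (F : bool -> nat -> nat -> R) (s : bool) (a b : nat) : R :=
  F s a b + if m is m'.+1 then
    ((if s then 1 else w) * (N - a)%:R * green m' F true a.+1 b +
     (if s then w else 1) * (N - b)%:R * green m' F false a b.+1) / M
  else 0.

End Green.

Section TwoCommunityForests.
Context (R : fieldType) (n N : nat) (c : pred 'I_n) (w q : R).
Hypothesis card_community : forall s, #|[pred v | c v == s]| = N.
Implicit Types (t u v x : 'I_n) (p : seq 'I_n) (s : bool).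

Let M : R := q + N%:R * (1 + w).
Hypothesis M_neq0 : M != 0.
Local Notation W := (community_weight c w q).

(** Induction on the number of unvisited vertices. Grouping them by community gives the factors
    [N - a] and [N - b]; each step lowers the power of [M] in the determinant by one, which is the
    division by [M] in [green]. *)
Lemma path_sum_green s t p : uniq (t :: p) ->
  path_sum W (fun v => c v == s) t p =
  q * (M ^+ (n - size (t :: p)) / M) *
    green N w M (n - size (t :: p)) (fun _ => tree_count N w q s) (c t)
      (nb c true (t :: p)) (nb c false (t :: p)).
Proof.
have [m hm] : exists m, m = (n - size (t :: p))%N by exists (n - size (t :: p))%N.
elim: m t p hm => [|m IH] t p hm utp; rewrite -hm (path_sum_rec _ _ utp) (det_count_row card_community M_neq0) // -/M -hm.
  have all_in u : u \in t :: p.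
    have : [pred v | v \notin t :: p] =1 pred0.
      apply/card0_eq; apply/eqP; rewrite -leqn0.
      have e := cardC (mem (t :: p)); rewrite card_ord (card_uniqP utp) in e.
      rewrite (@eq_card _ _ [predC mem (t :: p)]) => [|v]; last by rewrite !inE.
      by rewrite hm -(addKn (size (t :: p)) #|_|) [(_ + _)%N]e.
    by move=> /(_ u) /= /negbFE.
  rewrite big1 => [|u]; last by rewrite all_in.
  by rewrite /= addr0 addr0 mulrA.
set a := nb c true (t :: p); set b := nb c false (t :: p).
have hm' u : m = (n - size (u :: t :: p))%N by rewrite /= subnS -/(size (t :: p)) -hm.
have IHu u : u \notin t :: p -> path_sum W (fun v => c v == s) u (t :: p) =
    q * (M ^+ m / M) * green N w M m (fun _ => tree_count N w q s) (c u)
      ((c u == true) + a) ((c u == false) + b).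
  by move=> up; rewrite (IH _ _ (hm' u)) -?hm' // cons_uniq up.
pose cc u := if c t == c u then 1 else w.
have sumE s' (e : R) : (forall u, u \notin t :: p -> c u = s' -> path_sum W (fun v => c v == s) u (t :: p) = e) ->
   \sum_(u | (u \notin t :: p) && (c u == s')) cc u * path_sum W (fun v => c v == s) u (t :: p)
   = (if c t == s' then 1 else w) * (N - nb c s' (t :: p))%:R * e.
  move=> he; rewrite (eq_bigr (fun=> (if c t == s' then 1 else w) * e)).
    rewrite sumr_const -[#|_|]/#|[pred v | (v \notin t :: p) && (c v == s')]|.
    by rewrite (card_unvisited card_community) // -[LHS]mulr_natl mulrCA mulrA.
  by move=> u /andP[up /eqP cu]; rewrite he // /cc cu.
rewrite (bigID (fun u => c u == true)) /=.
rewrite (sumE true (q * (M ^+ m / M) * green N w M m (fun _ => tree_count N w q s) true a.+1 b)); last first.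
  by move=> u up cu; rewrite (IHu _ up) cu.
rewrite [X in _ + (_ + X)](eq_bigl (fun u => (u \notin t :: p) && (c u == false))); last first.
  by move=> u; case: (c u).
rewrite (sumE false (q * (M ^+ m / M) * green N w M m (fun _ => tree_count N w q s) false a b.+1)); last first.
  by move=> u up cu; rewrite (IHu _ up) cu.
rewrite -/a -/b eqb_id eqbF_neg if_neg exprS.
set g1 := green _ _ _ m _ true _ _; set g2 := green _ _ _ m _ false _ _.
set g3 := tree_count _ _ _ _ _ _; move: g1 g2 g3 (M ^+ m) (N - a)%:R (N - b)%:R => g1 g2 g3 Mm Na Nb; by case: (c t) => /=; field.
Qed.

Lemma sum_tree_card s x : (0 < n)%N ->
  \sum_(f | rooted_fun f) forest_fun_weight W f * (tree_card (fun v => c v == s) f x)%:R =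
  q * (M ^+ n / M ^+ 2) *
    green N w M n.-1 (fun _ => tree_count N w q s) (c x) (c x) (~~ c x).
Proof.
move=> n0; rewrite -path_sum1 path_sum_green //= /nb /= !addn0 subn1.
rewrite eqb_id eqbF_neg; congr (_ * _ * _).
by rewrite -[in M ^+ n](prednK n0) exprS; field.
Qed.

End TwoCommunityForests.

Lemma card_half (N : nat) (s : bool) :
  #|[pred v : 'I_(2 * N) | (v < N)%N == s]| = N.
Proof.
have e b : #|[pred v : 'I_(2 * N) | (v < N)%N == b]| =
    (\sum_(0 <= i < 2 * N) ((i < N) == b))%N.
  by rewrite -sum1_card big_mkcond [RHS]big_mkord /=; apply: eq_bigr => v _; rewrite inE; case: eqP.
rewrite e mul2n -addnn (big_cat_nat (n := N)) ?leq_addr //=.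
rewrite (eq_big_nat _ _ (F2 := fun=> (true == s) : nat)) => [|i /andP[_ ->]//].
rewrite [X in (_ + X)%N](eq_big_nat _ _ (F2 := fun=> (false == s) : nat)); last first.
  by move=> i /andP[Ni _]; rewrite ltnNge Ni.
by rewrite !sum_nat_const_nat subn0 addnK; case: s {e} => /=; rewrite ?muln0 ?muln1 ?addn0.
Qed.

(** * Mean tree content of a community and the two potentials *)

Section PotentialFormula.
Context (R : realType) (N : nat) (w q : R).
Hypotheses (w_ge0 : 0 <= w) (q_gt0 : 0 < q) (N_gt0 : (0 < N)%N).
Let M : R := q + N%:R * (1 + w).
Let T : R := q + 2 * N%:R * w.

Let c (v : 'I_(2 * N)) : bool := (v < N)%N.

Let M_gt0 : 0 < M.
Proof. by rewrite /M ltr_pwDl // mulr_ge0 // addr_ge0. Qed.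

Let T_gt0 : 0 < T.
Proof. by rewrite /T ltr_pwDl // !mulr_ge0. Qed.

Lemma edge_weight_community v o :
  edge_weight (two_community_weight 1 w) q v o = community_weight c w q v o.
Proof.
case: o => //= u; rewrite /two_community_weight !finset.subUset !finset.sub1set !inE /c.
by case: (v < N)%N; case: (u < N)%N.
Qed.

(** Both sides are the mean number of vertices of community [s] in the tree of [x]. For the
    community of [x] this includes [x] itself, which is the leading [1] in [U_in_green]. *)
Lemma same_tree_probability (s : bool) (x : 'I_(2 * N)) : c x ->
  \sum_(y | c y == s) (1 - two_community_potential 1 w q x y) =
  green N w M (2 * N).-1 (fun _ => tree_count N w q s) true 1 0 / T.
Proof.
move=> cx; have M0 : M != 0 by rewrite gt_eqF.
pose Z := \sum_(f : {ffun 'I_(2 * N) -> option 'I_(2 * N)} | rooted_fun f)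
   forest_fun_weight (community_weight c w q) f.
have weightE (f : {ffun 'I_(2 * N) -> option 'I_(2 * N)}) :
    \prod_v edge_weight (two_community_weight 1 w) q v (f v) =
    forest_fun_weight (community_weight c w q) f.
  by apply: eq_bigr => v _; rewrite edge_weight_community.
have ZE : LEP_Z (complete_edges _) (@two_community_weight R N 1 w) q = Z.
  by rewrite LEP_Z_rooted_fun; apply: eq_bigr => f _.
have Zdet : Z = M ^+ (2 * N) / M ^+ 2 * (q * T).
  by rewrite /Z -matrix_tree (det_community_laplacian (@card_half N)).
have Z0 : Z != 0.
  by rewrite Zdet gt_eqF // !mulr_gt0 ?invr_gt0 ?exprn_gt0.
have potE y : 1 - two_community_potential 1 w q x y = Z^-1 *
    \sum_(f : {ffun 'I_(2 * N) -> option 'I_(2 * N)} | rooted_fun f)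
      forest_fun_weight (community_weight c w q) f * (tree_root f y == tree_root f x)%:R.
  rewrite /two_community_potential LEP_potential_rooted_fun ZE.
  apply: (canRL (mulKf Z0)); rewrite mulrBr mulrA divff // mul1r mulr1.
  rewrite {1}/Z (bigID (fun f : {ffun _} => tree_root f x == tree_root f y)) /=.
  under [in X in _ - X]eq_bigr do rewrite weightE.
  rewrite addrK big_mkcondr /=; apply: eq_bigr => f _.
  by rewrite eq_sym; case: eqP; rewrite ?mulr1 ?mulr0.
under eq_bigr do rewrite potE.
rewrite -mulr_sumr exchange_big /=.
have -> : \sum_(f : {ffun 'I_(2 * N) -> option 'I_(2 * N)} | rooted_fun f) \sum_(y | c y == s)
     forest_fun_weight (community_weight c w q) f * (tree_root f y == tree_root f x)%:R =
   \sum_(f | rooted_fun f) forest_fun_weight (community_weight c w q) f *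
     (tree_card (fun v => c v == s) f x)%:R.
  apply: eq_bigr => f _; rewrite -mulr_sumr; congr (_ * _).
  rewrite /tree_card -sum1_card natr_sum [RHS]big_mkcond [LHS]big_mkcond /=.
  by apply: eq_bigr => y _; rewrite inE; case: (c y == s); case: eqP.
rewrite (@sum_tree_card _ _ _ c w q (@card_half N)) ?muln_gt0 // cx Zdet -/M.
have q0 : q != 0 by rewrite gt_eqF.
have T0 : T != 0 by rewrite gt_eqF.
have MN0 : M ^+ (2 * N) != 0 by rewrite expf_neq0.
by field; rewrite T0 M0 q0 MN0.
Qed.

End PotentialFormula.

Lemma two_community_potential_diag (R : realType) (N : nat) (w1 w2 q : R) x :
  @two_community_potential R N w1 w2 q x x = 0.
Proof.
by rewrite /two_community_potential /LEP_potential /LEP_prob big_pred0 // => P;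
  rewrite eqxx andbF.
Qed.

Section PotentialValues.
Context (R : realType) (N : nat) (w q : R).
Hypotheses (w_ge0 : 0 <= w) (q_gt0 : 0 < q) (N_gt0 : (0 < N)%N).

Lemma U_out_green : N%:R * (1 - U_out N 1 w q) =
  green N w (q + N%:R * (1 + w)) (2 * N).-1 (fun _ => tree_count N w q false) true 1 0 /
  (q + 2 * N%:R * w).
Proof.
have N2 : (0 < 2 * N)%N by rewrite muln_gt0.
pose x : 'I_(2 * N) := Ordinal N2.
rewrite -(@same_tree_probability _ _ _ _ w_ge0 q_gt0 N_gt0 false x) //.
rewrite (eq_bigr (fun=> 1 - U_out N 1 w q)).
  rewrite sumr_const mulr_natl; congr (_ *+ _); rewrite -[LHS](card_half N false).
  by apply: eq_card => y; rewrite !inE.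
move=> y /eqP cy; rewrite U_outE // /same_community !inE /= N_gt0.
by rewrite cy.
Qed.

Lemma U_in_green : 1 + (N%:R - 1) * (1 - U_in N 1 w q) =
  green N w (q + N%:R * (1 + w)) (2 * N).-1 (fun _ => tree_count N w q true) true 1 0 /
  (q + 2 * N%:R * w).
Proof.
have N2 : (0 < 2 * N)%N by rewrite muln_gt0.
pose x : 'I_(2 * N) := Ordinal N2.
rewrite -(@same_tree_probability _ _ _ _ w_ge0 q_gt0 N_gt0 true x) //.
rewrite (bigD1 x) /=; last by rewrite N_gt0.
rewrite two_community_potential_diag subr0; congr (_ + _).
rewrite (eq_bigr (fun=> 1 - U_in N 1 w q)).
  rewrite sumr_const -[RHS]mulr_natl; congr (_ * _).
  have := cardD1 x [pred v : 'I_(2 * N) | (v < N)%N == true].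
  rewrite card_half inE /= N_gt0 /= => e.
  rewrite (@eq_card _ _ [predD1 [pred v : 'I_(2 * N) | (v < N)%N == true] & x]).
    by rewrite [in LHS]e natrD addrAC subrr add0r.
  by move=> y; rewrite !inE andbC.
move=> y /andP[/eqP cy yx]; rewrite U_inE //; first by rewrite eq_sym.
by rewrite /same_community !inE /= N_gt0 cy.
Qed.

End PotentialValues.

(** * The killed walk on the communities *)

(* Approximate solutions of [- g' + (1 + c s) g = 1]. *)
Definition profile (R : realType) (c : R) (g : R -> R) : Prop :=
  [/\ forall s, 0 <= s -> 0 <= g s <= 1,
      forall s h, 0 <= s -> 0 <= h -> `|g s - g (s + h)| <= h &
      forall s h, 0 <= s -> 0 <= h ->
        `|g s - g (s + h) + h * ((1 + c * s) * g (s + h) - 1)| <= h * h * (1 + c + c * s)].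

Section WalkSum.
Context (R : realType) (N : nat) (w q : R).
Hypotheses (w_gt0 : 0 < w) (w_le1 : w <= 1) (q_gt0 : 0 < q) (N_gt0 : (0 < N)%N).
Implicit Types (F G psi : bool -> nat -> nat -> R).

Let M : R := q + N%:R * (1 + w).
Let T : R := q + 2 * N%:R * w.

Let nN : 0 < N%:R :> R. Proof. by rewrite ltr0n. Qed.
Let M_gt0 : 0 < M. Proof. by rewrite addr_gt0 // mulr_gt0 // addr_gt0. Qed.
Let M_neq0 : M != 0. Proof. by rewrite gt_eqF. Qed.
Let T_gt0 : 0 < T. Proof. by rewrite addr_gt0 // !mulr_gt0. Qed.
Let T_neq0 : T != 0. Proof. by rewrite gt_eqF. Qed.

Lemma green_lin m F G (x y : R) s a b :
  green N w M m (fun s a b => x * F s a b + y * G s a b) s a b =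
  x * green N w M m F s a b + y * green N w M m G s a b.
Proof. by elim: m s a b => [|m IH] s a b /=; rewrite ?IH; field. Qed.

Lemma green_le m F G s a b : (a <= N)%N -> (b <= N)%N ->
  (forall s a b, (a <= N)%N -> (b <= N)%N -> F s a b <= G s a b) ->
  green N w M m F s a b <= green N w M m G s a b.
Proof.
move=> + + FG; elim: m s a b => [|m IH] s a b aN bN /=; first by rewrite !addr0 FG.
have coef (P : bool) : 0 <= (if P then 1 else w) by case: P; rewrite // ltW.
rewrite lerD ?FG // ler_pM2r ?invr_gt0 // lerD //.
- move: aN; rewrite leq_eqVlt => /orP[/eqP->|aN]; first by rewrite subnn mulr0 !mul0r.
  by rewrite ler_wpM2l ?mulr_ge0 // IH.
- move: bN; rewrite leq_eqVlt => /orP[/eqP->|bN]; first by rewrite subnn mulr0 !mul0r.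
  by rewrite ler_wpM2l ?mulr_ge0 ?IH //; case: (s); rewrite // ltW.
Qed.

(** [M] times the difference between [psi] and its mean after one step of the killed walk; for
    [psi = 1] it is the killing rate. *)
Definition drift psi s a b : R :=
  M * psi s a b - (if s then 1 else w) * (N%:R - a%:R) * psi true a.+1 b
                - (if s then w else 1) * (N%:R - b%:R) * psi false a b.+1.

(** The horizon [m] is the number of unvisited vertices. At [m = 0] both communities are exhausted
    and the drift is [M * psi], so Dynkin's formula has no boundary term. *)
Lemma green_drift m psi s a b : (a <= N)%N -> (b <= N)%N -> (a + b + m = 2 * N)%N ->
  green N w M m (drift psi) s a b = M * psi s a b.
Proof.
elim: m s a b => [|m IH] s a b aN bN abm /=.
  have [-> ->] : a = N /\ b = N by split; lia.
  by rewrite /drift !subrr !mulr0 !mul0r !subr0 addr0.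
have stepa : (N - a)%:R * green N w M m (drift psi) true a.+1 b =
    (N%:R - a%:R) * (M * psi true a.+1 b).
  have [->|aN'] := eqVneq a N; first by rewrite subnn subrr !mul0r.
  by rewrite natrB // IH //; lia.
have stepb : (N - b)%:R * green N w M m (drift psi) false a b.+1 =
    (N%:R - b%:R) * (M * psi false a b.+1).
  have [->|bN'] := eqVneq b N; first by rewrite subnn subrr !mul0r.
  by rewrite natrB // IH //; lia.
rewrite -!mulrA stepa stepb /drift; by case: s; field.
Qed.

Definition walk_sum F : R := green N w M (2 * N).-1 F true 1 0.
Local Notation E := walk_sum.

Lemma walk_sum_le F G :
  (forall s a b, (a <= N)%N -> (b <= N)%N -> F s a b <= G s a b) -> E F <= E G.
Proof. exact: green_le. Qed.

Lemma eq_walk_sum F G :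
  (forall s a b, (a <= N)%N -> (b <= N)%N -> F s a b = G s a b) -> E F = E G.
Proof.
move=> FG; apply/eqP; rewrite eq_le !walk_sum_le // => s a b aN bN;
  by rewrite FG.
Qed.

Lemma walk_sum_drift psi : E (drift psi) = M * psi true 1%N 0%N.
Proof. by apply: green_drift => //; lia. Qed.

Lemma walk_sum_lin x y F G :
  E (fun s a b => x * F s a b + y * G s a b) = x * E F + y * E G.
Proof. exact: green_lin. Qed.

Lemma walk_sumZ x F : E (fun s a b => x * F s a b) = x * E F.
Proof.
rewrite -[RHS]addr0 -[X in _ + X](mul0r (E F)) -walk_sum_lin.
by apply: eq_walk_sum => s a b _ _; rewrite mul0r addr0.
Qed.

Lemma walk_sumD F G : E (fun s a b => F s a b + G s a b) = E F + E G.
Proof.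
rewrite -[E F]mul1r -[E G]mul1r -walk_sum_lin.
by apply: eq_walk_sum => s a b _ _; rewrite !mul1r.
Qed.

Lemma walk_sumB F G : E (fun s a b => F s a b - G s a b) = E F - E G.
Proof.
rewrite -[E F]mul1r -[- E G]mulN1r -walk_sum_lin.
by apply: eq_walk_sum => s a b _ _; rewrite !mul1r mulN1r.
Qed.

Lemma walk_sum_ge0 F :
  (forall s a b, (a <= N)%N -> (b <= N)%N -> 0 <= F s a b) -> 0 <= E F.
Proof.
move=> F0; rewrite -(mul0r (E F)) -walk_sumZ.
by apply: walk_sum_le => s a b aN bN; rewrite mul0r F0.
Qed.

Lemma walk_sum_norm F : `|E F| <= E (fun s a b => `|F s a b|).
Proof.
rewrite ler_norml -[- _]mulN1r -walk_sumZ; apply/andP; split;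
  apply: walk_sum_le => s a b _ _; rewrite ?ler_norm // mulN1r lerNl -normrN; exact: ler_norm.
Qed.

(** * Moments of the walk and their balance equations *)

Definition mass1 := E (fun s a b => s%:R).
Definition mass2 := E (fun s a b => (~~ s)%:R).
Definition a_sum1 := E (fun s a b => s%:R * a%:R).
Definition a_sum2 := E (fun s a b => (~~ s)%:R * a%:R).
Definition b_sum1 := E (fun s a b => s%:R * b%:R).
Definition b_sum2 := E (fun s a b => (~~ s)%:R * b%:R).
Definition ab_sum1 := E (fun s a b => s%:R * (a%:R * b%:R)).
Definition ab_sum2 := E (fun s a b => (~~ s)%:R * (a%:R * b%:R)).

Lemma mass1_ge0 : 0 <= mass1. Proof. exact: walk_sum_ge0. Qed.
Lemma mass2_ge0 : 0 <= mass2. Proof. exact: walk_sum_ge0. Qed.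
Lemma a_sum1_ge0 : 0 <= a_sum1. Proof. by apply: walk_sum_ge0 => s a b _ _; rewrite mulr_ge0. Qed.
Lemma a_sum2_ge0 : 0 <= a_sum2. Proof. by apply: walk_sum_ge0 => s a b _ _; rewrite mulr_ge0. Qed.
Lemma b_sum1_ge0 : 0 <= b_sum1. Proof. by apply: walk_sum_ge0 => s a b _ _; rewrite mulr_ge0. Qed.
Lemma b_sum2_ge0 : 0 <= b_sum2. Proof. by apply: walk_sum_ge0 => s a b _ _; rewrite mulr_ge0. Qed.
Lemma ab_sum1_ge0 : 0 <= ab_sum1.
Proof. by apply: walk_sum_ge0 => s a b _ _; rewrite !mulr_ge0. Qed.
Lemma ab_sum2_ge0 : 0 <= ab_sum2.
Proof. by apply: walk_sum_ge0 => s a b _ _; rewrite !mulr_ge0. Qed.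

(* The four balance equations come from the test functions [1_{s=1}], [1_{s=2}],
   [b 1_{s=1}] and [a 1_{s=2}], whose drift has degree at most two. *)
Lemma balance_mass1 : (q + N%:R * w) * mass1 + a_sum1 + w * a_sum2 - w * N%:R * mass2 = M.
Proof.
rewrite /mass1 /mass2 /a_sum1 /a_sum2 -!walk_sumZ -!walk_sumD -walk_sumB.
rewrite -[RHS]mulr1 -(walk_sum_drift (fun s a b => s%:R)).
by apply: eq_walk_sum => -[] a b _ _; rewrite /drift /M /=; ring.
Qed.

Lemma balance_mass2 : (q + N%:R * w) * mass2 + b_sum2 + w * b_sum1 = w * N%:R * mass1.
Proof.
apply/eqP; rewrite -subr_eq0; apply/eqP.
rewrite /mass1 /mass2 /b_sum1 /b_sum2 -!walk_sumZ -!walk_sumD -walk_sumB.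
rewrite -[RHS](mulr0 M) -(walk_sum_drift (fun s a b => (~~ s)%:R)).
by apply: eq_walk_sum => -[] a b _ _; rewrite /drift /M /=; ring.
Qed.

Lemma balance_b_sum1 : (q + N%:R * w) * b_sum1 + ab_sum1 + w * ab_sum2 = w * N%:R * b_sum2.
Proof.
apply/eqP; rewrite -subr_eq0; apply/eqP.
rewrite /b_sum1 /b_sum2 /ab_sum1 /ab_sum2 -!walk_sumZ -!walk_sumD -walk_sumB.
transitivity (M * (true%:R * 0%:R)); last by rewrite !mulr0.
rewrite -(walk_sum_drift (fun s a b => s%:R * b%:R)).
by apply: eq_walk_sum => -[] a b _ _; rewrite /drift /M /=; ring.
Qed.

Lemma balance_a_sum2 : (q + N%:R * w) * a_sum2 + ab_sum2 + w * ab_sum1 = w * N%:R * a_sum1.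
Proof.
apply/eqP; rewrite -subr_eq0; apply/eqP.
rewrite /a_sum1 /a_sum2 /ab_sum1 /ab_sum2 -!walk_sumZ -!walk_sumD -walk_sumB.
transitivity (M * ((~~ true)%:R * 1%:R)); last by rewrite /= mul0r mulr0.
rewrite -(walk_sum_drift (fun s a b => (~~ s)%:R * a%:R)).
by apply: eq_walk_sum => -[] a b _ _; rewrite /drift /M /=; ring.
Qed.

(** Second moments occur only in [ab_sum1 + ab_sum2]. Adding the balances of [b_sum1] and [a_sum2]
    produces [1 + w] times this sum, whence the factor on the left; the mass balances then eliminate
    [a_sum1] and [b_sum2]. *)
Lemma walk_sum_tree_count_in : (1 + w) * E (fun _ => tree_count N w q true) =
  (q * (1 + w) + 2 * N%:R * w) * M + w * q * (1 - w) * a_sum2 - q * (1 - w) * b_sum1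
  - w * N%:R * q * (1 - w) * mass2 - q * (q * (1 + w) + N%:R * w * (3 + w)) * mass1.
Proof.
have -> : E (fun _ => tree_count N w q true) =
    (q + N%:R * w) * (a_sum1 + a_sum2) + w * N%:R * (b_sum1 + b_sum2) + (1 - w) * (ab_sum1 + ab_sum2).
  rewrite /a_sum1 /a_sum2 /b_sum1 /b_sum2 /ab_sum1 /ab_sum2 -!walk_sumD -!walk_sumZ -!walk_sumD.
  apply: eq_walk_sum => -[] a b aN bN; rewrite /tree_count /= !natrB //; ring.
have eA1 := balance_mass1; have eA2 := balance_mass2.
have eb1 := balance_b_sum1; have ea2 := balance_a_sum2.
have -> : (1 + w) * ((q + N%:R * w) * (a_sum1 + a_sum2) + w * N%:R * (b_sum1 + b_sum2) + (1 - w) * (ab_sum1 + ab_sum2)) =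
   (1 + w) * ((q + N%:R * w) * (a_sum1 + a_sum2) + w * N%:R * (b_sum1 + b_sum2))
   + (1 - w) * (((q + N%:R * w) * b_sum1 + ab_sum1 + w * ab_sum2) + ((q + N%:R * w) * a_sum2 + ab_sum2 + w * ab_sum1)
                - (q + N%:R * w) * (b_sum1 + a_sum2)) by ring.
rewrite eb1 ea2.
have -> : b_sum2 = w * N%:R * mass1 - w * b_sum1 - (q + N%:R * w) * mass2 by rewrite -eA2; ring.
have -> : a_sum1 = M - (q + N%:R * w) * mass1 - w * a_sum2 + w * N%:R * mass2 by rewrite -eA1; ring.
by ring.
Qed.

Lemma walk_sum_tree_count_out : (1 + w) * E (fun _ => tree_count N w q false) =
  2 * w * N%:R * M - q * ((1 - w) * (a_sum2 - w * b_sum1 + w * N%:R * mass1)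
    + (q * (1 + w) + N%:R * w * (3 + w)) * mass2).
Proof.
have -> : E (fun _ => tree_count N w q false) =
    (q + N%:R * w) * (b_sum1 + b_sum2) + w * N%:R * (a_sum1 + a_sum2) + (1 - w) * (ab_sum1 + ab_sum2).
  rewrite /a_sum1 /a_sum2 /b_sum1 /b_sum2 /ab_sum1 /ab_sum2 -!walk_sumD -!walk_sumZ -!walk_sumD.
  apply: eq_walk_sum => -[] a b aN bN; rewrite /tree_count /= !natrB //; ring.
have eA1 := balance_mass1; have eA2 := balance_mass2.
have eb1 := balance_b_sum1; have ea2 := balance_a_sum2.
have -> : (1 + w) * ((q + N%:R * w) * (b_sum1 + b_sum2) + w * N%:R * (a_sum1 + a_sum2) + (1 - w) * (ab_sum1 + ab_sum2)) =
   (1 + w) * ((q + N%:R * w) * (b_sum1 + b_sum2) + w * N%:R * (a_sum1 + a_sum2))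
   + (1 - w) * (((q + N%:R * w) * b_sum1 + ab_sum1 + w * ab_sum2) + ((q + N%:R * w) * a_sum2 + ab_sum2 + w * ab_sum1)
                - (q + N%:R * w) * (b_sum1 + a_sum2)) by ring.
rewrite eb1 ea2.
have -> : b_sum2 = w * N%:R * mass1 - w * b_sum1 - (q + N%:R * w) * mass2 by rewrite -eA2; ring.
have -> : a_sum1 = M - (q + N%:R * w) * mass1 - w * a_sum2 + w * N%:R * mass2 by rewrite -eA1; ring.
by ring.
Qed.

Lemma walk_sum_tree_count_ge0 s : 0 <= E (fun _ => tree_count N w q s).
Proof.
have MN (k : nat) : 0 <= M - (N - k)%:R.
  rewrite subr_ge0; apply: (@le_trans _ _ N%:R); first by rewrite ler_nat leq_subr.
  by have := mulr_gt0 nN w_gt0; have := q_gt0; rewrite /M; lra.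
apply: walk_sum_ge0 => s' a b aN bN.
by case: s; apply: addr_ge0; rewrite !mulr_ge0 // ltW.
Qed.

(** * Bounds on the mass and on the moments *)

Definition mass := mass1 + mass2.
Definition len_sum := (a_sum1 + b_sum1) + (a_sum2 + b_sum2).

Lemma kill_mass_le : q * mass <= M.
Proof.
have := balance_mass1; have := balance_mass2; rewrite /mass => e2 e1.
have := mulr_ge0 (ltW w_gt0) a_sum2_ge0; have := mulr_ge0 (ltW w_gt0) b_sum1_ge0.
have := a_sum1_ge0; have := b_sum2_ge0; lra.
Qed.

Lemma a_sum1_b_sum2_le : a_sum1 + b_sum2 <= M.
Proof.
have := balance_mass1; have := balance_mass2 => e2 e1.
have := mulr_ge0 (ltW w_gt0) a_sum2_ge0; have := mulr_ge0 (ltW w_gt0) b_sum1_ge0.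
have := mulr_ge0 (ltW q_gt0) mass1_ge0; have := mulr_ge0 (ltW q_gt0) mass2_ge0; lra.
Qed.

Lemma b_sum1_le_b_sum2 : b_sum1 <= b_sum2.
Proof.
have wN : 0 < w * N%:R by rewrite mulr_gt0.
rewrite -(ler_pM2l wN) -balance_b_sum1.
have := mulr_ge0 (ltW q_gt0) b_sum1_ge0; have := mulr_ge0 (ltW w_gt0) ab_sum2_ge0.
have := ab_sum1_ge0; lra.
Qed.

Lemma a_sum2_le_a_sum1 : a_sum2 <= a_sum1.
Proof.
have wN : 0 < w * N%:R by rewrite mulr_gt0.
rewrite -(ler_pM2l wN) -balance_a_sum2.
have := mulr_ge0 (ltW q_gt0) a_sum2_ge0; have := mulr_ge0 (ltW w_gt0) ab_sum1_ge0.
have := ab_sum2_ge0; lra.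
Qed.

Lemma b_sum2_le : b_sum2 <= w * N%:R * mass1.
Proof.
rewrite -balance_mass2; have := mulr_ge0 (ltW w_gt0) b_sum1_ge0.
have := mulr_ge0 (ltW q_gt0) mass2_ge0.
by have := mulr_ge0 (mulr_ge0 (ltW nN) (ltW w_gt0)) mass2_ge0; lra.
Qed.

Lemma len_sum_le : len_sum <= 2 * M.
Proof. by have := a_sum1_b_sum2_le; have := b_sum1_le_b_sum2; have := a_sum2_le_a_sum1; rewrite /len_sum; lra. Qed.

Lemma len_sum_ge0 : 0 <= len_sum.
Proof.
by rewrite /len_sum; have := a_sum1_ge0; have := a_sum2_ge0; have := b_sum1_ge0; have := b_sum2_ge0; lra.
Qed.

Lemma massE : mass = E (fun s a b => 1).
Proof.
by rewrite /mass /mass1 /mass2 -walk_sumD; apply: eq_walk_sum => -[] a b _ _; rewrite ?addr0 ?add0r.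
Qed.

Lemma len_sumE : len_sum = E (fun s a b => (a + b)%:R).
Proof.
rewrite /len_sum /a_sum1 /a_sum2 /b_sum1 /b_sum2 -!walk_sumD; apply: eq_walk_sum => -[] a b _ _;
  rewrite natrD /=; ring.
Qed.

Definition own (s : bool) (a b : nat) : R := if s then a%:R else b%:R.
Definition other (s : bool) (a b : nat) : R := if s then b%:R else a%:R.

(** The test function is [k = a + b]. With killing rate [r], its drift is
    [M k - (M - r) (k + 1) = (k + 1) r - M]. The mass thus controls second moments that involve the
    own community. *)
Lemma walk_sum_length :
  E (fun s a b => (a + b + 1)%:R * (q + own s a b + w * other s a b)) = M * (1 + mass).
Proof.
rewrite massE mulrDr; have -> : M * 1 = M * (1 + 0)%:R by [].
rewrite -(walk_sum_drift (fun s a b => (a + b)%:R)) -walk_sumZ -walk_sumD.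
apply: eq_walk_sum => s a b _ _; rewrite /drift /own /other /M addn1 addSn addnS -natr1 natrD.
by case: s; ring.
Qed.

(** The test function is [max (l - k) 0] with [k = a + b]. Its drift is at least [M] times its
    decrement, which is at least [1 - k / l] because [1 <= l]; then [len_sum <= 2 M] applies. The
    best [l] is of order [sqrt M]. *)
Lemma mass_le (l : R) : 1 <= l -> mass <= l + 2 * M / l.
Proof.
move=> l1; have l0 : 0 < l by lra.
have KM := len_sum_le.
suff : M * (mass - len_sum / l) <= M * l.
  rewrite ler_pM2l // lerBlDr => h; apply: (le_trans h); rewrite lerD2l.
  by rewrite ler_pM2r // invr_gt0.
pose psi (s : bool) (a b : nat) : R := Num.max (l - (a + b)%:R) 0.
have psi0 s a b : 0 <= psi s a b by rewrite le_max lexx orbT.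
have h1 : M * psi true 1%N 0%N <= M * l.
  by rewrite ler_pM2l // /psi ge_max; apply/andP; split; lra.
apply: le_trans h1; rewrite -walk_sum_drift.
have -> : M * (mass - len_sum / l) = E (fun s a b => M * (1 - (a + b)%:R / l)).
  rewrite walk_sumZ massE len_sumE; congr (_ * _).
  have -> : E (fun s a b => (a + b)%:R) / l = E (fun s a b => l^-1 * (a + b)%:R).
    by rewrite walk_sumZ mulrC.
  by rewrite -walk_sumB; apply: eq_walk_sum => s a b _ _; rewrite [_ * l^-1]mulrC.
apply: walk_sum_le => s a b aN bN.
have psiS s' : psi s' a.+1 b = psi s' a b.+1 by rewrite /psi addnS addSn.
have hd : 1 - (a + b)%:R / l <= psi s a b - psi s a b.+1.
  rewrite /psi addnS -natr1; set k : R := (a + b)%:R.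
  have k0 : 0 <= k by rewrite ler0n.
  have kl : 0 <= k / l by rewrite divr_ge0 // ltW.
  have kll : k / l * l = k by rewrite divfK // gt_eqF.
  rewrite /Num.max; case: ltP => h2; case: ltP => h3; nra.
have aN' : a%:R <= N%:R :> R by rewrite ler_nat.
have bN' : b%:R <= N%:R :> R by rewrite ler_nat.
have a0 : 0 <= a%:R :> R by []. have b0 : 0 <= b%:R :> R by [].
have p0 := psi0 s a b.+1.
apply: (@le_trans _ _ (M * (psi s a b - psi s a b.+1))); first by rewrite ler_pM2l.
rewrite /drift; have -> : psi true a.+1 b = psi s a b.+1 by rewrite psiS.
have -> : psi false a b.+1 = psi s a b.+1 by [].
rewrite /M; move: (psi s a b) (psi s a b.+1) p0 {hd} => x y y0.
have h1 := mulr_ge0 (ltW q_gt0) y0; have h2 := mulr_ge0 a0 y0; have h3 := mulr_ge0 b0 y0.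
have h4 := mulr_ge0 (ltW w_gt0) h2; have h5 := mulr_ge0 (ltW w_gt0) h3.
by case: s {psiS psi0 psi}; lra.
Qed.

Lemma b_sum1_le : b_sum1 <= M.
Proof. by have := b_sum1_le_b_sum2; have := a_sum1_b_sum2_le; have := a_sum1_ge0; lra. Qed.

Lemma b_sum1_le_mass : b_sum1 <= w * N%:R * mass.
Proof.
have := b_sum1_le_b_sum2; have := b_sum2_le.
have := mulr_ge0 (mulr_ge0 (ltW w_gt0) (ltW nN)) mass2_ge0; rewrite /mass; lra.
Qed.

Lemma a_sum2_le_total : a_sum2 <= M.
Proof. by have := a_sum2_le_a_sum1; have := a_sum1_b_sum2_le; have := b_sum2_ge0; lra. Qed.

Lemma mass2_le_mass1 : mass2 <= mass1.
Proof.
have wN : 0 < w * N%:R by rewrite mulr_gt0.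
rewrite -(ler_pM2l wN) -balance_mass2.
have := mulr_ge0 (ltW q_gt0) mass2_ge0; have := mulr_ge0 (ltW w_gt0) b_sum1_ge0.
by have := b_sum2_ge0; lra.
Qed.

(** By the mass balance on the second community, the net crossing flow equals the mass killed there;
    frequent crossings therefore equalise the two masses. *)
Lemma mass1_sub_mass2_le : w * N%:R * (mass1 - mass2) <= q * mass + 2 * M.
Proof.
have := balance_mass2; have := len_sum_le; rewrite /len_sum /mass.
have := mulr_ge0 (ltW q_gt0) mass1_ge0; have := ler_piMl b_sum1_ge0 w_le1.
have := a_sum1_ge0; have := a_sum2_ge0; lra.
Qed.

Lemma walk_sum_length_le F :
  (forall s a b, F s a b <= (a + b + 1)%:R * (q + own s a b + w * other s a b)) ->
  E F <= M * (1 + mass).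
Proof. by move=> h; rewrite -walk_sum_length; apply: walk_sum_le => s a b _ _; exact: h. Qed.

Lemma own_ge0 s a b : 0 <= own s a b. Proof. by case: s. Qed.
Lemma other_ge0 s a b : 0 <= other s a b. Proof. by case: s. Qed.

Lemma kill_len_sum_le : q * len_sum <= M * (1 + mass).
Proof.
rewrite len_sumE -walk_sumZ; apply: walk_sum_length_le => s a b.
have h1 := own_ge0 s a b; have h2 := mulr_ge0 (ltW w_gt0) (other_ge0 s a b).
rewrite mulrC ler_pM ?(ltW q_gt0) //; first by rewrite ler_nat leq_addr.
by move: h1 h2; lra.
Qed.

(** On the second community [a] enters the killing rate only with weight [w], so [walk_sum_length]
    does not control [a * a] there. The test function [a * a] on that community moves this moment to
    the first one, where [a] is the own count. *)
Lemma second_moment_a_sum2 : E (fun s a b => (~~ s)%:R * (a%:R * (a + b)%:R)) <= M * (1 + mass).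
Proof.
have wN : 0 < w * N%:R by rewrite mulr_gt0.
have h : E (fun s a b => (~~ s)%:R * (a%:R * a%:R)) <= E (fun s a b => s%:R * (a%:R * a%:R)).
  rewrite -subr_le0 -walk_sumB -(ler_pM2l wN) mulr0 -walk_sumZ.
  have -> : 0 = E (drift (fun s a b => (~~ s)%:R * (a%:R * a%:R))).
    by rewrite walk_sum_drift /= mul0r mulr0.
  apply: walk_sum_le => s a b aN bN; rewrite /drift /M.
  have a0 : 0 <= a%:R * a%:R :> R by rewrite mulr_ge0.
  have ba0 := mulr_ge0 (ler0n R b) a0; have qa0 := mulr_ge0 (ltW q_gt0) a0.
  have wba0 := mulr_ge0 (ltW w_gt0) ba0; have wa0 := mulr_ge0 (ltW w_gt0) a0.
  by case: s => /=; lra.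
have -> : E (fun s a b => (~~ s)%:R * (a%:R * (a + b)%:R)) =
    E (fun s a b => (~~ s)%:R * (a%:R * a%:R)) + ab_sum2.
  by rewrite /ab_sum2 -walk_sumD; apply: eq_walk_sum => s a b _ _; rewrite natrD; ring.
apply: (@le_trans _ _ (E (fun s a b => s%:R * (a%:R * a%:R)) + ab_sum2)); first by rewrite lerD2r.
rewrite /ab_sum2 -walk_sumD; apply: walk_sum_length_le => s a b.
rewrite !natrD /own /other; have a0 := ler0n R a; have b0 := ler0n R b.
have aa := mulr_ge0 a0 a0; have bb := mulr_ge0 b0 b0; have ab := mulr_ge0 a0 b0.
have qa := mulr_ge0 (ltW q_gt0) a0; have qb := mulr_ge0 (ltW q_gt0) b0.
have wa := mulr_ge0 (ltW w_gt0) a0; have wb := mulr_ge0 (ltW w_gt0) b0.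
have waa := mulr_ge0 (ltW w_gt0) aa; have wbb := mulr_ge0 (ltW w_gt0) bb.
have wab := mulr_ge0 (ltW w_gt0) ab; have q0 := ltW q_gt0.
by case: s => /=; lra.
Qed.

(* Test function: [a] times a linear cut-off at length [l], on the second
   community. *)
Lemma a_sum2_le_cutoff (l : R) : 1 <= l -> a_sum2 <= l * w * N%:R + M * (1 + mass) / l.
Proof.
move=> l1; have l0 : 0 < l by lra.
set S2 := E (fun s a b => (~~ s)%:R * (a%:R * (a + b)%:R)).
have S2M : S2 <= M * (1 + mass) := second_moment_a_sum2.
have wN : 0 < w * N%:R by rewrite mulr_gt0.
suff h : M * (l^-1 * a_sum2 - l^-1 * l^-1 * S2) <= w * N%:R * a_sum1.
  have a1M : w * N%:R * a_sum1 <= M * (w * N%:R).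
    by rewrite [M * _]mulrC ler_pM2l //; have := a_sum1_b_sum2_le; have := b_sum2_ge0; lra.
  have := le_trans h a1M; rewrite ler_pM2l // => h2.
  have : l * (l^-1 * a_sum2 - l^-1 * l^-1 * S2) <= l * (w * N%:R) by rewrite ler_pM2l.
  rewrite mulrBr !mulrA divff ?gt_eqF // !mul1r => h3.
  have : l^-1 * S2 <= l^-1 * (M * (1 + mass)) by rewrite ler_pM2l ?invr_gt0.
  by rewrite [_ / l]mulrC; lra.
pose phi (a b : nat) : R := Num.max (1 - (a + b)%:R / l) 0.
pose psi (s : bool) (a b : nat) : R := (~~ s)%:R * (a%:R * phi a b).
have : E (drift psi) = 0 by rewrite walk_sum_drift /psi /= mul0r mulr0.
rewrite -subr_le0 => e; rewrite -[X in _ <= X]e /a_sum1 /a_sum2 /S2.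
have -> : M * (l^-1 * E (fun s a b => (~~ s)%:R * a%:R)
      - l^-1 * l^-1 * E (fun s a b => (~~ s)%:R * (a%:R * (a + b)%:R)))
    - w * N%:R * E (fun s a b => s%:R * a%:R) =
  E (fun s a b => M * (l^-1 * ((~~ s)%:R * a%:R)
       - l^-1 * l^-1 * ((~~ s)%:R * (a%:R * (a + b)%:R)))
     - w * N%:R * (s%:R * a%:R)).
  by rewrite walk_sumB walk_sumZ walk_sumB !walk_sumZ.
apply: walk_sum_le => s a b aN bN; rewrite /drift /psi.
have bN' : b%:R <= N%:R :> R by rewrite ler_nat.
have a0 := ler0n R a; have b0 := ler0n R b.
have p0 : 0 <= phi a b.+1 by rewrite le_max lexx orbT.
have p1 : phi a b.+1 <= 1.
  by rewrite ge_max ler01 andbT lerBlDr lerDl divr_ge0 // ltW.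
have hd : l^-1 * (1 - (a + b)%:R * l^-1) <= phi a b - phi a b.+1.
  rewrite /phi addnS -natr1; set k : R := (a + b)%:R.
  have k0 : 0 <= k by rewrite ler0n.
  have li0 : 0 < l^-1 by rewrite invr_gt0.
  have li1 : l^-1 <= 1 by rewrite invf_le1.
  rewrite mulrDl mul1r; set z := k / l.
  have z0 : 0 <= z by rewrite mulr_ge0 // ltW.
  rewrite /Num.max; case: ltP => h2; case: ltP => h3; nra.
have ahd : a%:R * (l^-1 * (1 - (a + b)%:R * l^-1)) <= a%:R * (phi a b - phi a b.+1).
  by rewrite ler_wpM2l.
have ap : 0 <= a%:R * phi a b.+1 by rewrite mulr_ge0.
have ap1 : a%:R * phi a b.+1 <= a%:R by rewrite ler_piMr.
case: s => /=.
- have h1 : w * (N%:R - b%:R) * (a%:R * phi a b.+1) <= w * N%:R * a%:R.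
    rewrite ler_pM //; first by rewrite mulr_ge0 ?subr_ge0 // ltW.
    by rewrite ler_pM2l //; lra.
  by rewrite !mul0r !mulr0 !mul1r subrr mulr0; lra.
- have h1 := ler_wpM2l (ltW M_gt0) ahd.
  have h2 := mulr_ge0 (addr_ge0 (addr_ge0 (ltW q_gt0) (ltW wN)) b0) ap.
  by rewrite !mul0r !mulr0 !mul1r; move: h1 h2; rewrite /M; lra.
Qed.

(** * Comparison of the mass with the profile when [q * q = N] *)

Section Profile.
Hypothesis qqN : q * q = N%:R.
Variable g : R -> R.

Let h := q^-1.
Let q_neq0 : q != 0. Proof. by rewrite gt_eqF. Qed.
Let hq : h * q = 1. Proof. by rewrite mulVf. Qed.
Let h_gt0 : 0 < h. Proof. by rewrite invr_gt0. Qed.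
Let hN : h * N%:R = q. Proof. by rewrite -qqN mulrA hq mul1r. Qed.
Let hhN : h * h * N%:R = 1. Proof. by rewrite -mulrA hN hq. Qed.
Let h_le1 : h <= 1.
Proof.
rewrite invf_le1 // leNgt; apply/negP => q1.
have : q * q < 1 by have := q_gt0; nra.
by rewrite qqN ltNge ler1n N_gt0.
Qed.

Let G (k : nat) : R := g (h * k%:R).

(** The approximate equation with mesh [h = 1 / q], multiplied by [N]: since [h N = q] and
    [h h N = 1], the coefficient [1 + c s] at [s = h k] becomes [q + c k]. *)
Lemma profile_bounds c k : profile c g -> 0 <= c -> c <= 1 ->
  [/\ 0 <= G k <= 1, `|G k - G k.+1| <= h &
      `|N%:R * (G k - G k.+1) + (q + c * k%:R) * G k.+1 - q| <= 2 + h * k%:R].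
Proof.
move=> [g01 glip gode] c0 c1.
have s0 : 0 <= h * k%:R by rewrite mulr_ge0 // ltW.
have GS : G k.+1 = g (h * k%:R + h) by rewrite /G -natr1 mulrDr mulr1.
split; first exact: g01.
- by rewrite GS glip // ltW.
have := gode _ _ s0 (ltW h_gt0); rewrite -GS -/(G k).
rewrite -(ler_pM2l nN) -[X in X * `|_|](gtr0_norm nN) -normrM.
have -> : N%:R * (G k - G k.+1 + h * ((1 + c * (h * k%:R)) * G k.+1 - 1)) =
    N%:R * (G k - G k.+1) + (h * N%:R + c * (h * h * N%:R * k%:R)) * G k.+1 - h * N%:R by ring.
have -> : N%:R * (h * h * (1 + c + c * (h * k%:R))) = h * h * N%:R * (1 + c + c * (h * k%:R)).
  by ring.
rewrite hN hhN !mul1r => H; apply: le_trans H _; nra.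
Qed.

(** The test function lives on the first community only, and [c = 1] treats every visited vertex as
    an own one. The errors are crossings, of order [N w] per unit of mass, and the vertices counted
    by [b]. *)
Lemma mass1_profile : profile 1 g ->
  `|M * g h - q * mass1| <= (3 + 2 * N%:R * w) * mass + h * len_sum + b_sum1.
Proof.
move=> pg; pose psi (s : bool) (a b : nat) : R := s%:R * G (a + b).
have -> : M * g h = E (drift psi) by rewrite walk_sum_drift /psi /G addn0 mulr1 mul1r.
rewrite massE len_sumE /b_sum1 /mass1 -!walk_sumZ -walk_sumB -!walk_sumD.
apply: le_trans (walk_sum_norm _) _; apply: walk_sum_le => s a b aN bN.
have [G01 Glip Gode] := profile_bounds (a + b) pg ler01 (lexx 1).
have [G01' _ _] := profile_bounds (a + b).+1 pg ler01 (lexx 1).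
rewrite /drift /psi addSn addnS /=.
have a0 := ler0n R a; have b0 := ler0n R b.
have bN' : b%:R <= N%:R :> R by rewrite ler_nat.
have aN' : a%:R <= N%:R :> R by rewrite ler_nat.
have k0 : 0 <= h * (a + b)%:R by rewrite mulr_ge0 // ltW.
have wN : 0 < N%:R * w by rewrite mulr_gt0.
move: (G (a + b)) (G (a + b).+1) G01 G01' Glip Gode => x y /andP[x0 x1] /andP[y0 y1] Glip Gode.
case: s => /=; rewrite ?mul0r ?mulr0 ?mul1r ?mulr1 ?subr0 ?addr0 ?sub0r.
  have -> : M * x - (N%:R - a%:R) * y - q =
     (N%:R * (x - y) + (q + 1 * (a + b)%:R) * y - q) + (q + N%:R * w) * (x - y)
     + (N%:R * w) * y - b%:R * y by rewrite /M natrD; ring.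
  have e1 : `|(q + N%:R * w) * (x - y)| <= 1 + N%:R * w.
    rewrite normrM gtr0_norm ?addr_gt0 //.
    apply: (@le_trans _ _ ((q + N%:R * w) * h)); first by rewrite ler_pM2l ?addr_gt0.
    by have := ler_piMr (ltW wN) h_le1; rewrite mulrDl [q * h]mulrC hq; lra.
  have e2 : `|N%:R * w * y| <= N%:R * w by rewrite (ger0_norm (mulr_ge0 (ltW wN) y0)) ler_piMr // ltW.
  have e3 : `|b%:R * y| <= b%:R by rewrite ger0_norm ?mulr_ge0 // ler_piMr.
  apply: le_trans (ler_normB _ _) _; apply: le_trans (lerD (ler_normD _ _) (lexx _)) _.
  apply: le_trans (lerD (lerD (ler_normD _ _) (lexx _)) (lexx _)) _; lra.
rewrite normrN ger0_norm; last by rewrite !mulr_ge0 ?subr_ge0 // ltW.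
have : (N%:R - a%:R) * y <= N%:R by rewrite -[leRHS]mulr1 ler_pM ?subr_ge0 //; lra.
rewrite -(ler_pM2l w_gt0); lra.
Qed.

(** A crossing exchanges [own] and [other] and so reverses the sign of the test function; this makes
    [T = q + 2 N w] the relaxation rate of the imbalance between the visited counts. *)
Lemma signed_profile c : profile c g -> 0 <= c -> c <= 1 ->
  `|T * E (fun s a b => (own s a b - other s a b) * G (a + b).+1)| <=
  M * (2 + 2 * mass + h * len_sum).
Proof.
move=> pg c0 c1.
pose psi (s : bool) (a b : nat) : R := (own s a b - other s a b) * G (a + b).
have -> : T * E (fun s a b => (own s a b - other s a b) * G (a + b).+1) =
  E (drift psi) - E (fun s a b =>
     M * (own s a b - other s a b) * (G (a + b) - G (a + b).+1)
   + (own s a b - other s a b) * G (a + b).+1 * (own s a b - w * other s a b)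
   - G (a + b).+1 * ((N%:R - own s a b) + w * (N%:R - other s a b))).
  rewrite -walk_sumZ -walk_sumB; apply: eq_walk_sum => s a b _ _.
  by rewrite /drift /psi addSn addnS /own /other /T /M -!natr1; case: s; ring.
apply: le_trans (ler_normB _ _) _.
have psi1 : `|E (drift psi)| <= M.
  rewrite walk_sum_drift normrM gtr0_norm // -[leRHS]mulr1 ler_pM2l //.
  have [/andP[G0 G1] _ _] := profile_bounds 1 pg c0 c1.
  by rewrite /psi /own /other addn0 subr0 mul1r ger0_norm.
have lenE : E (fun s a b => (a + b)%:R * (own s a b + w * other s a b)) <= M * (1 + mass).
  apply: walk_sum_length_le => s a b; have o1 := own_ge0 s a b.
  have o2 := mulr_ge0 (ltW w_gt0) (other_ge0 s a b).
  by rewrite ler_pM // ?addr_ge0 // ?ler_nat ?leq_addr // -addrA lerDr ltW.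
suff H : `|E (fun s a b =>
     M * (own s a b - other s a b) * (G (a + b) - G (a + b).+1)
   + (own s a b - other s a b) * G (a + b).+1 * (own s a b - w * other s a b)
   - G (a + b).+1 * ((N%:R - own s a b) + w * (N%:R - other s a b)))| <=
   M * h * len_sum + E (fun s a b => (a + b)%:R * (own s a b + w * other s a b)) + M * mass by lra.
rewrite massE len_sumE -!walk_sumZ -!walk_sumD.
apply: le_trans (walk_sum_norm _) _; apply: walk_sum_le => s a b aN bN.
have [G01 Glip _] := profile_bounds (a + b) pg c0 c1.
have [G01' _ _] := profile_bounds (a + b).+1 pg c0 c1.
have o0 := own_ge0 s a b; have o0' := other_ge0 s a b.
have okN : own s a b <= N%:R by case: s {o0 o0'}; rewrite /own ler_nat.
have okN' : other s a b <= N%:R by case: s {o0 o0' okN}; rewrite /other ler_nat.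
have okk : own s a b + other s a b = (a + b)%:R.
  by case: s {o0 o0' okN okN'}; rewrite /own /other natrD // addrC.
move: (G (a + b)) (G (a + b).+1) G01 G01' Glip => x y /andP[x0 x1] /andP[y0 y1] Glip.
move: (own s a b) (other s a b) (a + b)%:R o0 o0' okN okN' okk => u v k u0 v0 uN vN uv.
have duv : `|u - v| <= k by rewrite ler_norml; apply/andP; split; lra.
have wv : 0 <= w * v by rewrite mulr_ge0 // ltW.
have duv' : `|u - w * v| <= u + w * v by rewrite ler_norml; apply/andP; split; lra.
have e1 : `|M * (u - v) * (x - y)| <= M * h * k.
  by rewrite 2!normrM (gtr0_norm M_gt0) -!mulrA ler_pM2l // [h * k]mulrC ler_pM.
have e2 : `|(u - v) * y * (u - w * v)| <= k * (u + w * v).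
  rewrite 2!normrM (ger0_norm y0) ler_pM // ?mulr_ge0 //.
  by rewrite -[leRHS]mulr1 ler_pM.
have z0 : 0 <= N%:R - u + w * (N%:R - v).
  by rewrite addr_ge0 ?subr_ge0 // mulr_ge0 ?subr_ge0 // ltW.
have e3 : `|y * (N%:R - u + w * (N%:R - v))| <= M * 1.
  rewrite mulr1 ger0_norm ?mulr_ge0 //; apply: (@le_trans _ _ (N%:R - u + w * (N%:R - v))).
    by rewrite ler_piMl.
  by rewrite /M; have := ltW q_gt0; lra.
apply: le_trans (ler_normB _ _) _; apply: lerD e3.
by apply: le_trans (ler_normD _ _) _; exact: lerD.
Qed.

(** Since [own = k / 2 + (own - other) / 2], the killing rate is [q + k / 2] up to [w * other] and
    an imbalance, which [signed_profile] makes small when [T] is large. *)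
Lemma mass_profile : profile 2^-1 g ->
  `|M * g h - q * mass| <= (3 + N%:R * w * h) * mass + (h + w) * len_sum
     + M * (2 + 2 * mass + h * len_sum) / (2 * T).
Proof.
move=> pg; have c0 : 0 <= 2^-1 :> R by []. have c1 : 2^-1 <= 1 :> R by lra.
pose psi (s : bool) (a b : nat) : R := G (a + b).
have -> : M * g h = E (drift psi) by rewrite walk_sum_drift /psi /G addn0 mulr1.
set D := E (fun s a b => (own s a b - other s a b) * G (a + b).+1).
have DT : `|D / 2| <= M * (2 + 2 * mass + h * len_sum) / (2 * T).
  rewrite ler_pdivlMr ?mulr_gt0 // -[2 * T]gtr0_norm ?mulr_gt0 // -normrM.
  have -> : D / 2 * (2 * T) = T * D by field.
  exact: signed_profile pg c0 c1.
have -> : E (drift psi) - q * mass = (E (drift psi) - q * mass - D / 2) + D / 2 by ring.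
apply: le_trans (ler_normD _ _) _; apply: lerD DT.
have -> : D / 2 = 2^-1 * D by rewrite mulrC.
rewrite massE len_sumE /D -!walk_sumZ -!walk_sumB -!walk_sumD.
apply: le_trans (walk_sum_norm _) _; apply: walk_sum_le => s a b aN bN.
have [G01 Glip Gode] := profile_bounds (a + b) pg c0 c1.
have [G01' _ _] := profile_bounds (a + b).+1 pg c0 c1.
have o0 := own_ge0 s a b; have o0' := other_ge0 s a b.
have okk : own s a b + other s a b = (a + b)%:R.
  by case: s {o0 o0'}; rewrite /own /other natrD // addrC.
have -> : drift psi s a b = M * G (a + b)
   - (M - q - own s a b - w * other s a b) * G (a + b).+1.
  rewrite /drift /psi addSn addnS /own /other /M; by case: s {o0 o0' okk}; ring.
have wN : 0 < N%:R * w by rewrite mulr_gt0.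
move: (G (a + b)) (G (a + b).+1) G01 G01' Glip Gode => x y /andP[x0 x1] /andP[y0 y1] Glip Gode.
move: (own s a b) (other s a b) (a + b)%:R o0 o0' okk Gode => u v k u0 v0 uv Gode.
have k0 : 0 <= k by lra.
have -> : M * x - (M - q - u - w * v) * y - q * 1 - 2^-1 * ((u - v) * y) =
   (N%:R * (x - y) + (q + 2^-1 * k) * y - q) + (q + N%:R * w) * (x - y) + w * v * y.
  by rewrite /M -uv; field.
have e1 : `|(q + N%:R * w) * (x - y)| <= 1 + N%:R * w * h.
  rewrite normrM gtr0_norm ?addr_gt0 //.
  apply: (@le_trans _ _ ((q + N%:R * w) * h)); first by rewrite ler_pM2l ?addr_gt0.
  by rewrite mulrDl [q * h]mulrC hq.
have e2 : `|w * v * y| <= w * k.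
  rewrite ger0_norm; last by rewrite !mulr_ge0 // ltW.
  by rewrite -mulrA ler_pM2l // -[leRHS]mulr1 ler_pM //; lra.
apply: le_trans (ler_normD _ _) _; apply: le_trans (lerD (ler_normD _ _) (lexx _)) _; lra.
Qed.

End Profile.

(** * The two potentials in terms of the moments *)

Let Uo := U_out N 1 w q.
Let Ui := U_in N 1 w q.

Lemma U_out_walk : (1 + w) * T * N%:R * Uo = q * (1 - w) * N%:R +
  q * ((1 - w) * (a_sum2 - w * b_sum1 + w * N%:R * mass1)
       + (q * (1 + w) + N%:R * w * (3 + w)) * mass2).
Proof.
have e := U_out_green (ltW w_gt0) q_gt0 N_gt0; rewrite -/Uo -/M -/T -/(E _) in e.
have := walk_sum_tree_count_out.
have -> : E (fun _ => tree_count N w q false) = T * (N%:R * (1 - Uo)).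
  by rewrite e mulrC divfK.
by rewrite /M /T; lra.
Qed.

Lemma U_in_walk : (1 + w) * T * ((N%:R - 1) * Ui) =
  q * (q * (1 + w) + N%:R * w * (3 + w)) * (mass1 - 1) - w * q * (1 - w) * a_sum2
  + q * (1 - w) * b_sum1 + w * N%:R * q * (1 - w) * mass2.
Proof.
have e := U_in_green (ltW w_gt0) q_gt0 N_gt0; rewrite -/Ui -/M -/T -/(E _) in e.
have := walk_sum_tree_count_in.
have -> : E (fun _ => tree_count N w q true) = T * (1 + (N%:R - 1) * (1 - Ui)).
  by rewrite e mulrC divfK.
by rewrite /M /T; lra.
Qed.

Let c0 : R := (1 + w) * T * N%:R.
Let c0_gt0 : 0 < c0. Proof. by rewrite !mulr_gt0 // addr_gt0. Qed.
(** Clearing the denominator [c0] leaves polynomial inequalities, which [lra] settles once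
    [monomials] and [slack] supply the signs of the nonlinear terms. *)
Let norm_le_scale (x y P : R) : c0 * x = P -> - (c0 * y) <= P -> P <= c0 * y -> `|x| <= y.
Proof.
move=> e h1 h2; rewrite ler_norml.
by apply/andP; split; rewrite -(ler_pM2l c0_gt0) ?mulrN e.
Qed.

Let T0 : T != 0 := T_neq0.
Let nN0 : N%:R != 0 :> R. Proof. by rewrite gt_eqF. Qed.

Let monomials (x : R) : 0 <= x ->
  [/\ 0 <= q * x, 0 <= q * w * x, 0 <= q * w * w * x &
      [/\ 0 <= q * (N%:R * w) * x, 0 <= q * (N%:R * w * w) * x, 0 <= q * q * x & 0 <= q * q * w * x]].
Proof. by move=> x0; split; [..|split]; rewrite !mulr_ge0 // ltW. Qed.

Let slack (x : R) : 0 <= x -> 0 <= q * w * (1 - w) * x.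
Proof. by move=> x0; rewrite !mulr_ge0 ?subr_ge0 // ltW. Qed.

(** The centre is the moment-free term of the exact formula. It governs [alpha < 1/2], where
    [q * mass / N] vanishes. *)
Lemma U_out_error : `|Uo - q / T * ((1 - w) / (1 + w))| <=
  q / T * ((a_sum2 + w * b_sum1) / N%:R) + 2 * (q / N%:R * mass).
Proof.
have w1 : 1 + w != 0 by rewrite gt_eqF // addr_gt0.
apply: (norm_le_scale (P := q * ((1 - w) * (a_sum2 - w * b_sum1 + w * N%:R * mass1)
       + (q * (1 + w) + N%:R * w * (3 + w)) * mass2))).
- rewrite mulrBr [c0 * Uo]U_out_walk.
  have -> : c0 * (q / T * ((1 - w) / (1 + w))) = q * (1 - w) * N%:R.
    by rewrite /c0; field; rewrite ?w1 ?T0 ?nN0.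
  by ring.
all: have -> : c0 * (q / T * ((a_sum2 + w * b_sum1) / N%:R) + 2 * (q / N%:R * mass)) =
  q * (1 + w) * (a_sum2 + w * b_sum1) + 2 * q * (1 + w) * T * mass by rewrite /c0; field; rewrite ?w1 ?T0 ?nN0.
all: have [? ? ? [? ? ? ?]] := monomials mass1_ge0; have [? ? ? [? ? ? ?]] := monomials mass2_ge0.
all: have [? ? ? _] := monomials a_sum2_ge0; have [? ? ? _] := monomials b_sum1_ge0.
all: have [? ?] := (slack a_sum2_ge0, slack b_sum1_ge0).
all: rewrite /mass /T; lra.
Qed.

(** Meant for [alpha = 1/2] with frequent crossings: [q / T] and the rescaled imbalance
    [mass1 - mass2] vanish, and [q * mass / N] carries the limit. *)
Lemma U_out_diff : `|Uo - q / N%:R * mass| <= q / T + q / T * ((a_sum2 + b_sum1) / N%:R) +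
  q / N%:R * (q / T * mass + 2 * w * mass + (mass1 - mass2) / 2).
Proof.
have w1 : 1 + w != 0 by rewrite gt_eqF // addr_gt0.
have d0 : 0 <= mass1 - mass2 by rewrite subr_ge0 mass2_le_mass1.
apply: (norm_le_scale (P := q * (1 - w) * N%:R + q * (1 - w) * (a_sum2 - w * b_sum1)
   + q * ((N%:R * w - N%:R * w * w) * (mass2 - mass1) - (1 + w) * q * mass1 - 4 * (N%:R * w * w) * mass1))).
- rewrite mulrBr [c0 * Uo]U_out_walk.
  have -> : c0 * (q / N%:R * mass) = q * (1 + w) * T * mass.
    by rewrite /c0; field.
  by rewrite /T /mass; ring.
all: have -> : c0 * (q / T + q / T * ((a_sum2 + b_sum1) / N%:R) +
     q / N%:R * (q / T * mass + 2 * w * mass + (mass1 - mass2) / 2)) =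
  q * (1 + w) * N%:R + q * (1 + w) * (a_sum2 + b_sum1) +
     q * (1 + w) * (q * mass + 2 * w * T * mass + T * (mass1 - mass2) / 2) by rewrite /c0; field; rewrite ?w1 ?T0 ?nN0.
all: have [? ? ? [? ? ? ?]] := monomials mass1_ge0; have [? ? ? [? ? ? ?]] := monomials mass2_ge0.
all: have [? ? ? [? ? ? ?]] := monomials d0.
all: have [? ? ? [? ? ? ?]] := monomials (mulr_ge0 (ltW w_gt0) mass1_ge0).
all: have [? ? ? [? ? ? ?]] := monomials (mulr_ge0 (ltW w_gt0) mass2_ge0).
all: have [? ? ? _] := monomials a_sum2_ge0; have [? ? ? _] := monomials b_sum1_ge0.
all: have [? ?] := (slack a_sum2_ge0, slack b_sum1_ge0).
all: have [? ? ? _] := monomials (ltW nN).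
all: rewrite /mass /T; lra.
Qed.

(** In the upper bound every moment term has a favourable sign except that of [b_sum1], which gives
    the second summand. *)
Lemma U_out_ge : 0 <= 1 - Uo <= 2 * w * (M / q) + w * (M / N%:R).
Proof.
have w1 : 1 + w != 0 by rewrite gt_eqF // addr_gt0.
have e : c0 * (1 - Uo) = 2 * w * N%:R * M - q * ((1 - w) * (a_sum2 - w * b_sum1 + w * N%:R * mass1)
    + (q * (1 + w) + N%:R * w * (3 + w)) * mass2).
  by rewrite mulrBr [c0 * Uo]U_out_walk /c0 /M /T; ring.
apply/andP; split.
  have -> : 1 - Uo = (T * (N%:R * (1 - Uo))) / (T * N%:R) by field; rewrite ?T0 ?nN0.
  have -> : T * (N%:R * (1 - Uo)) = E (fun _ => tree_count N w q false).
    by rewrite (U_out_green (ltW w_gt0) q_gt0 N_gt0) -/M -/T -/(E _) mulrC divfK.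
  apply: divr_ge0; last by rewrite mulr_ge0 // ltW.
  exact: walk_sum_tree_count_ge0.
rewrite -(ler_pM2l c0_gt0) e.
have qT : q <= T by rewrite /T lerDl !mulr_ge0 // ltW.
have h1 : N%:R * (2 * w * M) <= c0 * (2 * w * (M / q)).
  have -> : c0 * (2 * w * (M / q)) = (2 * w * M) * ((1 + w) * (T / q) * N%:R).
    by rewrite /c0; field; rewrite gt_eqF.
  rewrite mulrC ler_pM2l ?mulr_gt0 // ler_peMl ?ler0n // mulr_ege1 //.
    by rewrite lerDl ltW.
  by rewrite ler_pdivlMr // mul1r.
have h2 : q * (w * b_sum1) <= c0 * (w * (M / N%:R)).
  have -> : c0 * (w * (M / N%:R)) = ((1 + w) * T) * (w * M) by rewrite /c0; field.
  apply: ler_pM; [exact: ltW | by rewrite mulr_ge0 ?b_sum1_ge0 // ltW | | by rewrite ler_pM2l // b_sum1_le].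
  by apply: le_trans qT _; rewrite ler_peMl ?ltW // ltrDl.
have [? ? ? [? ? ? ?]] := monomials mass1_ge0; have [? ? ? [? ? ? ?]] := monomials mass2_ge0.
have [? ? ? _] := monomials a_sum2_ge0; have [? ? ? _] := monomials b_sum1_ge0.
have a2w : 0 <= q * (1 - w) * a_sum2 by rewrite !mulr_ge0 ?a_sum2_ge0 ?subr_ge0 // ltW.
have A1w : 0 <= q * (1 - w) * (N%:R * w) * mass1.
  by rewrite !mulr_ge0 ?mass1_ge0 ?subr_ge0 // ltW.
rewrite [leRHS]mulrDr; apply: le_trans (lerD h1 h2); lra.
Qed.

(** The exact formula for [Ui] carries [N - 1]; rescaling gives both potentials the same denominator
    [c0], and [U_in_rescaled] undoes it. *)
Let V := (N%:R - 1) / N%:R * Ui.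

Lemma scaled_U_in_walk : c0 * V = q * (q * (1 + w) + N%:R * w * (3 + w)) * (mass1 - 1)
  - w * q * (1 - w) * a_sum2 + q * (1 - w) * b_sum1 + w * N%:R * q * (1 - w) * mass2.
Proof. by rewrite -U_in_walk /c0 /V; field. Qed.

(** Centred at [mass1], which carries the limit at [alpha = 1/2] when crossings are rare;
    [U_in_diff] is the counterpart for frequent ones. *)
Lemma U_in_error : `|V - q / N%:R * mass1| <= 2 * (q / N%:R) + q / N%:R * (N%:R * w / T * mass)
  + q / T * ((b_sum1 + w * a_sum2) / N%:R).
Proof.
have w1 : 1 + w != 0 by rewrite gt_eqF // addr_gt0.
apply: (norm_le_scale (P := - (q * (q * (1 + w) + N%:R * w * (3 + w)))
  + q * (1 - w) * (N%:R * w * mass) + q * (1 - w) * (b_sum1 - w * a_sum2))).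
- rewrite mulrBr scaled_U_in_walk.
  have -> : c0 * (q / N%:R * mass1) = q * (1 + w) * T * mass1 by rewrite /c0; field.
  by rewrite /T /mass; ring.
all: have -> : c0 * (2 * (q / N%:R) + q / N%:R * (N%:R * w / T * mass)
     + q / T * ((b_sum1 + w * a_sum2) / N%:R)) =
  2 * q * (1 + w) * T + q * (1 + w) * (N%:R * w * mass) + q * (1 + w) * (b_sum1 + w * a_sum2)
  by rewrite /c0; field; rewrite ?w1 ?T0 ?nN0.
all: have [? ? ? [? ? ? ?]] := monomials mass1_ge0; have [? ? ? [? ? ? ?]] := monomials mass2_ge0.
all: have [? ? ? _] := monomials a_sum2_ge0; have [? ? ? _] := monomials b_sum1_ge0.
all: have [? ?] := (slack a_sum2_ge0, slack b_sum1_ge0).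
all: have [? ? ? [? ? ? ?]] := monomials ler01.
all: rewrite /mass /T; lra.
Qed.

Lemma U_in_diff : `|V - q / N%:R * mass| <= 2 * (q / N%:R) + q / T * ((a_sum2 + b_sum1) / N%:R) +
  q / N%:R * (q / T * mass + 2 * w * mass + (mass1 - mass2) / 2).
Proof.
have w1 : 1 + w != 0 by rewrite gt_eqF // addr_gt0.
have d0 : 0 <= mass1 - mass2 by rewrite subr_ge0 mass2_le_mass1.
apply: (norm_le_scale (P := - (q * (q * (1 + w) + N%:R * w * (3 + w)))
   + q * (1 - w) * (b_sum1 - w * a_sum2)
   + q * ((N%:R * w - N%:R * w * w) * (mass1 - mass2) - (1 + w) * q * mass2 - 4 * (N%:R * w * w) * mass2))).
- rewrite mulrBr scaled_U_in_walk.
  have -> : c0 * (q / N%:R * mass) = q * (1 + w) * T * mass by rewrite /c0; field.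
  by rewrite /T /mass; ring.
all: have -> : c0 * (2 * (q / N%:R) + q / T * ((a_sum2 + b_sum1) / N%:R) +
     q / N%:R * (q / T * mass + 2 * w * mass + (mass1 - mass2) / 2)) =
  2 * q * (1 + w) * T + q * (1 + w) * (a_sum2 + b_sum1) +
     q * (1 + w) * (q * mass + 2 * w * T * mass + T * (mass1 - mass2) / 2) by rewrite /c0; field; rewrite ?w1 ?T0 ?nN0.
all: have [? ? ? [? ? ? ?]] := monomials mass1_ge0; have [? ? ? [? ? ? ?]] := monomials mass2_ge0.
all: have [? ? ? [? ? ? ?]] := monomials d0.
all: have [? ? ? [? ? ? ?]] := monomials (mulr_ge0 (ltW w_gt0) mass1_ge0).
all: have [? ? ? [? ? ? ?]] := monomials (mulr_ge0 (ltW w_gt0) mass2_ge0).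
all: have [? ? ? _] := monomials a_sum2_ge0; have [? ? ? _] := monomials b_sum1_ge0.
all: have [? ?] := (slack a_sum2_ge0, slack b_sum1_ge0).
all: have [? ? ? [? ? ? ?]] := monomials ler01.
all: rewrite /mass /T; lra.
Qed.

(** The balance equations bound the mixed moments by [N w * len_sum]. Divided by [T], this bounds
    the mean tree content by [2 * len_sum], which is enough for [alpha > 1/2]. *)
Lemma walk_sum_tree_count_le s : E (fun _ => tree_count N w q s) <= 2 * T * len_sum.
Proof.
have ab_le : ab_sum1 + ab_sum2 <= N%:R * w * len_sum.
  have := balance_b_sum1; have := balance_a_sum2.
  have := mulr_ge0 (ltW w_gt0) ab_sum1_ge0; have := mulr_ge0 (ltW w_gt0) ab_sum2_ge0.
  have Nw0 := mulr_ge0 (ltW nN) (ltW w_gt0).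
  have := mulr_ge0 (ltW q_gt0) b_sum1_ge0; have := mulr_ge0 (ltW q_gt0) a_sum2_ge0.
  have := mulr_ge0 Nw0 b_sum1_ge0; have := mulr_ge0 Nw0 a_sum2_ge0.
  have := mulr_ge0 Nw0 b_sum2_ge0; have := mulr_ge0 Nw0 a_sum1_ge0; rewrite /len_sum; lra.
have h : E (fun _ => tree_count N w q s) <= T * len_sum + (ab_sum1 + ab_sum2).
  rewrite len_sumE /ab_sum1 /ab_sum2 -walk_sumZ -!walk_sumD; apply: walk_sum_le => s' a b aN bN.
  have a0 := ler0n R a; have b0 := ler0n R b.
  have wab : 0 <= w * (a%:R * b%:R) by rewrite !mulr_ge0 // ltW.
  have qa := mulr_ge0 (ltW q_gt0) a0; have qb := mulr_ge0 (ltW q_gt0) b0.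
  have wa : 0 <= N%:R * w * a%:R by rewrite !mulr_ge0 // ltW.
  have wb : 0 <= N%:R * w * b%:R by rewrite !mulr_ge0 // ltW.
  rewrite /tree_count !natrB // natrD /M /T; case: s; case: s' => /=; lra.
have := mulr_ge0 (ltW q_gt0) len_sum_ge0; have := mulr_ge0 (mulr_ge0 (ltW nN) (ltW w_gt0)) len_sum_ge0.
by move: h ab_le; rewrite /T; lra.
Qed.

Lemma U_out_small : N%:R * (1 - Uo) <= 2 * len_sum.
Proof.
have e := U_out_green (ltW w_gt0) q_gt0 N_gt0; rewrite -/Uo -/M -/T -/(E _) in e.
by rewrite e ler_pdivrMr // mulrAC walk_sum_tree_count_le.
Qed.

Lemma U_in_small : 0 <= 1 + (N%:R - 1) * (1 - Ui) <= 2 * len_sum.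
Proof.
have e := U_in_green (ltW w_gt0) q_gt0 N_gt0; rewrite -/Ui -/M -/T -/(E _) in e.
rewrite e ler_pdivrMr // mulrAC walk_sum_tree_count_le andbT.
by apply: divr_ge0; [exact: walk_sum_tree_count_ge0 | exact: ltW].
Qed.

End WalkSum.

(** * The limiting profile *)

Local Open Scope classical_set_scope.
Local Open Scope ring_scope.

Section ProfileExists.
Context (R : realType).

Lemma MVT_le (f df : R -> R) (a b : R) : a <= b ->
  (forall x : R, a <= x <= b -> is_derive x (1 : R) f (df x)) ->
  exists2 x, a <= x <= b & f b - f a = df x * (b - a).
Proof.
move=> ab dfx.
have [||x] := @MVT_segment R f df a b ab.
- by move=> x; rewrite in_itv /= => /andP[ax xb]; apply: dfx; rewrite !ltW.
- apply: derivable_within_continuous => x; rewrite in_itv /= => xab.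
  by have [] := dfx _ xab.
- by rewrite in_itv /= => xab e; exists x.
Qed.

Lemma continuous_antiderivative (f : R -> R) : continuous f ->
  exists H : R -> R, forall x : R, 0 <= x -> is_derive x (1 : R) H (f x).
Proof.
(* Starting the integral at [-1] makes [0] an interior point, with a two-sided derivative. *)
move=> cf; exists (fun x => (\int[@lebesgue_measure R]_(t in `[(-1), x]) f t)%R) => x x0.
have xx1 : x < x + 1 by rewrite ltrDl.
have ie : lebesgue_measure.-integrable `[-1, x + 1] (EFin \o f).
  apply: continuous_compact_integrable; first exact: segment_compact.
  exact: continuous_subspaceT.
have x1 : -1 < x by lra.
have [dH eH] := continuous_FTC1_closed xx1 ie x1 (cf x).
by split => //; rewrite -eH derive1E.
Qed.

Variable c : R.
Hypotheses (c_gt0 : 0 < c).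

Let phi (s : R) : R := s + c / 2 * s ^+ 2.
Let e (s : R) : R := expR (- phi s).

Let is_derive_phi s : is_derive s (1 : R) phi (1 + c * s).
Proof. by apply: is_derive_eq; rewrite /GRing.scale /=; field. Qed.

Let is_derive_e s : is_derive s (1 : R) e (- (1 + c * s) * e s).
Proof. by apply: is_derive_eq; rewrite /GRing.scale /= /e; field. Qed.

Let e_gt0 s : 0 < e s. Proof. exact: expR_gt0. Qed.

Let continuous_e : continuous e.
Proof. by move=> s; apply/differentiable_continuous/derivable1_diffP; have [] := is_derive_e s. Qed.

(** The solution is [exp (phi s)] times the integral of [exp (- phi)] over [[s, oo)], where
    [phi' = 1 + c s]. That improper integral is written [I - H s], with [I] the supremum of the
    antiderivative [H] over the nonnegative reals. *)
Lemma profile_exists : exists g : R -> R, profile c g /\ 0 < g 0 < 1.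
Proof.
have [H dH] := continuous_antiderivative continuous_e.
have Hincr s t : 0 <= s -> s <= t -> 0 <= H t - H s.
  move=> s0 st; have [|x /andP[sx xt] ->] := @MVT_le H e s t st.
    by move=> x /andP[sx _]; apply: dH; lra.
  by rewrite mulr_ge0 ?subr_ge0 // ltW.
(* On [[s, t]] the factor [1 + c s] is at most [1 + c x], and [(1 + c x) * e x] is minus the
   derivative of [e]. This gives both the finiteness of [I] and [(1 + c s) * g s <= 1]. *)
have Htail s t : 0 <= s -> s <= t -> (1 + c * s) * (H t - H s) <= e s - e t.
  move=> s0 st.
  have [|x /andP[sx xt]] := @MVT_le (fun x => (1 + c * s) * H x + e x)
     (fun x => (1 + c * s) * e x - (1 + c * x) * e x) s t st.
    move=> x /andP[sx _]; have x0 : 0 <= x by lra.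
    have dHx := dH _ x0; have dex := is_derive_e x.
    by apply: is_derive_eq; rewrite /GRing.scale /=; ring.
  move=> h; have : ((1 + c * s) * e x - (1 + c * x) * e x) * (t - s) <= 0.
    rewrite -mulrBl mulr_le0_ge0 ?subr_ge0 // mulr_le0_ge0 ?(ltW (e_gt0 _)) //.
    by rewrite opprD addrACA subrr add0r -mulrBr mulr_ge0_le0 ?subr_le0 // ltW.
  by rewrite -h; lra.
pose S := [set H t | t in [set t : R | 0 <= t]].
have Sub s : 0 <= s -> ubound S (H s + e s / (1 + c * s)).
  move=> s0 _ [t /= t0 <-]; have cs : 0 < 1 + c * s by rewrite ltr_pwDl // mulr_ge0 // ltW.
  have [ts|st] := leP t s.
    have := Hincr _ _ t0 ts; have := divr_gt0 (e_gt0 s) cs; lra.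
  rewrite -lerBlDl ler_pdivlMr // mulrC.
  by have := Htail _ _ s0 (ltW st); have := e_gt0 t; lra.
have S0 : S !=set0 by exists (H 0); exists 0 => /=.
have hS : has_sup S by split => //; exists (H 0 + e 0 / (1 + c * 0)); exact: Sub.
pose I := sup S.
have IH s : 0 <= s -> H s <= I by move=> s0; apply: ub_le_sup; [case: hS | exists s].
have Itail s : 0 <= s -> (1 + c * s) * (I - H s) <= e s.
  move=> s0; have cs : 0 < 1 + c * s by rewrite ltr_pwDl // mulr_ge0 // ltW.
  by rewrite mulrC -ler_pdivlMr // lerBlDl; apply: ge_sup => //; exact: Sub.
pose g s := (I - H s) * expR (phi s).
have eK s : e s * expR (phi s) = 1 by rewrite /e -expRD addNr expR0.
have g0 s : 0 <= s -> 0 <= g s by move=> s0; rewrite mulr_ge0 ?subr_ge0 ?IH // expR_ge0.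
have gle s : 0 <= s -> (1 + c * s) * g s <= 1.
  by move=> s0; rewrite /g mulrA -[leRHS](eK s) ler_pM2r ?expR_gt0 // Itail.
have g1 s : 0 <= s -> g s <= 1.
  move=> s0; apply: le_trans (gle _ s0); rewrite ler_peMl ?g0 // lerDl.
  by rewrite mulr_ge0 // ltW.
have dg (s : R) : 0 <= s -> is_derive s (1 : R) g ((1 + c * s) * g s - 1).
  move=> s0; have dHs := dH _ s0; have dps := is_derive_phi s.
  apply: is_derive_eq; rewrite /GRing.scale /= -[X in _ = _ - X](eK s) /g; ring.
have gmvt s t : 0 <= s -> s <= t ->
    exists2 x, s <= x <= t & g t - g s = ((1 + c * x) * g x - 1) * (t - s).
  by move=> s0 st; apply: MVT_le => // x /andP[sx _]; apply: dg; lra.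
have glip s t : 0 <= s -> s <= t -> `|g s - g t| <= t - s.
  move=> s0 st; rewrite distrC; have [x /andP[sx xt] ->] := gmvt _ _ s0 st.
  have x0 : 0 <= x by lra.
  have gx : 0 <= (1 + c * x) * g x by rewrite mulr_ge0 ?g0 // addr_ge0 // mulr_ge0 // ltW.
  rewrite normrM [`|t - s|]ger0_norm ?subr_ge0 // ler_piMl ?subr_ge0 //.
  by rewrite ler_norml; have := gle _ x0; lra.
exists g; split.
  split=> [s s0 | s h s0 h0 | s h s0 h0].
  - by rewrite g0 ?g1.
  - by apply: le_trans (glip s (s + h) s0 _) _; rewrite ?lerDl // addrAC subrr add0r.
  have sh : s <= s + h by rewrite lerDl.
  have [x /andP[sx xsh]] := gmvt _ _ s0 sh; rewrite addrAC subrr add0r => eg.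
  have x0 : 0 <= x by lra.
  have -> : g s - g (s + h) + h * ((1 + c * s) * g (s + h) - 1) =
     h * ((1 + c * s) * (g (s + h) - g x) - c * (x - s) * g x).
    by rewrite -opprB eg; ring.
  rewrite normrM ger0_norm // -[leRHS]mulrA ler_wpM2l //.
  apply: le_trans (ler_normB _ _) _.
  have cs : 0 < 1 + c * s by rewrite ltr_pwDl // mulr_ge0 // ltW.
  have h1 : `|(1 + c * s) * (g (s + h) - g x)| <= (1 + c * s) * h.
    rewrite normrM gtr0_norm // ler_pM2l // distrC.
    by apply: le_trans (glip _ _ x0 xsh) _; lra.
  have h2 : `|c * (x - s) * g x| <= c * h.
    have gx0 := g0 _ x0; have gx1 := g1 _ x0; have xs0 : 0 <= x - s by rewrite subr_ge0.
    move: (g x) gx0 gx1 => y y0 y1; rewrite ger0_norm; last by rewrite !mulr_ge0 // ltW.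
    rewrite -mulrA ler_pM2l //; apply: (@le_trans _ _ (x - s)); last by lra.
    by rewrite ler_piMr.
  by lra.
have phi0 : phi 0 = 0 by rewrite /phi expr0n mulr0 addr0.
have gE : g 0 = I - H 0 by rewrite /g phi0 expR0 mulr1.
have H01 : 0 < H 1 - H 0.
  have [|x _ ->] := @MVT_le H e 0 1 ler01.
    by move=> x /andP[x0 _]; exact: dH.
  by rewrite subr0 mulr1.
have t01 : (1 + c * 0) * (H 1 - H 0) <= e 0 - e 1 by apply: Htail.
have t1 := Itail 1 ler01.
have I1 := IH 1 ler01.
rewrite gE; apply/andP; split; first by lra.
have e0 : e 0 = 1 by rewrite /e phi0 oppr0 expR0.
rewrite e0 in t01; have e1 := e_gt0 1.
(* Strictness of [g 0 < 1] is gained beyond [1], where the factor [1 + c] exceeds one. *)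
have : I - H 1 < e 1.
  rewrite ltNge; apply/negP => h; have h0 : 0 < I - H 1 by lra.
  by have := mulr_gt0 c_gt0 h0; lra.
by lra.
Qed.

End ProfileExists.

(** * Bounds by powers of the community size *)

Section Scaling.
Context (R : realType) (N : nat) (alpha beta : R).
Hypotheses (N_gt0 : (0 < N)%N) (beta_gt0 : 0 < beta).

Local Notation p x := ((N%:R : R) `^ x).
Let w : R := p (- beta).
Let q : R := p alpha.
Let M : R := q + N%:R * (1 + w).
Let T : R := q + 2 * N%:R * w.

Let nN : 0 < N%:R :> R. Proof. by rewrite ltr0n. Qed.
Let nN1 : 1 <= N%:R :> R. Proof. by rewrite ler1n. Qed.
Let pD x y : p (x + y) = p x * p y.
Proof. by apply: powRD; apply/implyP => _; rewrite gt_eqF. Qed.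
Let p_gt0 x : 0 < p x. Proof. exact: powR_gt0. Qed.
Let p_ge0 x : 0 <= p x. Proof. exact: ltW. Qed.
Let p1 : p 1 = N%:R. Proof. by rewrite powRr1 // ltW. Qed.
Let p_mono x y : x <= y -> p x <= p y. Proof. exact: ler_powR. Qed.
Let p_le1 (x : R) : x <= 0 -> p x <= 1. Proof. by move=> /p_mono; rewrite powRr0. Qed.
Let p_ge1 (x : R) : 0 <= x -> 1 <= p x. Proof. by move=> /p_mono; rewrite powRr0. Qed.
Let p_half : p 2^-1 * p 2^-1 = N%:R.
Proof. by rewrite -pD -[RHS]p1; congr (_ `^ _); field. Qed.
Let div_p x y : p x / p y = p (x - y).
Proof. by rewrite pD powRN. Qed.
Let div_N x : p x / N%:R = p (x - 1).
Proof. by rewrite -div_p p1. Qed.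

Let w_gt0 : 0 < w. Proof. exact: p_gt0. Qed.
Let w_le1 : w <= 1. Proof. by apply: p_le1; rewrite oppr_le0 ltW. Qed.
Let q_gt0 : 0 < q. Proof. exact: p_gt0. Qed.
Let T_gt0 : 0 < T. Proof. by rewrite addr_gt0 // !mulr_gt0. Qed.
Let M_gt0 : 0 < M. Proof. by rewrite addr_gt0 // mulr_gt0 // addr_gt0. Qed.

Local Notation mass := (mass N w q).
Local Notation len_sum := (len_sum N w q).
Local Notation mass1 := (mass1 N w q).
Local Notation mass2 := (mass2 N w q).
Local Notation a_sum2 := (a_sum2 N w q).
Local Notation b_sum1 := (b_sum1 N w q).
Local Notation Uo := (U_out N 1 w q).
Local Notation Ui := (U_in N 1 w q).
Local Notation V := ((N%:R - 1) / N%:R * Ui).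

Let A1_0 : 0 <= mass1. Proof. exact: mass1_ge0. Qed.
Let A2_0 : 0 <= mass2. Proof. exact: mass2_ge0. Qed.
Let a2_0 : 0 <= a_sum2. Proof. exact: a_sum2_ge0. Qed.
Let b1_0 : 0 <= b_sum1. Proof. exact: b_sum1_ge0. Qed.
Let A_0 : 0 <= mass. Proof. exact: addr_ge0. Qed.
Let K_0 : 0 <= len_sum. Proof. exact: len_sum_ge0. Qed.

Let NwE : N%:R * w = p (1 - beta). Proof. by rewrite pD p1. Qed.

Lemma rate_le1 : q / T <= 1.
Proof. by rewrite ler_pdivrMr // mul1r lerDl !mulr_ge0 // ltW. Qed.

Lemma rate_le : q / T <= p (alpha + beta - 1).
Proof.
have -> : p (alpha + beta - 1) = q / (N%:R * w).
  by rewrite NwE div_p; congr (_ `^ _); ring.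
rewrite ler_pM2l // lef_pV2 ?posrE ?mulr_gt0 //.
have := mulr_gt0 nN w_gt0; have := q_gt0; rewrite /T; lra.
Qed.

Lemma crossing_rate_le : N%:R * w / T <= p (1 - beta - alpha).
Proof.
have -> : p (1 - beta - alpha) = N%:R * w / q by rewrite NwE div_p.
rewrite ler_pM2l ?mulr_gt0 // lef_pV2 ?posrE //.
have := mulr_gt0 nN w_gt0; have := q_gt0; rewrite /T; lra.
Qed.

(** * Exponents [alpha] up to one half *)

Section SmallAlpha.
Hypothesis alpha_le : alpha <= 2^-1.

Let q_leN : q <= N%:R.
Proof.
by rewrite -[leRHS]p1; apply: p_mono; apply: le_trans alpha_le _; rewrite invf_le1 ?ler1n.
Qed.
Lemma total_rate_leN : M <= 3 * N%:R.
Proof. by have := q_leN; have := ler_piMr (ltW nN) w_le1; rewrite /M; lra. Qed.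

(** [mass_le] at [l = sqrt N]; the constant is [1 + 6], from [M <= 3 N]. *)
Lemma mass_le_half : mass <= 7 * p 2^-1.
Proof.
have l1 : 1 <= p 2^-1 by exact: p_ge1.
have e : N%:R / p 2^-1 = p 2^-1 by rewrite -[X in X / _]p_half mulfK // gt_eqF.
apply: le_trans (mass_le w_gt0 w_le1 q_gt0 N_gt0 l1) _; rewrite -/M.
suff : 2 * M / p 2^-1 <= 6 * p 2^-1 by lra.
rewrite -[in leRHS]e mulrA ler_pM2r ?invr_gt0 //; have := total_rate_leN; lra.
Qed.

Let hA_le : q / N%:R * mass <= 7 * p (alpha - 2^-1).
Proof.
have -> : 7 * p (alpha - 2^-1) = q / N%:R * (7 * p 2^-1).
  by rewrite div_N mulrCA -pD; congr (_ * _ `^ _); field.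
by rewrite ler_pM2l ?divr_gt0 // mass_le_half.
Qed.

Lemma b_sum1_leN : b_sum1 / N%:R <= 3.
Proof.
by rewrite ler_pdivrMr //; apply: le_trans total_rate_leN; apply: b_sum1_le.
Qed.

Lemma a_sum2_leN : a_sum2 / N%:R <= 3.
Proof.
by rewrite ler_pdivrMr //; apply: le_trans total_rate_leN; apply: a_sum2_le_total.
Qed.

Lemma b_sum1_small : b_sum1 / N%:R <= 7 * p (2^-1 - beta).
Proof.
have -> : 7 * p (2^-1 - beta) = w * (7 * p 2^-1) by rewrite pD -/w; ring.
rewrite ler_pdivrMr //; apply: le_trans (b_sum1_le_mass w_gt0 w_le1 q_gt0 N_gt0) _.
by rewrite -[leLHS]mulrA -[leRHS]mulrA ler_pM2l // mulrC ler_pM2r // mass_le_half.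
Qed.

(** The cut-off length is [N^x], useful for [x] strictly between [1/2] and [beta]. The constant is
    [3], from [M <= 3 N], times [8], from [1 + mass <= 8 sqrt N]. *)
Let a_sum2_small x : 0 <= x -> a_sum2 / N%:R <= p (x - beta) + 24 * p (2^-1 - x).
Proof.
move=> x0; have l1 : 1 <= p x by exact: p_ge1.
rewrite ler_pdivrMr //; apply: le_trans (a_sum2_le_cutoff w_gt0 w_le1 q_gt0 N_gt0 l1) _.
rewrite [leRHS]mulrDl [p (x - beta)]pD -/w lerD2l -/M.
have l2 : 1 <= p 2^-1 by exact: p_ge1.
have -> : 24 * p (2^-1 - x) * N%:R = (3 * N%:R) * (8 * p 2^-1) / p x.
  by rewrite [p (2^-1 - x)]pD powRN; ring.
rewrite ler_pM2r ?invr_gt0 //; apply: ler_pM; [exact: ltW | exact: addr_ge0 | exact: total_rate_leN |].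
by have := mass_le_half; lra.
Qed.

Lemma len_sum_leN : len_sum <= 6 * N%:R.
Proof.
by apply: le_trans (len_sum_le w_gt0 w_le1 q_gt0 N_gt0) _; have := total_rate_leN; rewrite -/M; lra.
Qed.

Let h_gt0 : 0 < q / N%:R. Proof. exact: divr_gt0. Qed.
Let r_gt0 : 0 < q / T. Proof. exact: divr_gt0. Qed.

Lemma U_out_near1 : `|Uo - 1| <= 6 * p (1 - beta - alpha) + 3 * p (- beta).
Proof.
have /andP[h1 h2] := U_out_ge w_gt0 w_le1 q_gt0 N_gt0; rewrite -/M in h2.
rewrite distrC ger0_norm //; apply: le_trans h2 _; apply: lerD.
  have -> : 6 * p (1 - beta - alpha) = 2 * w * ((3 * N%:R) / q).
    by rewrite -(div_p (1 - beta) alpha) -NwE -/q; ring.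
  by rewrite ler_pM2l ?mulr_gt0 // ler_pM2r ?invr_gt0 // total_rate_leN.
by rewrite mulrC ler_pM2r // ler_pdivrMr // total_rate_leN.
Qed.

Lemma U_out_near0 : `|Uo| <= 7 * p (alpha + beta - 1) + 14 * p (alpha - 2^-1).
Proof.
have := U_out_error w_gt0 w_le1 q_gt0 N_gt0; rewrite -/T => h.
have -> : Uo = (Uo - q / T * ((1 - w) / (1 + w))) + q / T * ((1 - w) / (1 + w)) by ring.
apply: le_trans (ler_normD _ _) _; apply: le_trans (lerD h (lexx _)) _.
have e1 : `|q / T * ((1 - w) / (1 + w))| <= q / T.
  rewrite ger0_norm; last first.
    by rewrite mulr_ge0 ?(ltW r_gt0) // divr_ge0 ?subr_ge0 // addr_ge0 // ltW.
  rewrite ler_piMr ?(ltW r_gt0) // ler_pdivrMr ?addr_gt0 // mul1r.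
  by have := w_gt0; lra.
have e2 : (a_sum2 + w * b_sum1) / N%:R <= 6.
  rewrite mulrDl; have : w * b_sum1 / N%:R <= 3.
    by rewrite -mulrA -[leRHS]mul1r ler_pM ?b_sum1_leN ?divr_ge0 // ltW.
  by have := a_sum2_leN; lra.
have e3 : q / T * ((a_sum2 + w * b_sum1) / N%:R) <= q / T * 6 by rewrite ler_pM2l.
by have := rate_le; have := hA_le; lra.
Qed.

Lemma U_out_critical x : 0 <= x -> alpha = 1 - beta ->
  `|Uo - 3^-1| <= p (x - beta) + 24 * p (2^-1 - x) + 4 * p (- beta) + 14 * p (alpha - 2^-1).
Proof.
move=> x0 ab; have qNw : q = N%:R * w by rewrite NwE /q ab.
have := U_out_error w_gt0 w_le1 q_gt0 N_gt0; rewrite -/T => h.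
have r3 : q / T = 3^-1.
  have -> : T = 3 * q by rewrite /T -mulrA -qNw; ring.
  by field; rewrite gt_eqF.
have -> : Uo - 3^-1 = (Uo - q / T * ((1 - w) / (1 + w))) - 3^-1 * (2 * w / (1 + w)).
  by rewrite r3; field; rewrite gt_eqF // addr_gt0.
apply: le_trans (ler_normB _ _) _; apply: le_trans (lerD h (lexx _)) _.
have e1 : `|3^-1 * (2 * w / (1 + w))| <= w.
  rewrite ger0_norm; last by rewrite !mulr_ge0 ?invr_ge0 ?addr_ge0 // ltW.
  rewrite mulrA ler_pdivrMr ?addr_gt0 //.
  by have := mulr_ge0 (ltW w_gt0) (ltW w_gt0); have := w_gt0; lra.
have e2 : (a_sum2 + w * b_sum1) / N%:R <= (p (x - beta) + 24 * p (2^-1 - x)) + 3 * w.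
  rewrite mulrDl; apply: lerD; first exact: a_sum2_small.
  by rewrite -mulrA mulrC ler_pM2r // b_sum1_leN.
have e3 : q / T * ((a_sum2 + w * b_sum1) / N%:R) <= (a_sum2 + w * b_sum1) / N%:R.
  by rewrite ler_piMl ?rate_le1 // divr_ge0 // addr_ge0 // mulr_ge0 // ltW.
by have := hA_le; rewrite -/w; lra.
Qed.

Lemma U_in_walk_error : `|V - q / N%:R * mass1| <=
  2 * p (alpha - 1) + q / N%:R * (N%:R * w / T * mass) + q / T * (b_sum1 / N%:R) + 3 * p (- beta).
Proof.
have := U_in_error w_gt0 w_le1 q_gt0 N_gt0; rewrite -/T => h.
apply: le_trans h _; rewrite div_N [(b_sum1 + _) / _]mulrDl [q / T * (_ + _)]mulrDr.
have h0 : 0 <= w * a_sum2 / N%:R by rewrite divr_ge0 ?mulr_ge0 // ltW.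
have h1 := ler_piMl h0 rate_le1.
have h2 : w * a_sum2 / N%:R <= 3 * w by rewrite -mulrA mulrC ler_pM2r // a_sum2_leN.
by rewrite -/w; lra.
Qed.

Let U_in_near0 : `|V| <=
  2 * p (alpha - 1) + 14 * p (alpha - 2^-1) + q / T * (b_sum1 / N%:R) + 3 * p (- beta).
Proof.
have -> : V = (V - q / N%:R * mass1) + q / N%:R * mass1 by ring.
apply: le_trans (ler_normD _ _) _; apply: le_trans (lerD U_in_walk_error (lexx _)) _.
have h1 : `|q / N%:R * mass1| <= q / N%:R * mass.
  rewrite ger0_norm; last by rewrite mulr_ge0 // ltW.
  by rewrite ler_pM2l // lerDl.
have h2 : q / N%:R * (N%:R * w / T * mass) <= q / N%:R * mass.
  rewrite ler_pM2l // ler_piMl // ler_pdivrMr // mul1r /T.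
  by have := mulr_gt0 nN w_gt0; have := q_gt0; lra.
by have := hA_le; lra.
Qed.

(** In the product of [q / T] and [b_sum1 / N], the small factor is here the second, for
    [beta > 1/2]; in [U_in_near0_fast] it is the first. *)
Lemma U_in_near0_slow : `|V| <=
  2 * p (alpha - 1) + 14 * p (alpha - 2^-1) + 7 * p (2^-1 - beta) + 3 * p (- beta).
Proof.
apply: le_trans U_in_near0 _; rewrite lerD2r lerD2l; apply: le_trans b_sum1_small.
by rewrite ler_piMl ?rate_le1 // divr_ge0.
Qed.

Lemma U_in_near0_fast : `|V| <=
  2 * p (alpha - 1) + 14 * p (alpha - 2^-1) + 3 * p (alpha + beta - 1) + 3 * p (- beta).
Proof.
apply: le_trans U_in_near0 _; rewrite lerD2r lerD2l.
apply: (@le_trans _ _ (q / T * 3)); first by rewrite ler_pM2l // b_sum1_leN.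
by rewrite mulrC ler_pM2l // rate_le.
Qed.

End SmallAlpha.

(** * The critical exponent [alpha = 1/2] *)

Section HalfAlpha.
Hypothesis alpha_half : alpha = 2^-1.
Variable g : R -> R.

Let alpha_le : alpha <= 2^-1. Proof. by rewrite alpha_half. Qed.
Let qE : q = p 2^-1. Proof. by rewrite /q alpha_half. Qed.
Let qqN : q * q = N%:R. Proof. by rewrite qE p_half. Qed.
Let q_neq0 : q != 0. Proof. by rewrite gt_eqF. Qed.
Let qV : q^-1 = p (- 2^-1). Proof. by rewrite powRN qE. Qed.
Let qN : q / N%:R = p (- 2^-1).
Proof. by rewrite div_N alpha_half; congr (_ `^ _); field. Qed.
Let A_q : mass <= 7 * q. Proof. by rewrite [X in _ * X]qE; exact: mass_le_half. Qed.
Let AN : mass / N%:R <= 7 * p (- 2^-1).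
Proof.
rewrite -qN; have -> : 7 * (q / N%:R) = (7 * q) / N%:R by ring.
by rewrite ler_pM2r ?invr_gt0.
Qed.
Let KN : len_sum / N%:R <= 6. Proof. by rewrite ler_pdivrMr //; exact: len_sum_leN. Qed.
Let M_leN : M / N%:R <= 3. Proof. by rewrite ler_pdivrMr //; exact: total_rate_leN. Qed.
Let wA_le : w * mass <= 7 * p (2^-1 - beta).
Proof.
have -> : 7 * p (2^-1 - beta) = w * (7 * q) by rewrite pD -/w -qE; ring.
by rewrite ler_pM2l.
Qed.
Let hA7 : q / N%:R * mass <= 7.
Proof.
have -> : q / N%:R * mass = mass / q by rewrite -qqN; field.
by rewrite ler_pdivrMr.
Qed.
Let rate_half : q / T <= p (beta - 2^-1).
Proof.
have -> : beta - 2^-1 = alpha + beta - 1 by rewrite alpha_half; field.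
exact: rate_le.
Qed.

(** The walk starts with one visited vertex, at [1 / q] on the rescaled axis, and [M / N] is [1] up
    to [q / N + w]. *)
Let profile_start c : profile c g ->
  `|M * g q^-1 / N%:R - g 0| <= 2 * p (- 2^-1) + p (- beta).
Proof.
move=> [g01 glip _]; have q0 : 0 <= q^-1 by rewrite invr_ge0 ltW.
have /andP[x0 x1] := g01 _ q0.
have := glip 0 q^-1 (lexx _) q0; rewrite add0r => h1.
have -> : M * g q^-1 / N%:R - g 0 = (q / N%:R + w) * g q^-1 - (g 0 - g q^-1).
  by rewrite /M; field; rewrite gt_eqF.
apply: le_trans (ler_normB _ _) _.
have : `|(q / N%:R + w) * g q^-1| <= q / N%:R + w.
  have qw : 0 <= q / N%:R + w by apply: addr_ge0; [apply: divr_ge0|]; rewrite ltW.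
  by rewrite ger0_norm ?mulr_ge0 // ler_piMr.
by move: h1; rewrite qN qV -/w; lra.
Qed.

Lemma U_in_profile_slow : profile 1 g ->
  `|V - g 0| <= 31 * p (- 2^-1) + 35 * p (2^-1 - beta) + 4 * p (- beta).
Proof.
move=> pg; have h1 := U_in_walk_error alpha_le; have h3 := profile_start pg.
have h2 := mass1_profile w_gt0 w_le1 q_gt0 N_gt0 qqN pg; rewrite -/M in h2.
have -> : V - g 0 = (V - q / N%:R * mass1) - (M * g q^-1 - q * mass1) / N%:R
   + (M * g q^-1 / N%:R - g 0) by ring.
apply: le_trans (ler_normD _ _) _; apply: le_trans (lerD (ler_normB _ _) h3) _.
have e1 : `|(M * g q^-1 - q * mass1) / N%:R| <= 27 * p (- 2^-1) + 21 * p (2^-1 - beta).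
  rewrite normrM [`|_^-1|]gtr0_norm ?invr_gt0 //.
  apply: (@le_trans _ _ (3 * (mass / N%:R) + 2 * (w * mass) + q^-1 * (len_sum / N%:R) + b_sum1 / N%:R)).
    have -> : 3 * (mass / N%:R) + 2 * (w * mass) + q^-1 * (len_sum / N%:R) + b_sum1 / N%:R =
      ((3 + 2 * N%:R * w) * mass + q^-1 * len_sum + b_sum1) / N%:R.
      by field; rewrite q_neq0 gt_eqF.
    by rewrite ler_pM2r ?invr_gt0.
  have e : q^-1 * (len_sum / N%:R) <= q^-1 * 6 by rewrite ler_pM2l ?invr_gt0.
  by move: (b_sum1_small alpha_le) e AN wA_le; rewrite qV; lra.
have e2 : q / N%:R * (N%:R * w / T * mass) <= 7 * p (2^-1 - beta).
  have : N%:R * w / T <= p (2^-1 - beta).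
    have -> : 2^-1 - beta = 1 - beta - alpha by rewrite alpha_half; field.
    exact: crossing_rate_le.
  move=> e; have -> : q / N%:R * (N%:R * w / T * mass) = (q / N%:R * mass) * (N%:R * w / T) by ring.
  apply: ler_pM => //; first by rewrite mulr_ge0 // divr_ge0 // ltW.
  by rewrite divr_ge0 ?mulr_ge0 // ltW.
have e3 : q / T * (b_sum1 / N%:R) <= 7 * p (2^-1 - beta).
  apply: le_trans (b_sum1_small alpha_le).
  by rewrite ler_piMl ?rate_le1 // divr_ge0.
have e4 : p (alpha - 1) = p (- 2^-1) by rewrite alpha_half; congr (_ `^ _); field.
by move: h1; rewrite e4; lra.
Qed.

Let scaled_mass_profile : profile 2^-1 g ->
  `|q / N%:R * mass - g 0| <= 29 * p (- 2^-1) + 14 * p (- beta) + 33 * p (beta - 2^-1).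
Proof.
move=> pg; have h3 := profile_start pg.
have h2 := mass_profile w_gt0 w_le1 q_gt0 N_gt0 qqN pg; rewrite -/M -/T in h2.
have -> : q / N%:R * mass - g 0 = - ((M * g q^-1 - q * mass) / N%:R)
   + (M * g q^-1 / N%:R - g 0) by ring.
apply: le_trans (ler_normD _ _) _; rewrite normrN; apply: le_trans (lerD (lexx _) h3) _.
suff : `|(M * g q^-1 - q * mass) / N%:R| <=
   27 * p (- 2^-1) + 13 * p (- beta) + 33 * p (beta - 2^-1) by lra.
rewrite normrM [`|_^-1|]gtr0_norm ?invr_gt0 //.
apply: (@le_trans _ _ (3 * (mass / N%:R) + w * (q^-1 * mass) + q^-1 * (len_sum / N%:R) + w * (len_sum / N%:R)
    + M / N%:R * ((2 + 2 * mass + q^-1 * len_sum) / (2 * T)))).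
  have -> : 3 * (mass / N%:R) + w * (q^-1 * mass) + q^-1 * (len_sum / N%:R) + w * (len_sum / N%:R)
    + M / N%:R * ((2 + 2 * mass + q^-1 * len_sum) / (2 * T)) =
    ((3 + N%:R * w * q^-1) * mass + (q^-1 + w) * len_sum + M * (2 + 2 * mass + q^-1 * len_sum) / (2 * T)) / N%:R.
    by field; rewrite q_neq0 !gt_eqF.
  by rewrite ler_pM2r ?invr_gt0.
have e1 : w * (q^-1 * mass) <= w * 7.
  by rewrite ler_pM2l // mulrC ler_pdivrMr.
have e2 : q^-1 * (len_sum / N%:R) <= q^-1 * 6 by rewrite ler_pM2l ?invr_gt0.
have e3 : w * (len_sum / N%:R) <= w * 6 by rewrite ler_pM2l.
have e4 : M / N%:R * ((2 + 2 * mass + q^-1 * len_sum) / (2 * T)) <= 33 * (q / T).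
  have -> : 33 * (q / T) = 3 * ((22 * q) / (2 * T)) by field; rewrite gt_eqF.
  have q1 : 1 <= q by rewrite qE; exact: p_ge1.
  have Kq : q^-1 * len_sum <= 6 * q.
    by rewrite mulrC ler_pdivrMr // -mulrA qqN; exact: len_sum_leN.
  have Kq0 : 0 <= q^-1 * len_sum by rewrite mulr_ge0 // invr_ge0 ltW.
  apply: ler_pM => //.
  - by rewrite divr_ge0 // ltW.
  - by apply: divr_ge0; [have := A_0; lra | rewrite mulr_ge0 // ltW].
  - by rewrite ler_pM2r ?invr_gt0 ?mulr_gt0 //; have := A_q; lra.
by have := rate_half; rewrite -/w; move: e1 e2 e4; rewrite qV; have := AN; lra.
Qed.

Let difference_le : q / T + q / T * ((a_sum2 + b_sum1) / N%:R) +
    q / N%:R * (q / T * mass + 2 * w * mass + (mass1 - mass2) / 2) <=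
  21 * p (beta - 2^-1) + 14 * p (- beta).
Proof.
have r0 : 0 < q / T by rewrite divr_gt0.
have e1 : q / T * ((a_sum2 + b_sum1) / N%:R) <= q / T * 6.
  by rewrite ler_pM2l // mulrDl; have := a_sum2_leN alpha_le; have := b_sum1_leN alpha_le; lra.
have e2 : q / N%:R * (q / T * mass) <= q / T * 7 by rewrite mulrCA ler_pM2l.
have e3 : q / N%:R * (w * mass) <= w * 7 by rewrite mulrCA ler_pM2l.
(* The constant is [7 + 6], from [q * mass <= 7 N] and [2 M <= 6 N]. *)
have e4 : q / N%:R * (mass1 - mass2) <= 13 * p (beta - 2^-1).
  have := mass1_sub_mass2_le w_gt0 w_le1 q_gt0 N_gt0; rewrite -/M => h.
  have h' : w * N%:R * (mass1 - mass2) <= 13 * N%:R.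
    apply: le_trans h _; have := total_rate_leN alpha_le.
    have : q * mass <= 7 * N%:R by rewrite -qqN mulrCA ler_pM2l.
    by lra.
  have -> : 13 * p (beta - 2^-1) = q / N%:R * (13 / w).
    by rewrite qN mulrCA /w -powRN opprK -pD; congr (_ * _ `^ _); ring.
  rewrite ler_pM2l ?divr_gt0 // ler_pdivlMr // -(ler_pM2r nN).
  by apply: le_trans h'; rewrite le_eqVlt; apply/orP; left; apply/eqP; ring.
by have := rate_half; rewrite -/w; lra.
Qed.

Lemma U_out_profile : profile 2^-1 g ->
  `|Uo - g 0| <= 29 * p (- 2^-1) + 28 * p (- beta) + 54 * p (beta - 2^-1).
Proof.
move=> pg; have h1 := scaled_mass_profile pg.
have h2 := U_out_diff w_gt0 w_le1 q_gt0 N_gt0; rewrite -/T in h2.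
have -> : Uo - g 0 = (Uo - q / N%:R * mass) + (q / N%:R * mass - g 0) by ring.
apply: le_trans (ler_normD _ _) _; apply: le_trans (lerD h2 h1) _.
by have := difference_le; lra.
Qed.

Lemma U_in_profile_fast : profile 2^-1 g ->
  `|V - g 0| <= 31 * p (- 2^-1) + 28 * p (- beta) + 54 * p (beta - 2^-1).
Proof.
move=> pg; have h1 := scaled_mass_profile pg.
have h2 := U_in_diff w_gt0 w_le1 q_gt0 N_gt0; rewrite -/T in h2.
have -> : V - g 0 = (V - q / N%:R * mass) + (q / N%:R * mass - g 0) by ring.
apply: le_trans (ler_normD _ _) _; apply: le_trans (lerD h2 h1) _.
have := difference_le; have : 0 < q / T by rewrite divr_gt0.
by rewrite qN; lra.
Qed.

End HalfAlpha.

(** * Strong killing *)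

Section LargeAlpha.

(** Killing at rate [q] alone bounds [mass] by [M / q] and [len_sum] by [M / q * (1 + mass)]. The
    last term, [P * P / N], is the one that needs [alpha > 1/2] to vanish. *)
Let K_small : len_sum / N%:R <= 2 * p (- 1) + 6 * p (- alpha) + 4 * p (1 - 2 * alpha).
Proof.
pose P := p (1 - alpha).
have PE : P = N%:R / q by rewrite /P -div_p p1.
have P0 : 0 < P by exact: p_gt0.
have Mq : M / q <= 1 + 2 * P.
  have -> : M / q = 1 + (1 + w) * P by rewrite PE /M; field; rewrite gt_eqF.
  by rewrite lerD2l ler_pM2r //; have := w_le1; lra.
have A_Mq : mass <= M / q by rewrite ler_pdivlMr // mulrC; exact: kill_mass_le.
have KM : len_sum <= M / q * (1 + mass).
  by rewrite mulrAC ler_pdivlMr // mulrC; exact: kill_len_sum_le.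
have -> : 2 * p (- 1) + 6 * p (- alpha) + 4 * p (1 - 2 * alpha) =
    ((1 + 2 * P) * (2 + 2 * P)) / N%:R.
  have -> : p (- 1) = N%:R^-1 by rewrite powRN p1.
  have -> : p (- alpha) = P / N%:R by rewrite /P div_N; congr (_ `^ _); ring.
  have -> : p (1 - 2 * alpha) = P * P / N%:R.
    by rewrite /P -pD div_N; congr (_ `^ _); ring.
  by ring.
rewrite ler_pM2r ?invr_gt0 //; apply: le_trans KM _; apply: ler_pM.
- by rewrite divr_ge0 // ltW.
- by rewrite addr_ge0.
- exact: Mq.
- by have := le_trans A_Mq Mq; lra.
Qed.

Lemma U_out_large : `|Uo - 1| <= 4 * p (- 1) + 12 * p (- alpha) + 8 * p (1 - 2 * alpha).
Proof.
have /andP[h1 _] := U_out_ge w_gt0 w_le1 q_gt0 N_gt0.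
rewrite distrC ger0_norm //; have := U_out_small w_gt0 w_le1 q_gt0 N_gt0 => h.
have : 1 - Uo <= 2 * (len_sum / N%:R) by rewrite mulrA ler_pdivlMr // mulrC.
by have := K_small; lra.
Qed.

Lemma U_in_large : (1 < N)%N ->
  `|Ui - 1| <= 10 * p (- 1) + 24 * p (- alpha) + 16 * p (1 - 2 * alpha).
Proof.
move=> N1; have /andP[h1 h2] := U_in_small w_gt0 w_le1 q_gt0 N_gt0.
have N2 : 2 <= N%:R :> R by rewrite ler_nat.
have h3 : (N%:R - 1) * `|Ui - 1| <= 2 * len_sum + 1.
  rewrite -[X in X * _]ger0_norm; last by lra.
  by rewrite -normrM ler_norml; apply/andP; split; have := K_0; lra.
have h4 : N%:R * `|Ui - 1| <= 4 * len_sum + 2.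
  apply: (@le_trans _ _ (2 * ((N%:R - 1) * `|Ui - 1|))); last by lra.
  by rewrite mulrA ler_wpM2r //; lra.
have h5 : `|Ui - 1| <= 4 * (len_sum / N%:R) + 2 * p (- 1).
  have -> : 4 * (len_sum / N%:R) + 2 * p (- 1) = (4 * len_sum + 2) / N%:R by rewrite powRN p1; ring.
  by rewrite ler_pdivlMr // mulrC.
by have := K_small; lra.
Qed.

End LargeAlpha.

Lemma U_in_rescaled L : (1 < N)%N -> `|Ui - L| <= 2 * `|V - L| + 2 * `|L| * p (- 1).
Proof.
move=> N1; have N2 : 2 <= N%:R :> R by rewrite ler_nat.
have n0 : 0 < N%:R - 1 :> R by lra.
have -> : Ui - L = N%:R / (N%:R - 1) * (V - L) + L * (N%:R - 1)^-1.
  by field; rewrite !gt_eqF.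
apply: le_trans (ler_normD _ _) _; rewrite !normrM; apply: lerD.
  rewrite ler_wpM2r // -normrM ger0_norm; last by rewrite divr_ge0 // ltW.
  by rewrite ler_pdivrMr //; lra.
have -> : 2 * `|L| * p (- 1) = `|L| * (2 / N%:R) by rewrite powRN p1; ring.
rewrite ler_wpM2l // gtr0_norm ?invr_gt0 // ler_pdivlMr // mulrC ler_pdivrMr //; lra.
Qed.

End Scaling.

(** * Limits *)

Section Limits.
Context (R : realType).
Implicit Types (u v b : nat -> R) (l x : R).

Lemma cvg0_powR x : x < 0 -> (fun N : nat => N%:R `^ x : R) @ \oo --> (0 : R).
Proof.
move=> x0; apply/cvgrPdist_le => e e0.
exists (Num.bound (e `^ x^-1)).+1 => // N /= hN.
have n0 : 0 < N%:R :> R by rewrite ltr0n; apply: leq_trans hN.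
rewrite sub0r normrN ger0_norm ?powR_ge0 //.
have eN : e `^ x^-1 <= N%:R.
  apply/ltW/(lt_le_trans (archi_boundP (powR_ge0 _ _))).
  by rewrite ler_nat ltnW.
have -> : e = (e `^ x^-1) `^ x by rewrite -powRrM mulVf ?lt_eqF // powRr1 // ltW.
have pV (z : R) : z `^ x = (z `^ (- x))^-1 by rewrite powRN invrK.
rewrite pV [leRHS]pV lef_pV2 ?posrE ?powR_gt0 //.
by apply: ge0_ler_powR; rewrite ?nnegrE ?powR_ge0 ?oppr_ge0 ?(ltW x0) ?(ltW n0).
Qed.

Lemma cvg0D u v : u @ \oo --> (0 : R) -> v @ \oo --> (0 : R) ->
  (fun N => u N + v N) @ \oo --> (0 : R).
Proof. by move=> hu hv; rewrite -[X in _ --> X]addr0; exact: cvgD. Qed.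

Lemma cvg0Z l u : u @ \oo --> (0 : R) -> (fun N => l * u N) @ \oo --> (0 : R).
Proof. by move=> hu; rewrite -[X in _ --> X](mulr0 l); apply: cvgM => //; exact: cvg_cst. Qed.

Lemma cvg_error_bound u b l : (forall N, (1 < N)%N -> `|u N - l| <= b N) ->
  b @ \oo --> (0 : R) -> u @ \oo --> l.
Proof.
move=> ub b0; apply/subr_cvg0/norm_cvg0P.
apply: (@squeeze_cvgr _ _ _ _ (fun=> 0) b) => //; last exact: cvg_cst.
by exists 2%N => // N /= N2; rewrite normr_ge0 ub.
Qed.

End Limits.

Ltac cvg0_bound :=
  repeat (first [apply: cvg0D | apply: cvg0Z]); apply: cvg0_powR; lra.

Theorem theorem3 (R : realType) (alpha beta : R) (hbeta : 0 < beta) :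
  let Uin : nat -> R := fun N => U_in N 1 (N%:R `^ (- beta)) (N%:R `^ alpha) in
  let Uout : nat -> R := fun N => U_out N 1 (N%:R `^ (- beta)) (N%:R `^ alpha) in
  (* (a) *)
  (1 - beta < alpha -> alpha = 2^-1 ->
     (Uout @ \oo --> (1 : R)) /\
     (exists eps0 : R, 0 < eps0 < 1 /\ (Uin @ \oo --> eps0))) /\
  (* (b) *)
  (1 - beta < alpha -> alpha < 2^-1 ->
     (Uout @ \oo --> (1 : R)) /\ (Uin @ \oo --> (0 : R))) /\
  (* (c) *)
  (alpha = 1 - beta -> 1 - beta < 2^-1 ->
     (exists eps2 : R, 0 < eps2 < 1 /\ (Uout @ \oo --> eps2)) /\
     (Uin @ \oo --> (0 : R))) /\
  (* (d) *)
  (alpha < Num.min 2^-1 (1 - beta) ->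
     (Uin @ \oo --> (0 : R)) /\ (Uout @ \oo --> (0 : R))) /\
  (* (e) *)
  (alpha = 2^-1 -> 2^-1 < 1 - beta ->
     exists eps1 : R, 0 < eps1 < 1 /\
       (Uin @ \oo --> eps1) /\ (Uout @ \oo --> eps1)) /\
  (* (f) *)
  (2^-1 < alpha ->
     (Uin @ \oo --> (1 : R)) /\ (Uout @ \oo --> (1 : R))).
Proof.
move=> Uin Uout.
have Uin_cvg (l : R) (b : nat -> R) :
    (forall N, (1 < N)%N -> `|(N%:R - 1) / N%:R * Uin N - l| <= b N) ->
    b @ \oo --> (0 : R) -> Uin @ \oo --> l.
  move=> hb b0; apply: (@cvg_error_bound _ _ (fun N => 2 * b N + 2 * `|l| * N%:R `^ (- 1))).
    move=> N N1; apply: le_trans (U_in_rescaled alpha beta (ltnW N1) l N1) _.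
    by rewrite lerD2r ler_wpM2l // hb.
  by apply: cvg0D; apply: cvg0Z => //; apply: cvg0_powR; lra.
(* Shared by (b) and (c); the two assumptions force [beta > 1/2]. *)
have Uin_slow : 1 - beta <= alpha -> alpha < 2^-1 -> Uin @ \oo --> (0 : R).
  move=> h1 h2; apply: Uin_cvg => [N N1|].
    by rewrite subr0; apply: (U_in_near0_slow (ltnW N1) hbeta (ltW h2)).
  by cvg0_bound.
have Uout_one : 1 - beta < alpha -> alpha <= 2^-1 -> Uout @ \oo --> (1 : R).
  move=> h1 h2; apply: cvg_error_bound => [N N1|].
    exact: (U_out_near1 (ltnW N1) hbeta h2).
  by cvg0_bound.
split; last (split; last (split; last (split; last split))).
- move=> h1 h2; split; first by apply: Uout_one => //; rewrite h2.
  have [g [pg g01]] := @profile_exists R 1 ltr01.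
  exists (g 0); split => //; apply: Uin_cvg => [N N1|].
    exact: (U_in_profile_slow (ltnW N1) hbeta h2 pg).
  by rewrite h2 in h1; cvg0_bound.
- move=> h1 h2; split; first by apply: Uout_one => //; exact: ltW.
  by apply: Uin_slow => //; exact: ltW.
- move=> h1 h2; split; last by apply: Uin_slow; lra.
  exists 3^-1; split; first by lra.
  (* The midpoint of [1/2] and [beta], where [beta > 1/2] in this case: both [N^(x - beta)] and
     [N^(1/2 - x)] vanish. *)
  pose x := (2^-1 + beta) / 2.
  apply: cvg_error_bound => [N N1|].
    have x0 : 0 <= x by rewrite /x; lra.
    have h3 : alpha <= 2^-1 by lra.
    exact: (U_out_critical (ltnW N1) hbeta h3 x0 h1).
  by rewrite /x; cvg0_bound.
- rewrite lt_min => /andP[h1 h2]; split.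
    apply: Uin_cvg => [N N1|].
      by rewrite subr0; apply: (U_in_near0_fast (ltnW N1) hbeta (ltW h1)).
    by cvg0_bound.
  apply: cvg_error_bound => [N N1|].
    by rewrite subr0; apply: (U_out_near0 (ltnW N1) hbeta (ltW h1)).
  by cvg0_bound.
- move=> h1 h2; have c0 : 0 < 2^-1 :> R by lra.
  have [g [pg g01]] := profile_exists c0; exists (g 0); split => //; split.
    apply: Uin_cvg => [N N1|]; first exact: (U_in_profile_fast (ltnW N1) hbeta h1 pg).
    by cvg0_bound.
  apply: cvg_error_bound => [N N1|]; first exact: (U_out_profile (ltnW N1) hbeta h1 pg).
  by cvg0_bound.
- move=> h1; split.
    apply: cvg_error_bound => [N N1|]; first exact: (U_in_large alpha (ltnW N1) hbeta N1).
    by cvg0_bound.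
  apply: cvg_error_bound => [N N1|]; first exact: (U_out_large alpha (ltnW N1) hbeta).
  by cvg0_bound.
Qed.
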